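(* Let $f:\mathbb{R}\to\mathbb{R}$ be of class $C^2$ and let $u:\mathbb{R}^2\to\mathbb{R}$, $(t,x)\mapsto u(t,x)$, be continuous. Suppose that the distribution $\partial_t u+\partial_x(f(u))$ on $\mathbb{R}^2$ is represented by a bounded function. If $\mathcal{L}^1(\operatorname{clos}(\operatorname{Infl}(f)))=0$, then the family of Broad sources of $u$ and the family of Eulerian sources of $u$ have nonempty intersection; that is, there is a bounded Borel function $\mathfrak{g}:\mathbb{R}^2\to\mathbb{R}$ which is both an Eulerian source and a Broad source.
   Context: $\mathcal{L}^d$ is $d$-dimensional Lebesgue measure. A point $z^*\in\mathbb{R}$ is an inflection point of $f$ if $f''(z^* )=0$ and $z^*$ is neither a local maximum nor a local minimum of $z\mapsto f(z)-f'(z^* )(z-z^* )$; $\operatorname{Infl}(f)$ is the set of inflection points and $\operatorname{clos}$ denotes closure. Equivalently, $\operatorname{clos}(\operatorname{Infl}(f))=\operatorname{Acc}(\{f''>0\})\cap\operatorname{Acc}(\{f''<0\})$, where $\operatorname{Acc}(X)$ is the set of accumulation points of $X$. A characteristic is a $C^1$ function $\gamma:I\to\mathbb{R}$ ($I$ an interval) with $\dot\gamma(t)=f'(u(t,\gamma(t)))$; the corresponding characteristic curve is $i_\gamma(t)=(t,\gamma(t))$. An Eulerian source is a bounded Borel function $\mathfrak{g}:\mathbb{R}^2\to\mathbb{R}$ such that $\partial_t u+\partial_x(f(u))=\mathfrak{g}$ in $\mathcal{D}'(\mathbb{R}^2)$. A Broad source is a bounded Borel function $\mathfrak{g}:\mathbb{R}^2\to\mathbb{R}$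 such that for every characteristic $\gamma:I\to\mathbb{R}$ one has $\frac{d}{dt}u(t,\gamma(t))=\mathfrak{g}(t,\gamma(t))$ in the sense of distributions on the interior of $I$.
   Formalization: clos(Infl(f)) is taken to be Acc({f''>0}) ∩ Acc({f''<0}), as in the context; for some fluxes with affine pieces this is strictly larger than the closure of the pointwise-defined inflection points, so the claimed equality fails and the negligibility hypothesis is then stronger. *)

(* Defs.v *)
From HB Require Import structures.
From mathcomp Require Import all_boot all_order all_algebra.
From mathcomp Require Import all_classical all_reals all_analysis.
From mathcomp Require Import lra.
Set Implicit Arguments.
Unset Strict Implicit.
Unset Printing Implicit Defensive.
Import Order.TTheory GRing.Theory Num.Theory.
Import numFieldNormedType.Exports.
Local Open Scope classical_set_scope.
Local Open Scope ring_scope.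

Section flux.
Context {R : realType}.
Implicit Type f : R -> R.

Definition C2 f : Prop :=
  [/\ forall z, derivable f z 1, forall z, derivable (derive1 f) z 1
    & continuous (derive1n 2 f)].

(* Extrema are not required to be strict, so affine pieces of f carry no
   inflection point. *)
Definition local_max (h : R -> R) (z : R) : Prop := \forall w \near z, h w <= h z.
Definition local_min (h : R -> R) (z : R) : Prop := \forall w \near z, h z <= h w.

Definition Infl f : set R := [set z | derive1n 2 f z = 0 /\
  let h := fun w => f w - derive1 f z * (w - z) in ~ local_max h z /\ ~ local_min h z].

(* The closure of the set of inflection points, in its characterization by
   accumulation points.  It contains closure (Infl f) and coincides with it as
   soon as f'' vanishes on no nonempty open set (closure_Infl_sub and
   closure_InflE below).  For a flux with affine pieces it can be larger: if f
   is 0 on ]-oo, 0] and, on the right of 0, f'' consists of dominant positive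
   bumps and small negative bumps, separated by intervals where f'' = 0 and
   accumulating at 0, then Infl f is empty although 0 is accumulated by both
   {f'' > 0} and {f'' < 0}.  The set below is the one whose complement is the
   set of points near which f is convex or concave. *)
Definition clos_Infl f : set R :=
  limit_point [set z | 0 < derive1n 2 f z] `&` limit_point [set z | derive1n 2 f z < 0].

Let mvt f (a b : R) : (forall z, derivable f z 1) -> a < b ->
  exists2 c, a < c < b & f b - f a = derive1 f c * (b - a).
Proof.
move=> df ab.
have dv x : x \in `]a, b[ -> is_derive x 1 f (derive1 f x).
  by move=> _; rewrite derive1E; apply: derivableP.
have cf : {within `[a, b], continuous f}.
  by apply: derivable_within_continuous => x _.
by have [c + ->] := MVT ab dv cf; rewrite in_itv; exists c.
Qed.

Let taylor f (z w : R) : C2 f -> w != z ->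
  exists d k, [/\ `|d - z| < `|w - z|, 0 < k &
    f w - derive1 f z * (w - z) = f z + derive1n 2 f d * k].
Proof.
move=> [d1 d2 _]; rewrite neq_lt => /orP[wz|zw].
- have [c /andP[wc cz] Ec] := mvt d1 wz.
  have [d /andP[cd dz] Ed] := mvt d2 cz.
  exists d, ((z - c) * (z - w)); split.
  + by rewrite !ltr0_norm ?subr_lt0//; lra.
  + by apply: mulr_gt0; lra.
  + rewrite -[derive1n 2 f d]/(derive1 (derive1 f) d) mulrA -Ed; nra.
- have [c /andP[wc cz] Ec] := mvt d1 zw.
  have [d /andP[cd dz] Ed] := mvt d2 wc.
  exists d, ((c - z) * (w - z)); split.
  + by rewrite !gtr0_norm ?subr_gt0//; lra.
  + by apply: mulr_gt0; lra.
  + rewrite -[derive1n 2 f d]/(derive1 (derive1 f) d) mulrA -Ed; nra.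
Qed.

Lemma closure_Infl_sub f : C2 f -> closure (Infl f) `<=` clos_Infl f.
Proof.
move=> f2.
have cl0 (A : set R) : (forall y, A y -> derive1n 2 f y <> 0) ->
  (forall z e, 0 < e -> Infl f z -> exists2 y, `|y - z| < e & A y) ->
  closure (Infl f) `<=` limit_point A.
  move=> A0 AI x clx; have fx0 : derive1n 2 f x = 0.
    have : closed [set y | derive1n 2 f y = 0].
      apply: (@preimage_closed _ _ (derive1n 2 f) [set y | y = 0]).
        by move=> y _; case: f2.
      exact: closed_eq.
    move=> /closure_id Z; have : closure [set y | derive1n 2 f y = 0] x.
      by apply: closureS clx => y [].
    by rewrite -Z.
  move=> U Ux; have : nbhs x U° by apply: nbhs_interior.
  move=> /clx[z [Iz /nbhs_ballP[e e0 zU]]].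
  have [y yz Ay] := AI z e e0 Iz; exists y; split=> //.
    by apply/eqP => yx; apply: (A0 y Ay); rewrite yx.
  by apply: zU; rewrite /ball/= distrC.
move=> x clx; split; move: x clx; apply: cl0.
- by move=> y /= + y0; rewrite y0 ltxx.
- move=> z e e0 [fz0 [nmax _]]; apply: contrapT => no; apply: nmax.
  near=> w; rewrite subrr mulr0 subr0.
  have [->|wz] := eqVneq w z; first by rewrite subrr mulr0 subr0.
  have [d [k [dz k0 ->]]] := taylor f2 wz.
  rewrite gerDl pmulr_lle0// leNgt; apply/negP => fd; apply: no; exists d => //.
  apply: lt_trans dz _; rewrite distrC; near: w; exact: nbhsx_ballx.
- by move=> y /= + y0; rewrite y0 ltxx.
- move=> z e e0 [fz0 [_ nmin]]; apply: contrapT => no; apply: nmin.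
  near=> w; rewrite subrr mulr0 subr0.
  have [->|wz] := eqVneq w z; first by rewrite subrr mulr0 subr0.
  have [d [k [dz k0 ->]]] := taylor f2 wz.
  rewrite lerDl pmulr_lge0// leNgt; apply/negP => fd; apply: no; exists d => //.
  apply: lt_trans dz _; rewrite distrC; near: w; exact: nbhsx_ballx.
Unshelve. all: by end_near. Qed.


Let affine f (c1 c2 A B c : R) : (forall w, c1 < w < c2 -> f w = A + B * (w - c)) ->
  forall z, c1 < z < c2 -> derive1n 2 f z = 0.
Proof.
move=> fE.
have d1 z : c1 < z < c2 -> derive1 f z = B.
  move=> zc; rewrite derive1E (@near_eq_derive _ _ _ f (fun w => A + B * (w - c))).
    by rewrite derive_val subr0 add0r mul1r /GRing.scale/= mulr1.
  have : z \in `]c1, c2[ by rewrite in_itv.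
  by move=> /near_in_itvoo; apply: filterS => w; rewrite in_itv; exact: fE.
move=> z zc; rewrite -[LHS]/(derive1 (derive1 f) z) derive1E.
rewrite (@near_eq_derive _ _ _ _ (cst B)) ?derive_cst//.
have : z \in `]c1, c2[ by rewrite in_itv.
by move=> /near_in_itvoo; apply: filterS => w; rewrite in_itv; exact: d1.
Qed.

Let small (e d : R) : 0 < e -> 0 < d -> exists m, [/\ 0 < m, m < e & m <= d].
Proof.
move=> e0 d0; exists (Num.min (e / 2) d); split.
- by rewrite lt_min d0 divr_gt0.
- by rewrite gt_min ltr_pdivrMr// ltr_pMr// ltr1n.
- by rewrite ge_min lexx orbT.
Qed.

Let Infl_between f (a b : R) : C2 f ->
  (forall x y, x < y -> exists2 z, x < z < y & derive1n 2 f z <> 0) ->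
  a < b -> 0 < derive1n 2 f a -> derive1n 2 f b < 0 ->
  exists2 z, a <= z <= b & Infl f z.
Proof.
move=> f2 nz ab fa fb; have [d1 d2 cf] := f2.
have cd : {within `[a, b], continuous (derive1 f)}.
  by apply: derivable_within_continuous => x _.
have [c + cmax] := EVT_max (ltW ab) cd; rewrite in_itv/= => /andP[ac cb].
have {}cmax t : a <= t -> t <= b -> derive1 f t <= derive1 f c.
  by move=> at_ tb; apply: cmax; rewrite in_itv/= at_.
have ca : c != a.
  apply/eqP => ca; subst c.
  have : \forall y \near a, 0 < derive1n 2 f y by move: (cf a) => /cvgr_gt; apply.
  move=> /nbhs_ballP[e /= e0 ae].
  have [m [m0 me mb]] : exists m, [/\ 0 < m, m < e & m <= b - a].
    by apply: small; rewrite ?subr_gt0.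
  have ay : a < a + m by rewrite ltrDl.
  have [t /andP[at_ ty] Et] := mvt d2 ay.
  have ft : 0 < derive1n 2 f t.
    by apply: ae; rewrite /ball/= ltr0_norm ?subr_lt0//; clear -ty me; lra.
  have : derive1 f (a + m) <= derive1 f a.
    by apply: cmax; [clear -m0|clear -mb]; lra.
  by rewrite -subr_le0 Et; apply/negP; rewrite -ltNge mulr_gt0 ?subr_gt0.
have cb' : c != b.
  apply/eqP => ca'; subst c.
  have : \forall y \near b, derive1n 2 f y < 0 by move: (cf b) => /cvgr_lt; apply.
  move=> /nbhs_ballP[e /= e0 ae].
  have [m [m0 me mb]] : exists m, [/\ 0 < m, m < e & m <= b - a].
    by apply: small; rewrite ?subr_gt0.
  have ay : b - m < b by rewrite gtrBl.
  have [t /andP[at_ ty] Et] := mvt d2 ay.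
  have ft : derive1n 2 f t < 0.
    by apply: ae; rewrite /ball/= gtr0_norm ?subr_gt0//; clear -at_ me; lra.
  have : derive1 f (b - m) <= derive1 f b.
    by apply: cmax; [clear -mb|clear -m0]; lra.
  by rewrite -subr_ge0 Et; apply/negP; rewrite -ltNge pmulr_llt0// subr_gt0.
have {ca}ac : a < c by rewrite lt_neqAle eq_sym ca.
have {cb'}cb : c < b by rewrite lt_neqAle cb'.
exists c; first by rewrite !ltW.
split.
  rewrite -[LHS]/(derive1 (derive1 f) c) derive1E.
  apply: derive_val; apply: (derive1_at_max (ltW ab)).
  - by move=> t _; apply: d2.
  - by rewrite in_itv/= ac.
  - by move=> t; rewrite in_itv/= => /andP[? ?]; apply: cmax; exact: ltW.
have R1 w : c < w -> w <= b -> f w - derive1 f c * (w - c) <= f c.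
  move=> cw wb; have [t /andP[ct tw] Et] := mvt d1 cw.
  have tm : derive1 f t <= derive1 f c.
    by apply: cmax; [clear -ac ct|clear -tw wb]; lra.
  by rewrite lerBlDl -lerBlDr Et ler_wpM2r// subr_ge0 ltW.
have L1 w : w < c -> a <= w -> f c <= f w - derive1 f c * (w - c).
  move=> wc aw; have [t /andP[wt tc] Et] := mvt d1 wc.
  have tm : derive1 f t <= derive1 f c.
    by apply: cmax; [clear -aw wt|clear -tc cb]; lra.
  rewrite -mulrN opprB -lerBlDl Et ler_wpM2r// subr_ge0 ltW//.
split; rewrite /local_max/local_min subrr mulr0 subr0 => /nbhs_ballP[e /= e0 H].
  have [m [m0 me mb]] : exists m, [/\ 0 < m, m < e & m <= c - a].
    by apply: small; rewrite ?subr_gt0.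
  have cm : c - m < c by rewrite gtrBl.
  have [z zI fz] := nz _ _ cm; apply: fz.
  apply: (affine (A := f c) (B := derive1 f c) (c := c)) zI => w /andP[w1 w2].
  have /H/= Hw : ball c e w.
    by rewrite /ball/= gtr0_norm ?subr_gt0//; clear -w1 me; lra.
  have Lw : f c <= f w - derive1 f c * (w - c).
    by apply: L1 => //; clear -w1 mb; lra.
  by apply/eqP; rewrite -subr_eq; apply/eqP/le_anti; rewrite Hw Lw.
have [m [m0 me mb]] : exists m, [/\ 0 < m, m < e & m <= b - c].
  by apply: small; rewrite ?subr_gt0.
have cm : c < c + m by rewrite ltrDl.
have [z zI fz] := nz _ _ cm; apply: fz.
apply: (affine (A := f c) (B := derive1 f c) (c := c)) zI => w /andP[w1 w2].
have /H/= Hw : ball c e w.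
  by rewrite /ball/= ltr0_norm ?subr_lt0//; clear -w2 me; lra.
have Rw : f w - derive1 f c * (w - c) <= f c.
  by apply: R1 => //; clear -w2 mb; lra.
by apply/eqP; rewrite -subr_eq; apply/eqP/le_anti; rewrite Hw Rw.
Qed.

Lemma closure_InflE f : C2 f -> [set z | derive1n 2 f z = 0]° = set0 ->
  closure (Infl f) = clos_Infl f.
Proof.
move=> f2 f0; apply/seteqP; split; first exact: closure_Infl_sub.
have [d1 d2 cf] := f2.
have nz x y : x < y -> exists2 z, x < z < y & derive1n 2 f z <> 0.
  move=> xy; apply: contrapT => no.
  suff : [set z | derive1n 2 f z = 0]° ((x + y) / 2) by rewrite f0.
  have : (x + y) / 2 \in `]x, y[ by rewrite in_itv/=; lra.
  move=> /near_in_itvoo; rewrite /interior/=; apply: filterS => z.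
  rewrite in_itv => zI; apply: contrapT => fz; apply: no.
  by exists z.
have N1 : derive1 (- f) = - derive1 f by apply/funext => x; rewrite derive1N.
have N2 : derive1n 2 (- f) = - derive1n 2 f.
  apply/funext => x; rewrite -[LHS]/(derive1 (derive1 (- f)) x) N1.
  by rewrite derive1N.
have fN2 : C2 (- f).
  split; first by move=> z; apply: derivableN.
    by move=> z; rewrite N1; apply: derivableN.
  by rewrite N2 => z; apply: cvgN; apply: cf.
have IN z : Infl (- f) z -> Infl f z.
  rewrite /Infl N1 N2 => -[/eqP]; rewrite oppr_eq0 => /eqP f''0 [h1 h2].
  split=> //; split=> H.
    by apply: h2; apply: filterS H => w; rewrite !fctE !mulNr -!opprD lerN2.
  by apply: h1; apply: filterS H => w; rewrite !fctE !mulNr -!opprD lerN2.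
move=> x [xp xn] U /nbhs_ballP[e /= e0 xU].
have [p [_ /= fp xp']] := xp _ (nbhsx_ballx x e e0).
have [n [_ /= fn xn']] := xn _ (nbhsx_ballx x e e0).
have bb a b z : ball x e a -> ball x e b -> a <= z <= b -> U z.
  rewrite /ball/= => + + /andP[az zb].
  rewrite !ltr_distl => /andP[? ?] /andP[? ?]; apply: xU.
  by rewrite /ball/= ltr_distl; apply/andP; split; lra.
have [pn|np|pn] := ltgtP p n.
- have [z zI Iz] := Infl_between f2 nz pn fp fn.
  by exists z; split=> //; apply: bb zI.
- have [||||z zI Iz] := @Infl_between (- f) n p fN2.
  + by move=> a b /nz[z zab fz]; exists z => //; rewrite N2 => /eqP; rewrite oppr_eq0 => /eqP.
  + by [].
  + by rewrite N2 oppr_gt0.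
  + by rewrite N2 oppr_lt0.
  by exists z; split; [exact: IN|apply: bb zI].
- by move: fp; rewrite pn; move=> /lt_trans/(_ fn); rewrite ltxx.
Qed.
End flux.

Section test_functions.
Context {R : realType} {V : normedModType R}.

Definition iter_derive (vs : seq V) (phi : V -> R) : V -> R :=
  foldr (fun v psi => fun p => 'D_v psi p) phi vs.

(* Continuity of all iterated directional derivatives: this is C^oo when V has
   finite dimension (V is R or R * R below). *)
Definition smooth (phi : V -> R) : Prop := forall vs : seq V,
  continuous (iter_derive vs phi) /\
  forall v p, derivable (iter_derive vs phi) p v.

Definition test_function (U : set V) (phi : V -> R) : Prop :=
  smooth phi /\
  exists K : set V, [/\ compact K, K `<=` U & forall p, ~ K p -> phi p = 0].

End test_functions.

Section balance_law.
Context {R : realType}.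
Implicit Types (f : R -> R) (u g : R * R -> R).

Definition bounded_Borel g : Prop :=
  (exists M : R, forall p, `|g p| <= M) /\
  measurable_fun [set: measurableTypeR R * measurableTypeR R]
    (g : measurableTypeR R * measurableTypeR R -> measurableTypeR R).

(* Points of R * R are pairs (t, x): (1, 0) is the direction of time and (0, 1)
   that of space. *)
Definition Eulerian_source f u g : Prop :=
  bounded_Borel g /\
  forall phi : R * R -> R, test_function setT phi ->
    - (\int[(lebesgue_measure \x lebesgue_measure)%E]_p
         (u p * 'D_(1, 0) phi p + f (u p) * 'D_(0, 1) phi p)) =
    \int[(lebesgue_measure \x lebesgue_measure)%E]_p (g p * phi p).

(* I may be open, closed, half-open, unbounded or degenerate; at an endpoint of
   I the derivative is one-sided.  The values of gamma outside I are
   irrelevant. *)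
Definition characteristic f u (I : set R) (gamma : R -> R) : Prop :=
  let speed t := derive1 f (u (t, gamma t)) in
  [/\ is_interval I,
      forall t, I t ->
        (gamma s - gamma t) / (s - t) @[s --> within I t^'] --> speed t
    & {within I, continuous speed}].

Definition Broad_source f u g : Prop :=
  bounded_Borel g /\
  forall (I : set R) (gamma : R -> R), characteristic f u I gamma ->
  forall phi : R -> R, test_function I° phi ->
    - (\int[lebesgue_measure]_(t in I°) (u (t, gamma t) * derive1 phi t)) =
    \int[lebesgue_measure]_(t in I°) (g (t, gamma t) * phi t).

End balance_law.

(* Main.v *)
(* Let N be the closure of the set of inflection points, g0 an Eulerian source
   bounded by M, G its primitive in x, gamma a characteristic and
   v (t) = u (t, gamma (t)).

   While v avoids N, f is locally convex or concave.  Integrating the balance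
   law over thin strips on either side of gamma, convexity gives a sign to the
   flux remainder and bounds the increments of v, above and below, by integrals
   of difference quotients of G.  Hence v is M-Lipschitz, and v' = g0 almost
   everywhere off the set Z where these quotients do not converge to g0.  Each
   time slice of Z is negligible, but gamma may run inside Z.  On Z the source
   is the supremum of the slopes b such that some Lipschitz path through the
   point is ahead of the characteristic along which u would grow at speed b,
   and carries values ahead of those.  By compactness this is a Borel function;
   since two such paths from nearby points of gamma cross, it equals v' at all
   but countably many of the times where v' exists.

   On {u in N} the source is 0.  This is compatible with the distributional
   equation because continuous solutions dissipate no entropy: u satisfies the
   Kruzkov balance with source g0 on {u > c} for every c, so the integral of g0
   over {u in N} is controlled by thin bands of levels covering the null set N.
   It is compatible with the characteristics because collapsing a neighbourhood
   of N of measure e moves v by at most e, so v does not vary on {v in N}. *)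
Require Import Defs.
From HB Require Import structures.
From mathcomp Require Import all_boot all_order all_algebra.
From mathcomp Require Import all_classical all_reals all_analysis.
From mathcomp Require Import measurable_realfun ring lra.
Set Implicit Arguments.
Unset Strict Implicit.
Unset Printing Implicit Defensive.
Import Order.TTheory GRing.Theory Num.Theory.
Import numFieldNormedType.Exports.
Local Open Scope classical_set_scope.
Local Open Scope ring_scope.

(** Two obstacles shape the proof. First, u is only continuous, so no chain rule yields the entropy
    balance. The integral of (u - c)^+ over [a, b] is the supremum, over finite families of disjoint
    intervals, of the sum of the increments of a primitive W of u - c. End points of an optimal
    family inside ]a, b[ are critical for W, so u = c there and the flux through them is f(c), which
    cancels in pairs. The time derivative of the supremum thus sees only the flux at a and b, up to
    an error M (b - a) due to the source. That error is of the order of the area, but away from {u =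
    c} the balance is exact; subdividing the rectangle therefore confines the error to {u = c}, and
    moving c removes it. Secondly, a characteristic is a null set of the plane and several of them
    may meet at one point, so neither an almost everywhere statement nor a choice along one curve
    defines a Broad source. The value on Z must depend on the point alone and be Borel; this is why
    it is defined through all Lipschitz paths from the point, with countably many speeds and
    moduli. *)

(** * Oriented integrals on the line *)

Section oriented_integral.
Context {R : realType}.
Implicit Types (f g : R -> R) (a b c x y M : R).
Notation mu := (@lebesgue_measure R).

Definition loc_int f := forall a b, mu.-integrable `[a, b] (EFin \o f).

(** The sign convention makes additivity hold for end points in any order, as primitives from 0 and
    displacements of either sign require. *)
Definition oint f a b : R :=
  if a <= b then \int[mu]_(x in `[a, b]) f x else - \int[mu]_(x in `[b, a]) f x.

Lemma continuous_loc_int f : continuous f -> loc_int f.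
Proof.
move=> cf a b; apply: continuous_compact_integrable; first exact: segment_compact.
exact: continuous_subspaceT.
Qed.

Lemma bounded_integrable_itv f a b M : measurable_fun setT f ->
  (forall x, a <= x <= b -> `|f x| <= M) -> mu.-integrable `[a, b] (EFin \o f).
Proof.
move=> mf fM; apply: (measurable_bounded_integrable (mu := mu)) => //=.
- rewrite lebesgue_measure_itv/=; case: ifP => // _; exact: ltry.
- exact: measurable_funTS.
- exists M; split; first exact: num_real.
  move=> z Mz x /=; rewrite in_itv => abx; apply: le_trans (fM _ abx) _; exact: ltW.
Qed.

Lemma bounded_loc_int f M : measurable_fun setT f ->
  (forall x, `|f x| <= M) -> loc_int f.
Proof. by move=> mf fM a b; apply: (@bounded_integrable_itv _ _ _ M). Qed.

Lemma loc_intD f g : loc_int f -> loc_int g -> loc_int (fun x => f x + g x).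
Proof.
move=> lf lg a b.
rewrite (_ : _ \o _ = ((EFin \o f) \+ (EFin \o g))%E); last exact/funext.
exact: integrableD.
Qed.

Lemma loc_intZ f k : loc_int f -> loc_int (fun x => k * f x).
Proof.
move=> lf a b.
rewrite (_ : _ \o _ = (fun x => k%:E * (EFin \o f) x)%E); last exact/funext.
exact: integrableZl.
Qed.

Lemma loc_intN f : loc_int f -> loc_int (fun x => - f x).
Proof.
move=> /(@loc_intZ _ (-1)); congr loc_int; apply/funext => x; by rewrite mulN1r.
Qed.

Lemma loc_intB f g : loc_int f -> loc_int g -> loc_int (fun x => f x - g x).
Proof. by move=> lf lg; apply: loc_intD => //; exact: loc_intN. Qed.

Lemma loc_int_cst k : loc_int (fun _ => k).
Proof. by apply: continuous_loc_int => x; exact: cvg_cst. Qed.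

Lemma ointE f a b : a <= b -> oint f a b = \int[mu]_(x in `[a, b]) f x.
Proof. by rewrite /oint => ->. Qed.

Lemma oint_refl f a : oint f a a = 0.
Proof. by rewrite ointE// set_itv1 Rintegral_set1. Qed.

Lemma oint_swap f a b : oint f b a = - oint f a b.
Proof.
have [ab|ba|->] := ltgtP a b; last by rewrite oint_refl oppr0.
- by rewrite /oint leNgt ab (ltW ab).
- by rewrite /oint (ltW ba) leNgt ba opprK.
Qed.

Let oint_cat_le f a b c : loc_int f -> a <= b -> b <= c ->
  oint f a b + oint f b c = oint f a c.
Proof.
move=> lf ab bc; rewrite !ointE//; last exact: le_trans bc.
rewrite -(Rintegral_itv_obnd_cbnd (r := b)); last first.
  apply: integrableS (lf b c) => //.
  by apply: subset_itvr; rewrite bnd_simp.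
rewrite -(@Rintegral_itvB _ f (BLeft a) (BRight c) b) ?bnd_simp//.
by rewrite addrC subrK.
Qed.

Lemma oint_cat f a b c : loc_int f -> oint f a b + oint f b c = oint f a c.
Proof.
move=> lf; have H := oint_cat_le lf.
have [ab|/ltW ba] := leP a b; have [bc|/ltW cb] := leP b c; have [ac|/ltW ca] := leP a c.
- exact: H.
- by rewrite -(H _ _ _ ab bc) .
- by rewrite -(H _ _ _ ac cb) (oint_swap f c b) addrK.
- by rewrite (oint_swap f c b) (oint_swap f c a) -(H _ _ _ ca ab) opprD addrCA subrr addr0.
- by rewrite (oint_swap f b a) -(H _ _ _ ba ac) addKr.
- by rewrite (oint_swap f b a) (oint_swap f c a) -(H _ _ _ bc ca) opprD addrAC addNr add0r.
- have ? : b = a by apply/le_anti; rewrite ba (le_trans ac cb).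
  by subst b; rewrite oint_refl add0r.
- by rewrite (oint_swap f b a) (oint_swap f c b) (oint_swap f c a) -(H _ _ _ cb ba) opprD addrC.
Qed.

Lemma ointD f g a b : loc_int f -> loc_int g ->
  oint (fun x => f x + g x) a b = oint f a b + oint g a b.
Proof.
by move=> lf lg; rewrite /oint; case: ifP => _; rewrite RintegralD// opprD.
Qed.

Lemma ointZ f k a b : loc_int f -> oint (fun x => k * f x) a b = k * oint f a b.
Proof.
by move=> lf; rewrite /oint; case: ifP => _; rewrite RintegralZl// mulrN.
Qed.

Lemma ointN f a b : loc_int f -> oint (fun x => - f x) a b = - oint f a b.
Proof.
move=> lf; rewrite -mulN1r -ointZ//; congr oint.
by apply/funext => x; rewrite mulN1r.
Qed.

Lemma ointB f g a b : loc_int f -> loc_int g ->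
  oint (fun x => f x - g x) a b = oint f a b - oint g a b.
Proof. by move=> lf lg; rewrite ointD ?ointN//; exact: loc_intN. Qed.

Lemma oint_cst k a b : oint (fun _ => k) a b = k * (b - a).
Proof.
rewrite /oint; case: (leP a b) => ab; rewrite Rintegral_cst//= lebesgue_measure_itv/= lte_fin.
- move: ab; rewrite le_eqVlt => /predU1P[->|ab]; first by rewrite ltxx subrr.
  by rewrite ab.
- by rewrite ab /= -mulrN opprB.
Qed.

Lemma le_oint f g a b : loc_int f -> loc_int g -> a <= b ->
  (forall x, a <= x <= b -> f x <= g x) -> oint f a b <= oint g a b.
Proof.
move=> lf lg ab fg; rewrite !ointE//; apply: le_Rintegral => //.
Qed.

Lemma eq_oint f g a b : (forall x, Num.min a b <= x <= Num.max a b -> f x = g x) ->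
  oint f a b = oint g a b.
Proof.
move=> fg; rewrite /oint; case: ifP => ab.
- apply: eq_Rintegral => x; rewrite inE/= in_itv/= => xab; apply: fg.
  by rewrite (min_idPl ab) (max_idPr ab).
- congr (- _); apply: eq_Rintegral => x; rewrite inE/= in_itv/= => xab; apply: fg.
  by move/negbT : ab; rewrite -ltNge => /ltW ba; rewrite (min_idPr ba) (max_idPl ba).
Qed.

Lemma oint_norm_le f a b M : loc_int f ->
  (forall x, Num.min a b <= x <= Num.max a b -> `|f x| <= M) ->
  `|oint f a b| <= M * `|b - a|.
Proof.
move=> lf; wlog ab : a b / a <= b => [hw|].
  have /orP[ab|ba] := le_total a b; first exact: hw.
  move=> fM.
  rewrite oint_swap normrN distrC; apply: hw => // x; rewrite minC maxC; exact: fM.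
rewrite (min_idPl ab) (max_idPr ab) => fM.
rewrite (ger0_norm (_ : 0 <= b - a)) ?subr_ge0//.
rewrite ler_norml -mulNr -!oint_cst; apply/andP; split;
  by apply: le_oint; try exact: loc_int_cst; rewrite // => x /fM;
     rewrite ler_norml => /andP[].
Qed.

Lemma oint_ge0 f a b : a <= b -> (forall x, a <= x <= b -> 0 <= f x) ->
  0 <= oint f a b.
Proof. by move=> ab f0; rewrite ointE//; apply: Rintegral_ge0 => x /=; rewrite in_itv; exact: f0. Qed.

Lemma oint_deriv f x : loc_int f -> {for x, continuous f} ->
  forall e : R, 0 < e -> exists2 d : R, 0 < d & forall y, `|y - x| < d ->
    `|oint f x y - f x * (y - x)| <= e * `|y - x|.
Proof.
move=> lf cf e e0; move: cf => /cvgrPdist_lt/(_ e e0)/nbhs_ballP[d /= d0 df].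
exists d => // y yx; rewrite -oint_cst -ointB//; last exact: loc_int_cst.
apply: oint_norm_le; first by apply: loc_intB => //; exact: loc_int_cst.
move=> z zxy; rewrite distrC ltW//; apply: df; rewrite /ball/=.
rewrite distrC; apply: le_lt_trans yx.
move: zxy; have [xy|/ltW yx] := leP x y.
  by move=> /andP[? ?]; rewrite !ger0_norm; lra.
by move=> /andP[? ?]; rewrite !ler0_norm; lra.
Qed.

Lemma oint_dominated (f_ : nat -> R -> R) f a b M :
  (forall n, measurable_fun setT (f_ n)) ->
  (forall n x, Num.min a b <= x <= Num.max a b -> `|f_ n x| <= M) ->
  (forall x, Num.min a b <= x <= Num.max a b -> f_ n x @[n --> \oo] --> f x) ->
  measurable_fun setT f ->
  oint (f_ n) a b @[n --> \oo] --> oint f a b.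
Proof.
move=> mf_ fM fc mf; wlog ab : a b fM fc / a <= b => [hw|].
  have /orP[ab|ba] := le_total a b; first exact: hw.
  rewrite oint_swap; under eq_cvg do rewrite oint_swap.
  by apply: cvgN; apply: hw => //; rewrite minC maxC.
move: fM fc; rewrite (min_idPl ab) (max_idPr ab) => fM fc.
under eq_cvg do rewrite ointE//.
rewrite ointE//.
have [] := @dominated_convergence _ _ R mu `[a, b] _ (fun n => EFin \o f_ n)
   (EFin \o f) (fun _ => M%:E).
- exact: measurable_itv.
- by move=> n; apply/measurable_EFinP; apply: measurable_funTS; exact: mf_.
- by apply/measurable_EFinP; apply: measurable_funTS.
- by apply: aeW => x /=; rewrite in_itv/= => /fc xc; apply: cvg_EFin => //; exact: nearW.
- by have := loc_int_cst M a b.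
- by apply: aeW => x /= n; rewrite in_itv/= => /fM; rewrite lee_fin.
move=> intf _ cv; apply: fine_cvg; rewrite fineK//.
by apply: integrable_fin_num.
Qed.

Lemma ae_oint_deriv f M : measurable_fun setT f -> (forall x, `|f x| <= M) ->
  {ae mu, forall x, forall e : R, 0 < e -> exists2 d : R, 0 < d & forall y, `|y - x| < d ->
    `|oint f x y - f x * (y - x)| <= e * `|y - x|}.
Proof.
move=> mf fM; have lf := bounded_loc_int mf fM.
have locf : locally_integrable setT f.
  split => //; first exact: openT.
  move=> K _ cK; have [N [Nr NK]] := compact_bounded cK.
  have KN : K `<=` `[- (N + 1), N + 1].
    move=> x /NK /= /(_ (N + 1)); rewrite ltrDl ltr01 => /(_ isT).
    by rewrite in_itv/= ler_norml.
  have /integrableP[_] : mu.-integrable K (EFin \o f).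
    apply: integrableS (lf (- (N + 1)) (N + 1)) => //.
    exact: compact_measurable.
  by [].
have := lebesgue_differentiation locf.
apply: filterS; first exact: (ae_filter_ringOfSetsType mu).
move=> x xf.
have [] := @FTC1_lebesgue_pt _ f (BLeft (x - 1)) x (x + 1) _ _ _ xf.
- by rewrite ltrDl.
- exact: lf.
- by rewrite lte_fin ltrBlDr ltrDl.
set F := fun y => _; move=> dF F'x e e0.
have : h^-1 *: (F (h + x) - F x) @[h --> 0^'] --> f x.
  have /cvg_ex[l Fl] := dF; rewrite -F'x derive1E /derive.
  have -> : lim (h^-1 *: ((F \o shift x) (h *: 1) - F x) @[h --> 0^']) = l.
    exact: (cvg_lim (@Rhausdorff R) Fl).
  apply: cvg_trans Fl; apply: near_eq_cvg; near=> h; by rewrite /= [h *: 1]mulr1.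
move=> /cvgrPdist_lt/(_ e e0) => /nbhs_ballP[d /= d0 df].
(* F is a primitive from x - 1; the cap 1 keeps y to the right of that base point. *)
exists (Num.min d 1); first by rewrite lt_min d0 ltr01.
move=> y; rewrite lt_min => /andP[yd y1].
have [->|yx] := eqVneq y x; first by rewrite oint_refl subrr mulr0 subr0 normr0 mulr0.
have yx0 : y - x != 0 by rewrite subr_eq0.
have /df : ball (0 : R) d (y - x) by rewrite /ball/= sub0r normrN.
move=> /(_ yx0); rewrite subrK => H.
have -> : oint f x y = F y - F x.
  have xm : x - 1 <= x by lra.
  have ym : x - 1 <= y by move: y1; clear; rewrite ltr_norml => /andP[? ?]; lra.
  rewrite /F -!ointE// -(oint_cat (x - 1) x y lf) addrC addKr//.
have yxp : 0 < `|y - x| by rewrite normr_gt0.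
rewrite -ler_pdivrMr// -normfV -normrM mulrBl mulfK// distrC.
by move: (ltW H); rewrite /GRing.scale/= mulrC.
Unshelve. all: by end_near. Qed.

End oriented_integral.

(** * Comparing increments with integrals by one-sided local conditions *)

Section calculus.
Context {R : realType}.
Implicit Types (f phi F B : R -> R) (a b s t e d : R).

(** Continuity relative to [a, b] alone: value functions of optimization problems are controlled
    only on the segment where they are studied. *)
Definition cont_itv a b phi := forall t, a <= t <= b -> forall e, 0 < e ->
  exists2 d, 0 < d & forall s, a <= s <= b -> `|s - t| < d -> `|phi s - phi t| < e.

Lemma continuous_cont_itv a b phi : continuous phi -> cont_itv a b phi.
Proof.
move=> cphi t _ e e0; have /cvgrPdist_lt/(_ e e0)/nbhs_ballP[d /= d0 dp] := cphi t.
exists d => // s _ st; rewrite distrC; apply: dp; by rewrite /ball/= distrC.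
Qed.

Lemma cont_itvD a b phi F : cont_itv a b phi -> cont_itv a b F ->
  cont_itv a b (fun t => phi t + F t).
Proof.
move=> cp cF t tab e e0; have e20 : 0 < e / 2 by lra.
have [d1 d10 H1] := cp t tab _ e20; have [d2 d20 H2] := cF t tab _ e20.
exists (Num.min d1 d2); first by rewrite lt_min d10.
move=> s sab; rewrite lt_min => /andP[/(H1 _ sab) h1 /(H2 _ sab) h2].
rewrite opprD addrACA; apply: le_lt_trans (ler_normD _ _) _; clear -h1 h2; lra.
Qed.

Lemma cont_itvN a b phi : cont_itv a b phi -> cont_itv a b (fun t => - phi t).
Proof.
move=> cp t tab e e0; have [d d0 H] := cp t tab _ e0; exists d => // s sab sd.
by rewrite -opprD normrN; exact: H.
Qed.

Lemma cont_itvB a b phi F : cont_itv a b phi -> cont_itv a b F ->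
  cont_itv a b (fun t => phi t - F t).
Proof. by move=> ? ?; apply: cont_itvD => //; exact: cont_itvN. Qed.

Lemma lipschitz_cont_itv a b phi k :
  (forall s t, a <= s <= b -> a <= t <= b -> `|phi s - phi t| <= k * `|s - t|) ->
  cont_itv a b phi.
Proof.
move=> lp t tab e e0; have k10 : 0 < `|k| + 1 by rewrite ltr_wpDl.
exists (e / (`|k| + 1)); first by rewrite divr_gt0.
move=> s sab; rewrite ltr_pdivlMr// => H; apply: le_lt_trans H.
apply: le_trans (lp _ _ sab tab) _; rewrite mulrC ler_wpM2l//.
by apply: le_trans (ler_norm k) _; rewrite lerDl.
Qed.

Lemma cont_itv_mirror a b phi : cont_itv a b phi ->
  cont_itv (- b) (- a) (fun t => phi (- t)).
Proof.
move=> cp t tab e e0; have tab' : a <= - t <= b by clear -tab; lra.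
have [d d0 H] := cp _ tab' _ e0; exists d => // s sab st; apply: H.
  by clear -sab; lra.
by rewrite -opprD normrN.
Qed.

(** By continuity the supremum of the times t with phi a <= phi t satisfies the same inequality, and
    the local hypothesis would push the set past it if it were not b. *)
Lemma locally_nondecreasing_right a b phi : a <= b -> cont_itv a b phi ->
  (forall t, a <= t < b -> exists2 d, 0 < d &
     forall s, t < s < t + d -> s <= b -> phi t <= phi s) ->
  phi a <= phi b.
Proof.
move=> ab cp H; pose S := [set t | a <= t <= b /\ phi a <= phi t].
have Sa : S a by rewrite /S/= !lexx ab.
have hS : has_sup S by split; [exists a|exists b => t [/andP[]]].
have am : a <= sup S by apply: sup_upper_bound.
have mb : sup S <= b by apply: ge_sup; [exists a|move=> t [/andP[]]].
have pm : phi a <= phi (sup S).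
  rewrite leNgt; apply/negP => lt_m.
  have mab : a <= sup S <= b by rewrite am.
  have e0 : 0 < phi a - phi (sup S) by rewrite subr_gt0.
  have [d d0 dp] := cp _ mab _ e0.
  have [t [tab pt] tm] := sup_adherent d0 hS.
  have tS : t <= sup S by apply: sup_upper_bound.
  have := dp t tab; rewrite distrC ger0_norm ?subr_ge0//.
  have tm' : sup S - t < d by clear -tm; lra.
  by move=> /(_ tm'); rewrite ltr_norml => /andP[_]; clear -pt; lra.
move: mb; rewrite le_eqVlt => /predU1P[<-//|mb].
have [d d0 dp] : exists2 d, 0 < d &
     forall s, sup S < s < sup S + d -> s <= b -> phi (sup S) <= phi s.
  by apply: H; rewrite am.
pose s := Num.min b (sup S + d / 2).
have ms : sup S < s by rewrite lt_min mb/= ltrDl divr_gt0.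
have sb : s <= b by rewrite ge_min lexx.
have sd : s < sup S + d.
  by apply: (@le_lt_trans _ _ (sup S + d / 2)); [rewrite ge_min lexx orbT|clear -d0; lra].
have : S s.
  split; first by rewrite sb (le_trans am)// ltW.
  by apply: le_trans pm _; apply: dp => //; rewrite ms.
by move=> /(sup_upper_bound hS); rewrite leNgt ms.
Qed.

Lemma locally_nonincreasing_left a b phi : a <= b -> cont_itv a b phi ->
  (forall t, a < t <= b -> exists2 d, 0 < d &
     forall s, t - d < s < t -> a <= s -> phi t <= phi s) ->
  phi b <= phi a.
Proof.
move=> ab cp H.
have := @locally_nondecreasing_right (- b) (- a) (fun t => phi (- t)).
rewrite !opprK; apply; first by rewrite lerN2.
  exact: cont_itv_mirror.
move=> t tab; have [|d d0 dp] := H (- t); first by clear -tab; lra.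
by exists d => // s st sa; apply: dp; clear -st sa; lra.
Qed.

Lemma oint_cont_itv f a b c : continuous f -> cont_itv a b (oint f c).
Proof.
move=> cf t _ e e0; have lf := continuous_loc_int cf.
have [d d0 H] := @oint_deriv _ f t lf (cf t) 1 ltr01.
have k0 : 0 < 1 + `|f t| by rewrite ltr_pwDl.
exists (Num.min d (e / (1 + `|f t|))).
  by rewrite lt_min d0 divr_gt0.
move=> s _; rewrite lt_min => /andP[/H]; rewrite mul1r => h1.
rewrite ltr_pdivlMr// => h2; rewrite -(oint_cat c t s lf) addrAC subrr add0r.
apply: le_lt_trans h2; rewrite mulrDr mulr1 -normrM.
have -> : oint f t s = (oint f t s - f t * (s - t)) + (s - t) * f t by rewrite mulrC; lra.
by apply: le_trans (ler_normD _ _) _; rewrite lerD2r.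
Qed.

(** F minus the primitive of B, tilted by an arbitrarily small slope, is locally nondecreasing to
    the right. *)
Lemma ge_oint_of_right_dini a b F B : a <= b -> cont_itv a b F -> continuous B ->
  (forall t, a <= t < b -> forall e, 0 < e -> exists2 d, 0 < d &
     forall s, t < s < t + d -> s <= b -> (B t - e) * (s - t) <= F s - F t) ->
  oint B a b <= F b - F a.
Proof.
move=> ab cF cB H; apply/ler_addgt0Pr => e e0.
have lB := continuous_loc_int cB.
have k0 : 0 < 2 * (b - a + 1) by clear -ab; lra.
(* The tilt is 2 k: one share pays for the lower bound on F, the other for the derivative of the
   primitive of B. The summand 1 covers a = b. *)
pose k := e / (2 * (b - a + 1)); have kp : 0 < k by rewrite divr_gt0.
have := @locally_nondecreasing_right a b (fun t => F t - oint B a t + (2 * k) * t) ab.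
have cm : cont_itv a b (fun t => F t - oint B a t + (2 * k) * t).
  apply: cont_itvD; first by apply: cont_itvB => //; exact: oint_cont_itv.
  apply: continuous_cont_itv => t; apply: cvgM; [exact: cvg_cst|exact: cvg_id].
move=> /(_ cm); rewrite oint_refl.
have step : forall t : R, a <= t < b -> exists2 d, 0 < d &
    (forall s, t < s < t + d -> s <= b ->
     F t - oint B a t + 2 * k * t <= F s - oint B a s + 2 * k * s).
  move=> t tab; have [d d0 h1] := H t tab k kp.
  have [d' d'0 h2] := @oint_deriv _ B t lB (cB t) k kp.
  exists (Num.min d d'); first by rewrite lt_min d0.
  move=> s /andP[ts]; rewrite -ltrBlDl lt_min => /andP[sd sd'] sb.
  have {}h1 := h1 s ltac:(clear -ts sd; lra) sb.
  have := h2 s; rewrite gtr0_norm ?subr_gt0// => /(_ sd').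
  rewrite ler_norml => /andP[_ {}h2].
  rewrite -(oint_cat a t s lB); move: h1 h2.
  by rewrite mulrBl; clear; lra.
move=> /(_ step).
have : 2 * k * (b - a) <= e.
  have -> : e = 2 * k * (b - a + 1).
    by rewrite /k mulrAC mulrC divfK// gt_eqF.
  by rewrite ler_pM2l; [clear; lra|clear -kp; lra].
by clear; lra.
Qed.

Lemma le_oint_of_left_dini a b F B : a <= b -> cont_itv a b F -> continuous B ->
  (forall t, a < t <= b -> forall e, 0 < e -> exists2 d, 0 < d &
     forall s, t - d < s < t -> a <= s -> F t - F s <= (B t + e) * (t - s)) ->
  F b - F a <= oint B a b.
Proof.
move=> ab cF cB H; apply/ler_addgt0Pr => e e0.
have lB := continuous_loc_int cB.
have k0 : 0 < 2 * (b - a + 1) by clear -ab; lra.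
pose k := e / (2 * (b - a + 1)); have kp : 0 < k by rewrite divr_gt0.
have := @locally_nonincreasing_left a b (fun t => F t - oint B a t - (2 * k) * t) ab.
have cm : cont_itv a b (fun t => F t - oint B a t - (2 * k) * t).
  apply: cont_itvB; first by apply: cont_itvB => //; exact: oint_cont_itv.
  apply: continuous_cont_itv => t; apply: cvgM; [exact: cvg_cst|exact: cvg_id].
move=> /(_ cm); rewrite oint_refl.
have step : forall t : R, a < t <= b -> exists2 d, 0 < d &
    (forall s, t - d < s < t -> a <= s ->
     F t - oint B a t - 2 * k * t <= F s - oint B a s - 2 * k * s).
  move=> t tab; have [d d0 h1] := H t tab k kp.
  have [d' d'0 h2] := @oint_deriv _ B t lB (cB t) k kp.
  exists (Num.min d d'); first by rewrite lt_min d0.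
  move=> s /andP[]; rewrite ltrBlDr -ltrBlDl lt_min => /andP[sd sd'] st sa.
  have {}h1 := h1 s ltac:(clear -st sd; lra) sa.
  have := h2 s; rewrite ltr0_norm ?subr_lt0// opprB => /(_ sd').
  rewrite ler_norml => /andP[_ {}h2].
  rewrite -(oint_cat a t s lB); move: h1 h2.
  by rewrite mulrDl; clear; lra.
move=> /(_ step).
have : 2 * k * (b - a) <= e.
  have -> : e = 2 * k * (b - a + 1).
    by rewrite /k mulrAC mulrC divfK// gt_eqF.
  by rewrite ler_pM2l; [clear; lra|clear -kp; lra].
by clear; lra.
Qed.

Lemma oint_of_derivative a b F B : a <= b -> continuous B ->
  (forall t, a <= t <= b -> forall e, 0 < e -> exists2 d, 0 < d &
     forall s, a <= s <= b -> `|s - t| < d ->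
       `|F s - F t - B t * (s - t)| <= e * `|s - t|) ->
  F b - F a = oint B a b.
Proof.
move=> ab cB H.
have cF : cont_itv a b F.
  move=> t tab e e0; have [d d0 h] := H t tab 1 ltr01.
  have k0 : 0 < 1 + `|B t| by rewrite ltr_pwDl.
  exists (Num.min d (e / (1 + `|B t|))); first by rewrite lt_min d0 divr_gt0.
  move=> s sab; rewrite lt_min => /andP[/(h _ sab)]; rewrite mul1r => h1.
  rewrite ltr_pdivlMr// => h2; apply: le_lt_trans h2; rewrite mulrDr mulr1 -normrM.
  have -> : F s - F t = (F s - F t - B t * (s - t)) + (s - t) * B t by rewrite mulrC; lra.
  by apply: le_trans (ler_normD _ _) _; rewrite lerD2r.
apply/le_anti/andP; split.
- apply: le_oint_of_left_dini => // t /andP[at_ tb] e e0.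
  have [d d0 h] := H t ltac:(by rewrite tb ltW) e e0; exists d => // s /andP[s1 s2] sa.
  have := h s; rewrite sa ltr0_norm ?subr_lt0// opprB => /(_ _ _).
  rewrite (le_trans (ltW s2))// => /(_ isT) /(_ ltac:(clear -s1; lra)).
  by rewrite ler_norml mulrDl => /andP[]; clear; lra.
- apply: ge_oint_of_right_dini => // t /andP[at_ tb] e e0.
  have [d d0 h] := H t ltac:(by rewrite at_ ltW) e e0; exists d => // s /andP[s1 s2] sa.
  have := h s; rewrite sa gtr0_norm ?subr_gt0// (le_trans at_ (ltW s1)) => /(_ isT).
  move=> /(_ ltac:(clear -s2; lra)).
  by rewrite ler_norml mulrBl => /andP[]; clear; lra.
Qed.

End calculus.

(** * Uniform estimates near a compact box *)

Section compactness.
Context {R : realType}.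
Implicit Types (h : R * R -> R) (a b s t e d : R).

(** Only (t, x) is confined to the box; the nearby point (s, y) may leave it. Compactness is used in
    its near-covering form, which provides the common radius directly. *)
Lemma box_uniform h t1 t2 a b e : continuous h -> 0 < e ->
  exists2 d, 0 < d & forall t x s y, t1 <= t <= t2 -> a <= x <= b ->
    `|s - t| < d -> `|y - x| < d -> `|h (s, y) - h (t, x)| < e.
Proof.
move=> ch e0.
have cK : compact (`[t1, t2] `*` `[a, b]) by apply: compact_setX; exact: segment_compact.
have /compact_near_coveringP nc := cK.
have [] := nc R (0^'+) (fun d p => forall s y, `|s - p.1| < d -> `|y - p.2| < d ->
    `|h (s, y) - h p| < e) _ _.
- move=> p _; have e20 : 0 < e / 2 by lra.
  have /cvgrPdist_lt/(_ _ e20)/nbhs_ballP[r /= r0 hr] := ch p.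
  near=> p' d => s y sp yp.
  have pp' : ball p (r / 2) p' by near: p'; apply: nbhsx_ballx; rewrite divr_gt0.
  have dr : d < r / 2 by near: d; apply: nbhs_right_lt; rewrite divr_gt0.
  have h1 : `|h p - h p'| < e / 2.
    by apply: hr; apply: le_ball pp'; clear -r0; lra.
  have h2 : `|h p - h (s, y)| < e / 2.
    apply: hr; case: pp' => b1 b2; split => /=.
      move: b1; rewrite /ball/= => b1; have -> : p.1 - s = (p.1 - p'.1) - (s - p'.1) by rewrite opprB addrA subrK.
      apply: le_lt_trans (ler_normB _ _) _; rewrite (splitr r); apply: ltrD => //; exact: lt_trans dr.
    move: b2; rewrite /ball/= => b2; have -> : p.2 - y = (p.2 - p'.2) - (y - p'.2) by rewrite opprB addrA subrK.
    apply: le_lt_trans (ler_normB _ _) _; rewrite (splitr r); apply: ltrD => //; exact: lt_trans dr.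
  have -> : h (s, y) - h p' = (h p - h p') - (h p - h (s, y)) by lra.
  by apply: le_lt_trans (ler_normB _ _) _; clear -h1 h2; lra.
- move=> d /= d0 H; exists (d / 2); first by rewrite divr_gt0.
  move=> t x s y tt xx ss yy; apply: (H (d / 2)) => //=.
  + by rewrite sub0r normrN gtr0_norm; clear -d0; lra.
  + by rewrite divr_gt0.
Unshelve. all: by end_near. Qed.

Lemma box_bounded h t1 t2 a b : continuous h ->
  exists2 M, 0 < M & forall t x, t1 <= t <= t2 -> a <= x <= b -> `|h (t, x)| <= M.
Proof.
move=> ch.
have cK : compact (`[t1, t2] `*` `[a, b]) by apply: compact_setX; exact: segment_compact.
have : compact (h @` (`[t1, t2] `*` `[a, b])).
  by apply: continuous_compact => //; exact: continuous_subspaceT.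
move=> /compact_bounded/ex_strict_bound_gt0[M M0 HM]; exists M => // t x tt xx.
by apply/ltW/HM; exists (t, x) => //=; rewrite !in_itv.
Qed.

End compactness.

(** * The entropy estimate *)

Section alternating_sums.
Context {R : realType}.
Implicit Types (W V : R -> R) (X Y : seq R) (x y a b M : R).

(** On a list x1, y1, x2, y2, ... of even length this is the sum of the increments W y_i - W x_i.
    Taken over sorted lists with W a primitive of u - c, its supremum is the integral of (u -
    c)^+. *)
Definition altS W X : R := foldr (fun x acc => - W x - acc) 0 X.

Lemma altS_cat W X Y : altS W (X ++ Y) = altS W X + (-1) ^+ size X * altS W Y.
Proof.
elim: X => [|x X ih] /=; first by rewrite add0r mul1r.
by rewrite ih opprD addrA exprS mulN1r mulNr.
Qed.

Lemma altS_pair W x y X : altS W [:: x, y & X] = W y - W x + altS W X.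
Proof. by rewrite /= opprB opprK; lra. Qed.

Lemma altSB W V X : altS (fun x => W x - V x) X = altS W X - altS V X.
Proof. by elim: X => [|x X ih] /=; rewrite ?subrr// ih; lra. Qed.

Lemma altSD W V X : altS (fun x => W x + V x) X = altS W X + altS V X.
Proof. by elim: X => [|x X ih] /=; rewrite ?addr0// ih; lra. Qed.

Lemma altS_cst k X : ~~ odd (size X) -> altS (fun _ => k) X = 0.
Proof.
have [n] := ubnP (size X); elim: n X => // n ih [|x [|y X]]//= szX.
rewrite negbK => oX; have := altS_pair (fun _ => k) x y X; rewrite /= => ->.
rewrite subrr add0r; apply: ih => //; exact: ltnW.
Qed.

Lemma altS_norm_le W X M : (forall x, x \in X -> `|W x| <= M) ->
  `|altS W X| <= (size X)%:R * M.
Proof.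
elim: X => [|x X ih] /= WM; first by rewrite normr0 mul0r.
apply: le_trans (ler_normB _ _) _; rewrite normrN -natr1 mulrDl mul1r addrC.
apply: lerD; last by apply: WM; rewrite mem_head.
by apply: ih => y yX; apply: WM; rewrite in_cons yX orbT.
Qed.

(* Cancelling equal consecutive entries changes neither the alternating sum nor
   the parity of the length. *)
Lemma altS_strict W X : pairwise <=%R X -> exists Y,
  [/\ pairwise <%R Y, {subset Y <= X}, (size Y <= size X)%N,
      odd (size Y) = odd (size X) & altS W Y = altS W X].
Proof.
elim: X => [_|x X ih] /=; first by exists [::].
move=> /andP[xX /ih[[|y Y] [sY YX szY oY WY]]].
  by exists [:: x]; split => //=; [move=> z; rewrite !inE => /eqP ->; rewrite eqxx|
     rewrite -oY|rewrite -WY].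
have : x <= y by move/allP : xX; apply; apply: YX; rewrite mem_head.
rewrite le_eqVlt => /predU1P[?|xy].
  subst y; exists Y; split.
  - by move: sY => /= /andP[].
  - by move=> z zY; rewrite in_cons YX ?orbT// in_cons zY orbT.
  - by move: szY => /= szY; apply: ltnW; apply: leqW.
  - by rewrite -oY /= negbK.
  - by rewrite -WY /= opprB opprK; lra.
exists [:: x, y & Y]; split => //.
- move: sY => /= /andP[yY ->]; rewrite yY andbT xy /= andbT.
  by apply/allP => z /(allP yY); exact: lt_trans.
- move=> z; rewrite in_cons => /orP[/eqP ->|/YX]; first by rewrite mem_head.
  by rewrite in_cons orbC => ->.
- by rewrite [in RHS]/= -oY.
- by rewrite [RHS]/= -WY.
Qed.

(** The intervals of a sorted list are disjoint, so their lengths add up to at most b - a. The bound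
    is independent of the number of intervals, which may therefore be refined freely. *)
Lemma altS_lipschitz W X a b M : 0 <= M -> a <= b ->
  (forall x y, a <= x -> x <= y -> y <= b -> `|W y - W x| <= M * (y - x)) ->
  pairwise <=%R X -> all (fun x => a <= x <= b) X -> ~~ odd (size X) ->
  `|altS W X| <= M * (b - a).
Proof.
move=> M0; have [n] := ubnP (size X).
elim: n X a => // n ih [|x [|y X]] //= a szX ab WM.
  by move=> _ _ _; rewrite normr0 mulr_ge0// subr_ge0.
move=> /and3P[/andP[xy xX] yX sX] /and3P[/andP[ax xb] /andP[ay yb] Xab]; rewrite negbK => oX.
have := altS_pair W x y X; rewrite /= => ->; apply: le_trans (ler_normD _ _) _.
have H1 : `|W y - W x| <= M * (y - x) by apply: WM.
have H2 : `|altS W X| <= M * (b - y).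
  apply: ih => //.
  - exact: ltnW.
  - by move=> z w yz; apply: WM; exact: le_trans yz.
  - apply/allP => z zX; have /andP[_ ->] := allP Xab _ zX.
    by rewrite (allP yX).
apply: le_trans (lerD H1 H2) _; rewrite -mulrDr ler_wpM2l//; lra.
Qed.

(** In a strictly sorted list a can only come first and b only last, which fixes the signs of the
    two terms that survive. *)
Lemma altS_sparse W X a b : pairwise <%R X -> all (fun x => a <= x <= b) X ->
  a < b -> (forall x, x \in X -> a < x < b -> W x = 0) ->
  altS W X = (if b \in X then (-1) ^+ size X * W b else 0)
             - (if a \in X then W a else 0).
Proof.
move=> + + ab; elim: X => [|x X ih] /=; first by rewrite subrr.
move=> /andP[xX sX] /andP[/andP[ax xb] Xab] W0.
have aX : a \in X = false by apply/negP => /(allP xX); rewrite ltNge ax.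
have W0' y : y \in X -> a < y < b -> W y = 0.
  by move=> yX; apply: W0; rewrite in_cons yX orbT.
rewrite ih// aX subr0 !in_cons aX orbF.
have [xa|xa] := eqVneq a x.
  rewrite -xa (gt_eqF ab) /=; case: ifP => _; last by rewrite subr0 add0r.
  by rewrite exprS mulN1r mulNr addrC.
have [bx|bx] := eqVneq b x.
  have -> : X = [::].
    case: X xX Xab {ih sX aX W0 W0'} => // y Y /= /andP[xy _] /andP[/andP[_ yb] _].
    by move: xy; rewrite -bx ltNge yb.
  by rewrite /= expr1 mulN1r !subr0 bx.
rewrite /= W0 ?mem_head//; last by rewrite !lt_neqAle xa ax xb eq_sym bx.
by case: ifP => _; rewrite ?exprS; lra.
Qed.

End alternating_sums.

(** * Optimal families of intervals *)

Section optimal_alternating_sum.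
Context {R : realType}.
Implicit Types (W V : R -> R) (X Y : seq R) (x y a b M : R).

(** At most n intervals, possibly empty ones: the weak inequalities make the set of families
    compact, so that a maximum exists. *)
Definition adm a b n X := [/\ pairwise <=%R X, all (fun x => a <= x <= b) X,
  ~~ odd (size X) & (size X <= n.*2)%N].

Lemma altS_nseq W x n : altS W (nseq n.*2 x) = 0.
Proof. by elim: n => //= n ->; rewrite subr0 opprK addNr. Qed.

Lemma altS_max W a b n : a <= b -> continuous W ->
  exists2 X, adm a b n X & forall Y, adm a b n Y -> altS W Y <= altS W X.
Proof.
move=> ab cW; set m := n.*2.
pose sq (v : 'rV[R]_m) := [seq v ord0 j | j <- enum 'I_m].
have szsq v : size (sq v) = m by rewrite size_map size_enum_ord.
pose K := [set v : 'rV[R]_m | forall i, [set` `[a, b]] (v ord0 i)] `&`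
  [set v : 'rV[R]_m | forall i j : 'I_m, (i < j)%N -> v ord0 i <= v ord0 j].
have cc k : continuous (fun v : 'rV[R]_m => v ord0 k) by exact: coord_continuous.
have cK : compact K.
  apply: compact_closedI; first by apply: (@rV_compact _ _ (fun=> [set` `[a, b]])) => i; exact: segment_compact.
  rewrite (_ : mkset _ = \bigcap_(ij in [set ij : 'I_m * 'I_m | (ij.1 < ij.2)%N])
     [set v : 'rV[R]_m | v ord0 ij.1 <= v ord0 ij.2]); last first.
    apply/seteqP; split => [v H [i j] /= ij|v H i j ij]; first exact: H.
    by have /= := H (i, j); exact.
  apply: closed_bigI => -[i j] /= _.
  rewrite (_ : mkset _ = (fun v : 'rV[R]_m => v ord0 j - v ord0 i) @^-1` [set z | 0 <= z]).
    apply: preimage_closed; last exact: closed_ge.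
    move=> v _; have := cc j v; have := cc i v => ci cj; exact: (cvgB cj ci).
  by apply/seteqP; split => v /=; rewrite subr_ge0.
have cS : continuous (fun v => altS W (sq v)).
  rewrite /sq; elim: (enum 'I_m) => [|i l ih] v /=; first exact: (@cst_continuous _ _ (0 : R)).
  have ci := cc i v; have cWi := continuous_comp ci (cW _).
  exact: (cvgB (cvgN cWi) (ih v)).
have sqadm v : K v -> adm a b n (sq v).
  move=> [vab vs]; split; rewrite ?szsq ?odd_double//.
    rewrite pairwise_map.
    have : pairwise (fun i j : 'I_m => (i < j)%N) (enum 'I_m).
      rewrite -(pairwise_map val ltn) val_enum_ord.
      by rewrite -(sorted_pairwise ltn_trans) iota_ltn_sorted.
    by apply: sub_pairwise => i j; exact: vs.
  by apply/allP => x /mapP[i _ ->]; have := vab i; rewrite /= in_itv.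
have K0 : K !=set0.
  exists (const_mx a); split => [i|i j _]; rewrite !mxE//=.
  by rewrite in_itv/= lexx.
have [v vK vmax] := EVT_max_rV K0 cK (continuous_subspaceT cS).
exists (sq v); first by apply: sqadm; rewrite inE in vK.
move=> Y [sY Yab oY szY].
have [k kE] : exists k, size Y = k.*2.
  by exists (size Y)./2; rewrite -[LHS]odd_double_half (negbTE oY).
have km : (k <= n)%N by rewrite -leq_double -kE.
(* A shorter family is padded with empty intervals at b, which keep it sorted and add nothing to the
   sum, so that vectors of the single length 2 n represent all families. *)
pose Z := Y ++ nseq (n - k).*2 b.
have szZ : size Z = m by rewrite size_cat size_nseq kE -doubleD subnKC.
have <- : altS W Z = altS W Y by rewrite altS_cat altS_nseq mulr0 addr0.
have sZ : pairwise <=%R Z.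
  rewrite pairwise_cat sY; apply/and3P; split => //.
    by apply/allrelP => x y xY /nseqP[-> _]; have /andP[] := allP Yab x xY.
  by elim: (n - k).*2 => //= l ->; rewrite andbT; apply/allP => x /nseqP[->].
have Zab : all (fun x => a <= x <= b) Z.
  by rewrite all_cat Yab; apply/allP => x /nseqP[->]; rewrite ab lexx.
pose w : 'rV[R]_m := \row_j nth b Z j.
have <- : sq w = Z.
  rewrite /sq (eq_map (g := nth b Z \o val)); last by move=> j; rewrite mxE.
  by rewrite map_comp val_enum_ord -szZ map_nth_iota0// take_size.
apply: vmax; rewrite inE; split => [i|i j ij]; rewrite !mxE.
  by apply: (allP Zab); rewrite mem_nth// szZ.
by have /(pairwiseP b) := sZ; apply; rewrite ?inE ?szZ.
Qed.

End optimal_alternating_sum.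

(** * First-order conditions at an optimal family *)

Section critical_points.
Context {R : realType}.
Implicit Types (W : R -> R) (X : seq R) (x y a b w : R).

(** Differentiability with derivative w, multiplied out so that y = x is no exception. *)
Definition slope_at W x w := forall e : R, 0 < e -> exists2 d : R, 0 < d &
  forall y, `|y - x| < d -> `|W y - W x - w * (y - x)| <= e * `|y - x|.

Lemma slope_atN W x w : slope_at W x w -> slope_at (fun y => - W y) x (- w).
Proof.
move=> H e e0; have [d d0 h] := H e e0; exists d => // y /h.
by rewrite -normrN; congr (`|_| <= _); lra.
Qed.

Lemma slope_ge0_right W x w d : 0 < d -> slope_at W x w ->
  (forall y, x < y < x + d -> W x <= W y) -> 0 <= w.
Proof.
move=> d0 H Wx; rewrite leNgt; apply/negP => w0.
have e0 : 0 < - w / 2 by lra.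
have [d' d'0 h] := H _ e0.
pose m := Num.min d d'; have m0 : 0 < m by rewrite lt_min d0.
have md : m <= d by rewrite ge_min lexx.
have md' : m <= d' by rewrite ge_min lexx orbT.
have := Wx (x + m / 2) ltac:(clear -m0 md; lra).
have := h (x + m / 2); rewrite addrAC subrr add0r gtr0_norm ?divr_gt0//.
move=> /(_ ltac:(clear -m0 md'; lra)); rewrite ler_norml => /andP[_].
have : w * (m / 2) < 0 by rewrite pmulr_llt0// divr_gt0.
by clear; rewrite (_ : - w / 2 * (m / 2) = - (w * (m / 2)) / 2); lra.
Qed.

Lemma slope_ge0_left W x w d : 0 < d -> slope_at W x w ->
  (forall y, x - d < y < x -> W y <= W x) -> 0 <= w.
Proof.
move=> d0 H Wx; rewrite leNgt; apply/negP => w0.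
have e0 : 0 < - w / 2 by lra.
have [d' d'0 h] := H _ e0.
pose m := Num.min d d'; have m0 : 0 < m by rewrite lt_min d0.
have md : m <= d by rewrite ge_min lexx.
have md' : m <= d' by rewrite ge_min lexx orbT.
have := Wx (x - m / 2) ltac:(clear -m0 md; lra).
have := h (x - m / 2); rewrite addrAC subrr add0r normrN gtr0_norm ?divr_gt0//.
move=> /(_ ltac:(clear -m0 md'; lra)); rewrite ler_norml => /andP[+ _].
have : w * (m / 2) < 0 by rewrite pmulr_llt0// divr_gt0.
by clear; rewrite (_ : - w / 2 * (m / 2) = - (w * (m / 2)) / 2); lra.
Qed.

(** Strict sorting leaves room to move one entry: d is a lower bound of its distance to the others.
    Hence left end points of an optimal family are local minima of W in [a, b] and right end points
    local maxima, the parity of [size X1] telling which one x is. *)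
Lemma optimal_perturb W a b n X1 x X2 :
  adm a b n (X1 ++ x :: X2) -> pairwise <%R (X1 ++ x :: X2) ->
  (forall Y, adm a b n Y -> altS W Y <= altS W (X1 ++ x :: X2)) ->
  exists2 d, 0 < d & forall y, a <= y <= b -> `|y - x| < d ->
    (-1) ^+ size X1 * (W x - W y) <= 0.
Proof.
move=> [_ Xab oX szX]; rewrite pairwise_cat pairwise_cons => /and3P[XX s1 /andP[xX s2]] opt.
have dist (s : seq R) : x \notin s -> exists2 d, 0 < d & forall z, z \in s -> d <= `|z - x|.
  elim: s => [_|z s ih]; first by exists 1.
  rewrite in_cons negb_or => /andP[xz /ih[d d0 h]].
  exists (Num.min d `|z - x|); first by rewrite lt_min d0 normr_gt0 subr_eq0 eq_sym.
  move=> w; rewrite in_cons => /orP[/eqP ->|/h]; rewrite ge_min; first by rewrite lexx orbT.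
  by move=> ->.
have x1 z : z \in X1 -> z < x by move=> zX; move/allrelP : XX => /(_ z x zX (mem_head _ _)).
have x2 z : z \in X2 -> x < z by move=> zX; move/allP : xX => /(_ z zX).
have [|d d0 h] := dist (X1 ++ X2).
  rewrite mem_cat negb_or; apply/andP.
  by split; apply/negP; [move/x1|move/x2]; rewrite ltxx.
exists d => // y yab yd.
have y1 z : z \in X1 -> z <= y.
  move=> zX; have := h z; rewrite mem_cat zX => /(_ isT).
  have := x1 _ zX; move: yd; rewrite ltr_norml => /andP[yd _] zx.
  by rewrite ltr0_norm ?subr_lt0//; clear -yd zx; lra.
have y2 z : z \in X2 -> y <= z.
  move=> zX; have := h z; rewrite mem_cat zX orbT => /(_ isT).
  have := x2 _ zX; move: yd; rewrite ltr_norml => /andP[_ yd] zx.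
  by rewrite gtr0_norm ?subr_gt0//; clear -yd zx; lra.
have wk (s : seq R) : pairwise <%R s -> pairwise <=%R s.
  by apply: sub_pairwise => ? ?; exact: ltW.
have adY : adm a b n (X1 ++ y :: X2).
  split.
  - rewrite pairwise_cat pairwise_cons wk// wk// andbT; apply/andP; split.
      apply/allrelP => z w zX; rewrite in_cons => /orP[/eqP -> |wX]; first exact: y1.
      by apply/ltW/(lt_trans (x1 _ zX))/x2.
    by apply/allP => z /y2.
  - by move: Xab; rewrite !all_cat /= yab => /and3P[-> _ ->].
  - by move: oX; rewrite !size_cat.
  - by move: szX; rewrite !size_cat.
by have := opt _ adY; rewrite !altS_cat /=; clear; lra.
Qed.

End critical_points.

(** * The balance law on rectangles *)

Section rectangle_balance.
Context {R : realType}.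
Implicit Types (f : R -> R) (u h : R * R -> R) (G : R -> R -> R).
Implicit Types (t s x y a b c e d M : R) (X : seq R).

(* [G t x] stands for the integral of the source [g (t, .)] from 0 to x. *)
Record rect_balance f u G M : Prop := RectBalance {
  rb_flux : continuous f;
  rb_cont : continuous u;
  rb_ge0 : 0 <= M;
  rb_meas : forall x, measurable_fun setT (fun t => G t x);
  rb_lip : forall t x y, `|G t y - G t x| <= M * `|y - x|;
  rb_eq : forall t1 t2 a b,
    oint (fun x => u (t2, x)) a b - oint (fun x => u (t1, x)) a b =
    oint (fun t => f (u (t, a)) - f (u (t, b)) + (G t b - G t a)) t1 t2 }.

Lemma slice_x_continuous h t : continuous h -> continuous (fun x => h (t, x)).
Proof.
move=> ch x; apply: (@continuous_comp _ _ _ (fun x => (t, x)) h); last exact: ch.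
exact: (cvg_pair (cvg_cst t) cvg_id).
Qed.

Lemma slice_t_continuous h x : continuous h -> continuous (fun t => h (t, x)).
Proof.
move=> ch t; apply: (@continuous_comp _ _ _ (fun t => (t, x)) h); last exact: ch.
exact: (cvg_pair cvg_id (cvg_cst x)).
Qed.

Lemma rb_flux_cont f u G M : rect_balance f u G M -> continuous (fun p => f (u p)).
Proof.
by move=> B p; apply: continuous_comp; [exact: (rb_cont B)|exact: (rb_flux B)].
Qed.

Lemma loc_int_source f u G M x y : rect_balance f u G M ->
  loc_int (fun t => G t y - G t x).
Proof.
move=> B; apply: (@bounded_loc_int _ _ (M * `|y - x|)).
  by apply: measurable_funB; exact: (rb_meas B).
by move=> t; exact: (rb_lip B).
Qed.

Lemma loc_int_slice_t h x : continuous h -> loc_int (fun t => h (t, x)).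
Proof. by move=> ch; apply: continuous_loc_int; exact: slice_t_continuous. Qed.

Lemma loc_int_slice_x h t : continuous h -> loc_int (fun x => h (t, x)).
Proof. by move=> ch; apply: continuous_loc_int; exact: slice_x_continuous. Qed.

Lemma loc_int_u u t c : continuous u -> loc_int (fun x => u (t, x) - c).
Proof.
by move=> cu; apply: loc_intB; [exact: loc_int_slice_x|exact: loc_int_cst].
Qed.

Definition W u a c t x := oint (fun z => u (t, z) - c) a x.

Lemma W_slope u a c t x : continuous u -> slope_at (W u a c t) x (u (t, x) - c).
Proof.
move=> cu e e0; have [|d d0 h] := @oint_deriv _ (fun z => u (t, z) - c) x (loc_int_u t c cu) _ e e0.
  by apply: cvgB; [exact: slice_x_continuous|exact: cvg_cst].
exists d => // y /h; rewrite /W -(oint_cat a x y (loc_int_u t c cu)).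
by rewrite (addrC (oint _ a x)) addrK.
Qed.

Lemma W_continuous u a c t : continuous u -> continuous (W u a c t).
Proof.
move=> cu x; apply/cvgrPdist_lt => e e0.
have cu' : continuous (fun z => u (t, z) - c).
  by move=> z; apply: cvgB; [exact: slice_x_continuous|exact: cvg_cst].
have x11 : x - 1 <= x <= x + 1 by lra.
have [d d0 h] := @oint_cont_itv _ _ (x - 1) (x + 1) a cu' x x11 e e0.
have nd (r : R) : 0 < r -> \forall y \near x, `|y - x| < r.
  by move=> r0; apply/nbhs_ballP; exists r => //= z; rewrite /ball/= distrC.
near=> y; rewrite distrC; apply: h.
  have : `|y - x| < 1 by near: y; exact: nd.
  by rewrite ltr_norml => /andP[? ?]; apply/andP; split; lra.
by near: y; exact: nd.
Unshelve. all: by end_near. Qed.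

Lemma W_time f u G M a c t s x : rect_balance f u G M ->
  W u a c s x - W u a c t x =
  oint (fun r => f (u (r, a)) - f (u (r, x)) + (G r x - G r a)) t s.
Proof.
move=> B; have cu := rb_cont B; rewrite -(rb_eq B) /W.
by rewrite !ointB; try exact: loc_int_cst; try exact: loc_int_slice_x; lra.
Qed.

Lemma altS_oint (phi : R -> R -> R) X t s : (forall x, loc_int (phi x)) ->
  loc_int (fun r => altS (fun x => phi x r) X) /\
  altS (fun x => oint (phi x) t s) X = oint (fun r => altS (fun x => phi x r) X) t s.
Proof.
move=> lphi; elim: X => [|x X [ih1 ih2]] /=.
  by split; [exact: loc_int_cst|rewrite oint_cst mul0r].
split; first by apply: loc_intB => //; exact: loc_intN.
rewrite ih2 ointB//; last exact: loc_intN.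
by rewrite ointN.
Qed.

Lemma loc_int_rate f u G M a x : rect_balance f u G M ->
  loc_int (fun r => f (u (r, a)) - f (u (r, x)) + (G r x - G r a)).
Proof.
move=> B; have cq := rb_flux_cont B; apply: loc_intD; last exact: (loc_int_source _ _ B).
by apply: loc_intB; exact: (loc_int_slice_t (h := fun p => f (u p))).
Qed.

Lemma altS_W_time f u G M a c X t s : rect_balance f u G M -> ~~ odd (size X) ->
  altS (W u a c s) X - altS (W u a c t) X =
  oint (fun r => altS (fun x => G r x - G r a) X - altS (fun x => f (u (r, x))) X) t s.
Proof.
move=> B oX; rewrite -altSB (_ : (fun x => _) =
  fun x => oint (fun r => f (u (r, a)) - f (u (r, x)) + (G r x - G r a)) t s); last first.
  by apply/funext => x; exact: (W_time _ _ _ _ _ B).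
have [_ ->] := altS_oint X t s (fun x => loc_int_rate a x B).
congr oint; apply/funext => r; rewrite altSD altSB altS_cst//.
by rewrite sub0r addrC.
Qed.

(** For a fixed family the flux at a cancels in pairs. The source contributes at most M times the
    total length of the intervals, and continuity allows the flux at the end points to be frozen at
    time t, at the cost of e. *)
Lemma altS_W_rate f u G M a b c X t e : rect_balance f u G M -> a <= b -> 0 < e ->
  pairwise <=%R X -> all (fun x => a <= x <= b) X -> ~~ odd (size X) ->
  exists2 d, 0 < d & forall s, `|s - t| < d ->
  `|altS (W u a c s) X - altS (W u a c t) X + altS (fun x => f (u (t, x))) X * (s - t)|
   <= (M * (b - a) + e) * `|s - t|.
Proof.
move=> B ab e0 sX Xab oX.
have k0 : 0 < e / ((size X)%:R + 1) by rewrite divr_gt0// ltr_wpDl.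
have [d d0 h] := box_uniform t t a b (rb_flux_cont B) k0.
exists d => // s sd.
have lr := (altS_oint X t s (fun x => loc_int_rate a x B)).1.
rewrite (altS_W_time _ _ _ _ B)// -oint_cst -ointD; last first.
- exact: loc_int_cst.
- move: lr; congr loc_int; apply/funext => r; rewrite altSD altSB altS_cst//.
  by rewrite sub0r addrC.
apply: oint_norm_le.
  apply: loc_intD; last exact: loc_int_cst.
  move: lr; congr loc_int; apply/funext => r; rewrite altSD altSB altS_cst//.
  by rewrite sub0r addrC.
move=> r rts; rewrite -addrA; apply: le_trans (ler_normD _ _) _; apply: lerD.
  apply: altS_lipschitz => //; first exact: (rb_ge0 B).
  move=> x y ax xy yb.
  have -> : G r y - G r a - (G r x - G r a) = G r y - G r x by lra.
  by rewrite -(ger0_norm (_ : 0 <= y - x)) ?subr_ge0//; exact: (rb_lip B).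
rewrite addrC -altSB.
(* Each entry of X receives an equal share of e. *)
apply: le_trans (_ : (size X)%:R * (e / ((size X)%:R + 1)) <= _); last first.
  by rewrite mulrCA ler_piMr ?(ltW e0)// ler_pdivrMr ?ltr_wpDl// mul1r lerDl.
apply: altS_norm_le => x xX; rewrite distrC ltW//; apply: h => //; last first.
- by rewrite subrr normr0.
- apply: le_lt_trans sd; move: rts; clear.
  have [ts|/ltW st] := leP t s => /andP[? ?]; first by rewrite !ger0_norm; lra.
  by rewrite !ler0_norm; lra.
- exact: (allP Xab).
- by rewrite lexx.
Qed.

(** The slope of W is u - c, so it vanishes at optimal entries inside ]a, b[. At a and b only
    perturbations into the segment are admissible, which leaves an inequality; there the flux need
    not be f c and remains in the formula. *)
Lemma optimal_flux f u a b c n t X : continuous u -> a < b -> adm a b n X -> pairwise <%R X ->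
  (forall Y, adm a b n Y -> altS (W u a c t) Y <= altS (W u a c t) X) ->
  [/\ - altS (fun x => f (u (t, x))) X =
      (if a \in X then f (u (t, a)) - f c else 0) - (if b \in X then f (u (t, b)) - f c else 0),
      a \in X -> c <= u (t, a), b \in X -> c <= u (t, b) &
      forall x, x \in X -> a < x < b -> u (t, x) = c].
Proof.
move=> cu ab aX sX opt; have [_ Xab oX _] := aX.
have crit x : x \in X -> a < x < b -> u (t, x) = c.
  move=> /path.splitPr XE /andP[ax xb]; case: XE aX sX opt {Xab oX} => X1 X2 aX sX opt.
  have [d d0 h] := optimal_perturb aX sX opt.
  pose d' := Num.min d (Num.min (x - a) (b - x)).
  have d'0 : 0 < d' by rewrite !lt_min d0 !subr_gt0 ax xb.
  have [dd' da db] : [/\ d' <= d, d' <= x - a & d' <= b - x].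
    by split; rewrite !ge_min lexx ?orbT.
  have sl := @W_slope u a c t x cu.
  have hr y : x < y < x + d' -> (-1) ^+ size X1 * (W u a c t x - W u a c t y) <= 0.
    move=> /andP[y1 y2]; apply: h; first by clear -y1 y2 ax db; lra.
    by rewrite gtr0_norm ?subr_gt0//; clear -y2 dd'; lra.
  have hl y : x - d' < y < x -> (-1) ^+ size X1 * (W u a c t x - W u a c t y) <= 0.
    move=> /andP[y1 y2]; apply: h; first by clear -y1 y2 xb da; lra.
    by rewrite ltr0_norm ?subr_lt0//; clear -y1 dd'; lra.
  apply/eqP; rewrite -subr_eq0; apply/eqP/le_anti.
  move: hr hl; rewrite -signr_odd; case: (odd _) => hr hl.
  - rewrite (slope_ge0_left d'0 sl) ?andbT//; last first.
      by move=> y /hl; rewrite expr1 mulN1r; clear; lra.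
    rewrite -oppr_ge0; apply: (slope_ge0_right d'0 (slope_atN sl)).
    by move=> y /hr; rewrite expr1 mulN1r; clear; lra.
  - rewrite (slope_ge0_right d'0 sl) ?andbT//; last first.
      by move=> y /hr; rewrite expr0 mul1r; clear; lra.
    rewrite -oppr_ge0; apply: (slope_ge0_left d'0 (slope_atN sl)).
    by move=> y /hl; rewrite expr0 mul1r; clear; lra.
have ua : a \in X -> c <= u (t, a).
  move=> /path.splitPr XE; case: XE aX sX opt {crit oX} Xab => X1 X2 aX sX opt Xab.
  have X10 : X1 = [::].
    case: X1 sX Xab {aX opt} => // y X1; rewrite pairwise_cat => /andP[/allrelP H _].
    move=> /allP/(_ y); rewrite mem_head => /(_ isT) /andP[ay _].
    by have := H y a (mem_head _ _) (mem_head _ _); rewrite ltNge ay.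
  subst X1; have [d d0 h] := optimal_perturb aX sX opt.
  pose d' := Num.min d (b - a); have d'0 : 0 < d' by rewrite !lt_min d0 !subr_gt0.
  have [dd' db] : d' <= d /\ d' <= b - a by split; rewrite !ge_min lexx ?orbT.
  rewrite -subr_ge0; apply: (slope_ge0_right d'0 (@W_slope u a c t a cu)).
  move=> y /andP[y1 y2]; have := h y ltac:(clear -y1 y2 db; lra).
  rewrite expr0 mul1r gtr0_norm ?subr_gt0// subr_le0; apply.
  by clear -y2 dd'; lra.
have ub : b \in X -> c <= u (t, b).
  move=> /path.splitPr XE; case: XE aX sX opt {crit ua} oX Xab => X1 X2 aX sX opt oX Xab.
  have X20 : X2 = [::].
    case: X2 sX Xab {aX opt oX} => // y X2; rewrite pairwise_cat.
    move=> /and3P[_ _ /= /andP[/andP[byy _] _]].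
    move=> /allP/(_ y); rewrite mem_cat !in_cons eqxx !orbT => /(_ isT) /andP[_ yb].
    by move: byy; rewrite ltNge yb.
  subst X2; have [d d0 h] := optimal_perturb aX sX opt.
  pose d' := Num.min d (b - a); have d'0 : 0 < d' by rewrite !lt_min d0 !subr_gt0.
  have [dd' da] : d' <= d /\ d' <= b - a by split; rewrite !ge_min lexx ?orbT.
  rewrite -subr_ge0; apply: (slope_ge0_left d'0 (@W_slope u a c t b cu)).
  move=> y /andP[y1 y2]; have := h y ltac:(clear -y1 y2 da; lra).
  have -> : (-1) ^+ size X1 = -1 :> R.
    by rewrite -signr_odd; move: oX; rewrite size_cat addn1 /= negbK => ->.
  rewrite mulN1r ltr0_norm ?subr_lt0// oppr_le0 subr_ge0; apply.
  by clear -y1 dd'; lra.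
split => //.
(* The length is even, so subtracting the constant f c changes nothing and makes the summand vanish
   at interior entries. *)
have -> : altS (fun x => f (u (t, x))) X = altS (fun x => f (u (t, x)) - f c) X.
  by rewrite altSB altS_cst// subr0.
rewrite (@altS_sparse _ _ _ a b)//; last first.
  by move=> x xX /(crit _ xX) ux; rewrite ux subrr.
rewrite -signr_odd (negbTE oX) expr0 mul1r.
by case: ifP => _; case: ifP => _; lra.
Qed.

End rectangle_balance.

(** * The entropy balance up to an error of the order of the area *)

Section entropy.
Context {R : realType}.
Implicit Types (f : R -> R) (u h : R * R -> R) (G : R -> R -> R).
Implicit Types (t s x y a b c e d M : R) (X : seq R).

Lemma pos_continuous u t c : continuous u ->
  continuous (fun z => Num.max (u (t, z) - c) 0).
Proof.
move=> cu z; apply: (@continuous_max _ _ (fun z => u (t, z) - c) (fun=> 0)).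
  by apply: cvgB; [exact: slice_x_continuous|exact: cvg_cst].
exact: cvg_cst.
Qed.

Lemma loc_int_pos u t c : continuous u ->
  loc_int (fun z => Num.max (u (t, z) - c) 0).
Proof. by move=> cu; apply: continuous_loc_int; exact: pos_continuous. Qed.

(** Each increment of W integrates u - c, which is at most its positive part. The left bound x0 is
    tracked because the gain over b alone must be localized: an optimal family that avoids a
    neighbourhood of a loses the mass found there. *)
Lemma altS_W_le_pos u t c a b X x0 : continuous u -> x0 <= b ->
  pairwise <=%R X -> all (fun x => x0 <= x <= b) X -> ~~ odd (size X) ->
  altS (W u a c t) X <= oint (fun z => Num.max (u (t, z) - c) 0) x0 b.
Proof.
move=> cu; have [n] := ubnP (size X); have lp := loc_int_pos t c cu.
have p0 x y : x <= y -> 0 <= oint (fun z => Num.max (u (t, z) - c) 0) x y.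
  by move=> xy; apply: oint_ge0 => // z _; rewrite le_max lexx orbT.
elim: n X x0 => // n ih [|x [|y X]]//= x0 szX x0b.
  by move=> _ _ _; exact: p0.
move=> /and3P[/andP[xy xX] yX sX] /and3P[/andP[x0x xb] /andP[x0y yb] Xab].
rewrite negbK => oX; have := altS_pair (W u a c t) x y X; rewrite /= => ->.
have h1 : W u a c t y - W u a c t x <= oint (fun z => Num.max (u (t, z) - c) 0) x y.
  rewrite /W -(oint_cat a x y (loc_int_u t c cu)) (addrC (oint _ a x)) addrK.
  apply: le_oint => //; first exact: loc_int_u.
  by move=> z _; rewrite le_max lexx.
have h2 : altS (W u a c t) X <= oint (fun z => Num.max (u (t, z) - c) 0) y b.
  apply: ih => //; first exact: ltnW.
  by apply/allP => z zX; have /andP[_ ->] := allP Xab _ zX; rewrite (allP yX).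
rewrite -(oint_cat x0 y b lp) -(oint_cat x0 x y lp).
by move: h1 h2 (p0 _ _ x0x); clear; lra.
Qed.

(** Cut the segment into k cells of length at most d and keep those with u > c at their left end. On
    a kept cell (u - c)^+ exceeds u - c by at most e, on a dropped one it is at most e. *)
Lemma altS_W_near_pos u t c a b e d k x0 : continuous u -> 0 <= e -> 0 < d ->
  (forall x y, a <= x <= b -> a <= y <= b -> `|y - x| <= d -> `|u (t, y) - u (t, x)| <= e) ->
  a <= x0 <= b -> b - x0 <= k%:R * d ->
  exists X, [/\ pairwise <=%R X, all (fun x => x0 <= x <= b) X, ~~ odd (size X),
    (size X <= k.*2)%N &
    oint (fun z => Num.max (u (t, z) - c) 0) x0 b - e * (b - x0) <= altS (W u a c t) X].
Proof.
move=> cu e0 d0 osc; have lp := loc_int_pos t c cu; have lu := loc_int_u t c cu.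
elim: k x0 => [|k ih] x0 /andP[ax0 x0b].
  rewrite mul0r subr_le0 => bx0; have -> : x0 = b by apply/le_anti; rewrite x0b.
  by exists [::]; split => //=; rewrite oint_refl subrr mulr0 subr0.
rewrite -natr1 mulrDl mul1r => bx0.
pose x1 := Num.min b (x0 + d).
have x01 : x0 <= x1 by rewrite le_min x0b lerDl ltW.
have x1b : x1 <= b by rewrite ge_min lexx.
have x1d : x1 <= x0 + d by rewrite ge_min lexx orbT.
have x1k : b - x1 <= k%:R * d.
  rewrite /x1; case: (leP b (x0 + d)) => _; last by clear -bx0; lra.
  by rewrite subrr mulr_ge0// ltW.
have [|X [sX Xb oX szX HX]] := ih x1 _ x1k; first by rewrite (le_trans ax0).
have Xb' : all (fun x => x0 <= x <= b) X.
  by apply/allP => x /(allP Xb) /andP[h1 ->]; rewrite (le_trans x01).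
have oscx z : x0 <= z <= x1 -> `|u (t, z) - u (t, x0)| <= e.
  move=> /andP[z0 z1]; apply: osc; first by rewrite ax0.
    by rewrite (le_trans ax0)//= (le_trans z1).
  by rewrite ger0_norm ?subr_ge0//; clear -z1 x1d; lra.
have [ux|ux] := leP (u (t, x0)) c.
  exists X; split => //; first by apply: (leq_trans szX); rewrite doubleS; do 2 apply: leqW.
  rewrite -(oint_cat x0 x1 b lp).
  have : oint (fun z => Num.max (u (t, z) - c) 0) x0 x1 <= e * (x1 - x0).
    rewrite -oint_cst; apply: le_oint => //; first exact: loc_int_cst.
    move=> z /oscx; rewrite ler_norml ge_max e0 andbT => /andP[_].
    by clear -ux; lra.
  by move: HX; clear; lra.
exists [:: x0, x1 & X]; split => //=.
- rewrite x01 sX andbT /=; apply/andP; split; apply/allP => x /(allP Xb)/andP[h1 _] //.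
  exact: le_trans h1.
- by rewrite lexx x0b x01 x1b Xb'.
- by rewrite negbK.
- have := altS_pair (W u a c t) x0 x1 X; rewrite /= => ->.
  rewrite -(oint_cat x0 x1 b lp).
  have -> : W u a c t x1 - W u a c t x0 = oint (fun z => u (t, z) - c) x0 x1.
    by rewrite /W -(oint_cat a x0 x1 lu) (addrC (oint _ a x0)) addrK.
  have : oint (fun z => Num.max (u (t, z) - c) 0) x0 x1 <=
         oint (fun z => (u (t, z) - c) + e) x0 x1.
    apply: le_oint => //; first by apply: loc_intD => //; exact: loc_int_cst.
    move=> z /oscx; rewrite ler_norml ge_max lerDl e0 => /andP[+ _].
    by clear -ux; lra.
  rewrite ointD//; last exact: loc_int_cst.
  by rewrite oint_cst; move: HX; clear; lra.
Qed.

Lemma W_time_uniform u a b c t e : continuous u -> a <= b -> 0 < e ->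
  exists2 d, 0 < d & forall s x, `|s - t| < d -> a <= x <= b ->
    `|W u a c s x - W u a c t x| <= e.
Proof.
move=> cu ab e0; have k0 : 0 < e / (b - a + 1) by rewrite divr_gt0// ltr_wpDl ?subr_ge0.
have [d d0 h] := box_uniform t t a b cu k0.
exists d => // s x st /andP[ax xb]; rewrite /W -ointB; try exact: loc_int_u.
apply: (@le_trans _ _ (e / (b - a + 1) * `|x - a|)).
  apply: oint_norm_le; first by apply: loc_intB; exact: loc_int_u.
  move=> z; rewrite (min_idPl ax) (max_idPr ax) => /andP[az zx].
  have -> : u (s, z) - c - (u (t, z) - c) = u (s, z) - u (t, z) by lra.
  apply/ltW/h => //; rewrite ?lexx// ?subrr ?normr0//.
  by rewrite az (le_trans zx).
rewrite ger0_norm ?subr_ge0// mulrAC ler_pdivrMr ?ltr_wpDl ?subr_ge0//.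
by rewrite ler_pM2l//; clear -xb; lra.
Qed.

Lemma optimal_strict u a b c n t : continuous u -> a <= b -> exists X,
  [/\ adm a b n X, pairwise <%R X &
  forall Y, adm a b n Y -> altS (W u a c t) Y <= altS (W u a c t) X].
Proof.
move=> cu ab; have [X [sX Xab oX szX] Xopt] := altS_max n ab (@W_continuous _ u a c t cu).
have [Y [sY YX szY oY WY]] := altS_strict (W u a c t) sX.
exists Y; split => //; last by rewrite WY.
split.
- by apply: sub_pairwise sY => ? ?; exact: ltW.
- by apply/allP => y /YX /(allP Xab).
- by rewrite oY.
- exact: leq_trans szX.
Qed.

(* Danskin's argument: the best [n] intervals at time [t] remain admissible at
   time [s], and since [u = c] at their end points, moving them costs no flux. *)
Lemma entropy_estimate f u G M a b c t1 t2 : rect_balance f u G M -> a <= b -> t1 <= t2 ->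
  `| oint (fun z => Num.max (u (t2, z) - c) 0) a b
   - oint (fun z => Num.max (u (t1, z) - c) 0) a b
   - oint (fun t => f (Num.max (u (t, a)) c) - f (Num.max (u (t, b)) c)) t1 t2 |
  <= M * (b - a) * (t2 - t1).
Proof.
move=> B; rewrite le_eqVlt => /predU1P[->|ab] t12.
  rewrite !oint_refl !subrr sub0r normrN mulr0 mul0r.
  rewrite (_ : (fun t => _) = fun=> 0); last by apply/funext => t; rewrite subrr.
  by rewrite oint_cst mul0r normr0.
have cu := rb_cont B; have cf := rb_flux B; have leab := ltW ab.
set E := fun t => oint (fun z => Num.max (u (t, z) - c) 0) a b.
set Bf := fun t => f (Num.max (u (t, a)) c) - f (Num.max (u (t, b)) c).
have cBf : continuous Bf.
  have H x : continuous (fun t => f (Num.max (u (t, x)) c)).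
    move=> t; apply: (@continuous_comp _ _ _ (fun t => Num.max (u (t, x)) c) f); last exact: cf.
    apply: (@continuous_max _ _ (fun t => u (t, x)) (fun=> c)); last exact: cvg_cst.
    exact: slice_t_continuous.
  by move=> t; apply: cvgB; exact: H.
have lBf := continuous_loc_int cBf.
suff main : forall e, 0 < e ->
    `|E t2 - E t1 - oint Bf t1 t2| <= (M * (b - a) + 3 * e) * (t2 - t1) + 2 * e.
  apply/ler_addgt0Pr => e e0.
  have k0 : 0 < 3 * (t2 - t1) + 2 by clear -t12; lra.
  have := main (e / (3 * (t2 - t1) + 2)) (divr_gt0 e0 k0).
  have : e = e / (3 * (t2 - t1) + 2) * (3 * (t2 - t1) + 2) by rewrite divfK// gt_eqF.
  by move: (e / _) => k; clear; lra.
move=> e e0.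
have [d1 d10 fc] : exists2 d1, 0 < d1 & forall z, `|z - c| < d1 -> `|f z - f c| <= e.
  have /cvgrPdist_lt/(_ _ e0)/nbhs_ballP[r /= r0 hr] := cf c.
  by exists r => // z zc; rewrite distrC ltW//; apply: hr; rewrite /ball/= distrC.
have d120 : 0 < d1 / 2 by rewrite divr_gt0.
have [d2 d20 ud2] := box_uniform t1 t2 a b cu d120.
pose w := Num.min (d2 / 2) ((b - a) / 2).
have w0 : 0 < w by rewrite lt_min !divr_gt0// subr_gt0.
have [wd2 wba] : w <= d2 / 2 /\ w <= (b - a) / 2 by split; rewrite ge_min lexx ?orbT.
(* If u >= c + d1 at an end of the segment, then (u - c)^+ has mass at least m within w of that end.
   The accuracy e' is chosen so that the loss e' (b - a) of the optimal family stays below m. *)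
pose m := w * (d1 / 2); have m0 : 0 < m by rewrite mulr_gt0.
pose e' := Num.min (m / 2) e / (b - a + 1).
have ba1 : 0 < b - a + 1 by rewrite ltr_wpDl// subr_ge0.
have e'0 : 0 < e' by rewrite divr_gt0// lt_min divr_gt0.
have e'ba : e' * (b - a) < m /\ e' * (b - a) <= e.
  have h : e' * (b - a) <= Num.min (m / 2) e.
    rewrite /e' mulrAC ler_pdivrMr// ler_wpM2l//; first by rewrite le_min !ltW// divr_gt0.
    by clear; lra.
  split; last by apply: le_trans h _; rewrite ge_min lexx orbT.
  apply: (@le_lt_trans _ _ (m / 2)); last by clear -m0; lra.
  by apply: le_trans h _; rewrite ge_min lexx.
have [d3 d30 ud3] := box_uniform t1 t2 a b cu e'0.
(* The number of cells of length d3 / 2, hence of intervals allowed in a family; it is the same for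
   all t in [t1, t2]. *)
pose k := (Num.truncn ((b - a) / (d3 / 2))).+1.
have kd : b - a <= k%:R * (d3 / 2).
  by rewrite -ler_pdivrMr ?divr_gt0// ltW// truncnS_gt.
have /choice[X HX] : forall t, exists X, [/\ adm a b k X, pairwise <%R X &
    forall Y, adm a b k Y -> altS (W u a c t) Y <= altS (W u a c t) X].
  by move=> t; exact: optimal_strict.
pose F t := altS (W u a c t) (X t).
have FE t : t1 <= t <= t2 -> E t - e' * (b - a) <= F t /\ F t <= E t.
  move=> tt; have [aX sX opt] := HX t; have [sX' Xab oX _] := aX.
  split; last exact: altS_W_le_pos.
  have [||||Y [sY Yab oY szY]] := @altS_W_near_pos u t c a b e' (d3 / 2) k a cu (ltW e'0).
  - by rewrite divr_gt0.
  - move=> x y xab yab yx; apply/ltW/ud3 => //; first by rewrite subrr normr0.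
    by apply: le_lt_trans yx _; clear -d30; lra.
  - by rewrite lexx.
  - exact: kd.
  by move=> /le_trans; apply; exact: opt.
have Fc : cont_itv t1 t2 F.
  move=> t tt r r0.
  have r'0 : 0 < r / 2 / (k.*2%:R + 1) by rewrite !divr_gt0// ltr_wpDl.
  have [d d0 h] := W_time_uniform c t cu leab r'0.
  exists d => // s ss st.
  have diff Y : adm a b k Y -> `|altS (W u a c s) Y - altS (W u a c t) Y| < r.
    move=> [_ Yab _ szY]; rewrite -altSB.
    apply: (@le_lt_trans _ _ ((size Y)%:R * (r / 2 / (k.*2%:R + 1)))).
      by apply: altS_norm_le => x /(allP Yab) xab; exact: h.
    apply: (@le_lt_trans _ _ (r / 2)); last by clear -r0; lra.
    rewrite mulrCA ler_piMr ?divr_ge0 ?(ltW r0)// ler_pdivrMr ?ltr_wpDl// mul1r.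
    by rewrite (@le_trans _ _ k.*2%:R) ?ler_nat// lerDl.
  have [as_ _ opts] := HX s; have [at_ _ optt] := HX t.
  have := diff _ as_; have := diff _ at_; have := opts _ at_; have := optt _ as_.
  rewrite /F !ltr_norml => h1 h2 /andP[h3 h4] /andP[h5 h6].
  by apply/andP; split; [clear -h2 h3|clear -h1 h6]; lra.
have flux t : t1 <= t <= t2 -> `|- altS (fun x => f (u (t, x))) (X t) - Bf t| <= 2 * e.
  move=> tt; have [aX sX opt] := HX t; have [sX' Xab oX _] := aX.
  have [-> ua ub crit] := optimal_flux f cu ab aX sX opt.
  have [FE1 _] := FE t tt; have [e'm _] := e'ba.
  have lp := loc_int_pos t c cu.
  (* If a is used, u >= c there and the two terms agree. If it is not and u < c + d1 at a, the
     discrepancy is at most e by the choice of d1. Otherwise u > c on [a, a + w], where no critical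
     entry can lie, so the family misses the mass m, contrary to its near optimality. *)
  have Ha : `|(if a \in X t then f (u (t, a)) - f c else 0) -
             (f (Num.max (u (t, a)) c) - f c)| <= e.
    case: ifP => [/ua uac|aNX]; first by rewrite (max_idPl uac) subrr normr0 ltW.
    rewrite sub0r normrN; have [uad|uad] := ltP (u (t, a)) (c + d1).
      apply: fc; rewrite ger0_norm; last by rewrite subr_ge0 le_max lexx orbT.
      by rewrite ltrBlDl gt_max uad ltrDl.
    have near_a z : a <= z <= a + w -> c + d1 / 2 <= u (t, z).
      move=> /andP[z1 z2]; have := ud2 t a t z tt; rewrite lexx leab subrr normr0.
      move=> /(_ isT d20); rewrite ger0_norm ?subr_ge0//.
      move=> /(_ ltac:(clear -z2 wd2 d20; lra)); rewrite ltr_norml => /andP[h1 _].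
      by clear -h1 uad; lra.
    have Xaw : all (fun x => a + w <= x <= b) (X t).
      apply/allP => x xX; have /andP[ax xb] := allP Xab x xX; rewrite xb andbT.
      rewrite leNgt; apply/negP => xaw.
      have xab : a < x < b.
        apply/andP; split; last by clear -xaw wba ab; lra.
        by rewrite lt_neqAle ax andbT; apply/eqP => axE; move: aNX; rewrite axE xX.
      have := near_a x; rewrite ax (ltW xaw) => /(_ isT); rewrite (crit x xX xab).
      by clear -d10; lra.
    have awb : a + w <= b by clear -wba ab; lra.
    have := altS_W_le_pos t c a cu awb sX' Xaw oX.
    have : m <= oint (fun z => Num.max (u (t, z) - c) 0) a (a + w).
      have <- : oint (fun=> d1 / 2) a (a + w) = m.
        by rewrite oint_cst (addrC a) addrK mulrC.
      apply: le_oint => //; [exact: loc_int_cst|by rewrite lerDl ltW|].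
      move=> z /near_a; rewrite le_max; move=> h1; apply/orP; left.
      by clear -h1; lra.
    move: FE1 e'm; rewrite /E -(oint_cat a (a + w) b lp) /F; clear => *; exfalso; lra.
  have Hb : `|(if b \in X t then f (u (t, b)) - f c else 0) -
             (f (Num.max (u (t, b)) c) - f c)| <= e.
    case: ifP => [/ub ubc|bNX]; first by rewrite (max_idPl ubc) subrr normr0 ltW.
    rewrite sub0r normrN; have [ubd|ubd] := ltP (u (t, b)) (c + d1).
      apply: fc; rewrite ger0_norm; last by rewrite subr_ge0 le_max lexx orbT.
      by rewrite ltrBlDl gt_max ubd ltrDl.
    have near_b z : b - w <= z <= b -> c + d1 / 2 <= u (t, z).
      move=> /andP[z1 z2]; have := ud2 t b t z tt; rewrite lexx leab subrr normr0.
      move=> /(_ isT d20); rewrite ler0_norm ?subr_le0//.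
      move=> /(_ ltac:(clear -z1 wd2 d20; lra)); rewrite ltr_norml => /andP[h1 _].
      by clear -h1 ubd; lra.
    have Xbw : all (fun x => a <= x <= b - w) (X t).
      apply/allP => x xX; have /andP[ax xb] := allP Xab x xX; rewrite ax /=.
      rewrite leNgt; apply/negP => xbw.
      have xab : a < x < b.
        apply/andP; split; first by clear -xbw wba ab; lra.
        by rewrite lt_neqAle xb andbT; apply/eqP => bxE; move: bNX; rewrite -bxE xX.
      have := near_b x; rewrite xb (ltW xbw) => /(_ isT); rewrite (crit x xX xab).
      by clear -d10; lra.
    have awb : a <= b - w by clear -wba ab; lra.
    have := altS_W_le_pos t c a cu awb sX' Xbw oX.
    have : m <= oint (fun z => Num.max (u (t, z) - c) 0) (b - w) b.
      have <- : oint (fun=> d1 / 2) (b - w) b = m by rewrite oint_cst subKr mulrC.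
      apply: le_oint => //; [exact: loc_int_cst|by clear -w0; lra|].
      move=> z /near_b; rewrite le_max; move=> h1; apply/orP; left.
      by clear -h1; lra.
    move: FE1 e'm; rewrite /E -(oint_cat a (b - w) b lp) /F; clear => *; exfalso; lra.
  rewrite /Bf; move: Ha Hb; rewrite !ler_norml => /andP[h1 h2] /andP[h3 h4].
  by apply/andP; split; [clear -h1 h4|clear -h2 h3]; lra.
pose K := M * (b - a) + 3 * e.
(* One inequality suffices because it holds for s on both sides of t: s > t bounds the growth of F
   from below, s < t bounds it from above. *)
have rate t : t1 <= t <= t2 -> exists2 d, 0 < d & forall s, `|s - t| < d ->
    Bf t * (s - t) - K * `|s - t| <= F s - F t.
  move=> tt; have [aX sX opt] := HX t; have [sX' Xab oX _] := aX.
  have [d d0 h] := altS_W_rate c t B leab e0 sX' Xab oX.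
  exists d => // s st; have [_ _ opts] := HX s.
  have := opts _ aX; rewrite -/(F s) => Fs.
  have := h s st; rewrite ler_norml => /andP[h1 _].
  have h2 : `|(- altS (fun x => f (u (t, x))) (X t) - Bf t) * (s - t)| <= 2 * e * `|s - t|.
    by rewrite normrM ler_wpM2r//; exact: flux.
  move: h2; rewrite ler_norml => /andP[h2 _].
  by move: h1 h2 Fs; rewrite /K /F; clear; lra.
have [[Fa Fa'] [Fb Fb']] : (E t1 - e' * (b - a) <= F t1 /\ F t1 <= E t1) /\
    (E t2 - e' * (b - a) <= F t2 /\ F t2 <= E t2).
  by split; apply: FE; rewrite lexx t12.
have cBK k' : continuous (fun t => Bf t + k').
  by move=> t; apply: cvgD; [exact: cBf|exact: cvg_cst].
have upper : F t2 - F t1 <= oint (fun t => Bf t + K) t1 t2.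
  apply: le_oint_of_left_dini => // t /andP[t1t tt2] r r0.
  have [d d0 h] := rate t ltac:(by rewrite tt2 ltW).
  exists d => // s /andP[sd st] _.
  have := h s; rewrite ltr0_norm ?subr_lt0// => /(_ ltac:(clear -sd; lra)) h1.
  have : 0 <= r * (t - s) by rewrite mulr_ge0 ?ltW// subr_gt0.
  by move: h1; clear; lra.
have lower : oint (fun t => Bf t + - K) t1 t2 <= F t2 - F t1.
  apply: ge_oint_of_right_dini => // t /andP[t1t tt2] r r0.
  have [d d0 h] := rate t ltac:(by rewrite t1t ltW).
  exists d => // s /andP[st sd] _.
  have := h s; rewrite gtr0_norm ?subr_gt0// => /(_ ltac:(clear -sd; lra)) h1.
  have : 0 <= r * (s - t) by rewrite mulr_ge0 ?ltW// subr_gt0.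
  by move: h1; clear; lra.
have addB k' : oint (fun t => Bf t + k') t1 t2 = oint Bf t1 t2 + k' * (t2 - t1).
  by rewrite ointD ?oint_cst//; exact: loc_int_cst.
move: upper lower; rewrite !addB => upper lower.
have [_ e'e] := e'ba.
have -> : M * (b - a) + 3 * e = K by [].
rewrite ler_norml; apply/andP.
by split; [clear -Fa Fb' e'e lower e0|clear -Fa' Fb e'e upper e0]; lra.
Qed.

End entropy.

(** * Iterated integrals and Kruzkov balances *)

Section measurability.
Context {R : realType}.
Implicit Types (a b c e K M : R).
Notation mu := (@lebesgue_measure R).

(** Adding K makes the integrand nonnegative, so Tonelli applies after the moving bounds are written
    as an indicator; the added K (h - l) is subtracted afterwards. *)
Lemma measurable_oint d (T : measurableType d) (phi : T * R -> R) (lo hi : T -> R) K :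
  measurable_fun setT phi -> (forall p, `|phi p| <= K) ->
  measurable_fun setT lo -> measurable_fun setT hi ->
  measurable_fun setT (fun t => oint (fun y => phi (t, y)) (lo t) (hi t)).
Proof.
move=> mphi phiK mlo mhi.
have K0 p : 0 <= phi p + K by have := phiK p; rewrite ler_norml => /andP[]; lra.
pose J (lo hi : T -> R) t := fine (\int[mu]_y
  (if (lo t <= y) && (y <= hi t) then phi (t, y) + K else 0)%:E).
have mJ l h : measurable_fun setT l -> measurable_fun setT h -> measurable_fun setT (J l h).
  move=> ml mh; apply: (measurableT_comp (fine_measurable measurableT)).
  apply: (measurable_fun_fubini_tonelli_F (m2 := mu)
    (fun p : T * R => (if (l p.1 <= p.2) && (p.2 <= h p.1) then phi p + K else 0)%:E)).
    apply/measurable_EFinP; apply: measurable_fun_ifT => //.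
      apply: measurable_and.
        by apply: measurable_fun_ler => //; exact: measurableT_comp.
      by apply: measurable_fun_ler => //; exact: measurableT_comp.
    exact: measurable_funD.
  by move=> p; rewrite lee_fin; case: ifP.
have JE l h t : l t <= h t -> oint (fun y => phi (t, y)) (l t) (h t) = J l h t - K * (h t - l t).
  move=> lh; have lphi : loc_int (fun y => phi (t, y)).
    by apply: (bounded_loc_int (M := K)) => //; exact: measurable_fun_pair2.
  apply/eqP; rewrite eq_sym subr_eq -oint_cst -ointD//; last exact: loc_int_cst.
  rewrite ointE// Rintegral_mkcond; apply/eqP; congr fine.
  apply: eq_integral => y _; rewrite patchE; congr EFin.
  by rewrite mem_setE in_itv/=.
rewrite (_ : (fun t => _) = fun t => if lo t <= hi t then J lo hi t - K * (hi t - lo t)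
   else - (J hi lo t - K * (lo t - hi t))); last first.
  apply/funext => t; case: ifPn; first exact: JE.
  by rewrite -ltNge => /ltW hl; rewrite -JE// -oint_swap.
apply: measurable_fun_ifT; first exact: measurable_fun_ler.
  apply: measurable_funB; first exact: mJ.
  by apply: measurable_funM => //; exact: measurable_funB.
apply: measurableT_comp => //; apply: measurable_funB; first exact: mJ.
by apply: measurable_funM => //; exact: measurable_funB.
Qed.

(** The product sigma-algebra is generated by rectangles, so U is written as a countable union of
    squares with rational centres; squares not contained in U are replaced by the empty set to keep
    the index set fixed. *)
Lemma open_prod_measurable (U : set (R * R)) : open U -> measurable U.
Proof.
move=> oU.
pose box (q : rat) (r : rat) (k : nat) : set (R * R) :=
  ball (ratr q : R) k.+1%:R^-1 `*` ball (ratr r : R) k.+1%:R^-1.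
pose B q r k := if `[< box q r k `<=` U >] then box q r k else set0.
have -> : U = \bigcup_q \bigcup_r \bigcup_k B q r k.
  apply/seteqP; split => [[t x] Utx|p [q _ [r _ [k _]]]]; last first.
    by rewrite /B; case: asboolP => // + Bp; exact.
  have /nbhs_ballP[e /= e0 eU] : nbhs (t, x) U by apply: open_nbhs_nbhs; split.
  pose k := Num.truncn (2 / e).
  have ke : 2 * k.+1%:R^-1 < e.
    by rewrite ltr_pdivrMr// mulrC -ltr_pdivrMr// truncnS_gt.
  have k0 : 0 < k.+1%:R^-1 :> R by rewrite invr_gt0.
  have dense (z : R) : exists q : rat, ball (ratr q : R) k.+1%:R^-1 z.
    have zk : z < z + k.+1%:R^-1 by rewrite ltrDl.
    have [q] := rat_in_itvoo zk; rewrite in_itv/= => /andP[q1 q2].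
    by exists q; rewrite /ball/= ger0_norm; [rewrite ltrBlDl|rewrite subr_ge0 ltW].
  have [q Hq] := dense t; have [r Hr] := dense x.
  exists q => //; exists r => //; exists k => //; rewrite /B.
  case: asboolP => // -[]; move=> [s y] [/= Hs Hy]; apply: eU.
  have H (z w v : R) : ball z k.+1%:R^-1 w -> ball z k.+1%:R^-1 v -> ball w e v.
    rewrite /ball/= => h1 h2; apply: le_lt_trans ke.
    have -> : w - v = (z - v) - (z - w) by lra.
    apply: le_trans (ler_normB _ _) _; rewrite mulr2n mulrDl mul1r.
    by apply: lerD; exact: ltW.
  by split; [exact: H Hs|exact: H Hy].
apply: bigcupT_measurable_rat => q; apply: bigcupT_measurable_rat => r.
apply: bigcupT_measurable => k; rewrite /B; case: asboolP => // _.
by apply: measurableX; exact: measurable_ball.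
Qed.

Lemma continuous2_measurable (h : R * R -> R) : continuous h -> measurable_fun setT h.
Proof.
move=> /continuousP ch; apply: (measurability _ (RGenOpens.measurableE R)).
move=> _ [_ [a [b ->] <-]]; rewrite setTI; apply: open_prod_measurable.
exact/ch/interval_open.
Qed.

Lemma closed_prod_measurable (A : set (R * R)) : closed A -> measurable A.
Proof.
by move=> /closed_openC/open_prod_measurable/measurableC; rewrite setCK.
Qed.

Definition oint2 (phi : R * R -> R) t1 t2 a b : R :=
  oint (fun t => oint (fun x => phi (t, x)) a b) t1 t2.

Definition bdd2 (phi : R * R -> R) K :=
  measurable_fun setT phi /\ forall p, `|phi p| <= K.

Lemma bdd2_slice phi K t : bdd2 phi K -> loc_int (fun x => phi (t, x)).
Proof.
move=> [mphi phiK]; apply: (bounded_loc_int (M := K)) => //.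
exact: measurable_fun_pair2.
Qed.

Lemma bdd2_inner_measurable phi K a b : bdd2 phi K ->
  measurable_fun setT (fun t => oint (fun x => phi (t, x)) a b).
Proof. by move=> [mphi phiK]; apply: (measurable_oint (K := K)). Qed.

Lemma bdd2_inner_le phi K t a b : bdd2 phi K ->
  `|oint (fun x => phi (t, x)) a b| <= K * `|b - a|.
Proof.
move=> H; apply: oint_norm_le; first exact: bdd2_slice H.
by move=> x _; apply: H.2.
Qed.

Lemma bdd2_inner phi K a b : bdd2 phi K ->
  loc_int (fun t => oint (fun x => phi (t, x)) a b).
Proof.
move=> H; apply: (bounded_loc_int (M := K * `|b - a|)).
  exact: bdd2_inner_measurable H.
by move=> t; exact: bdd2_inner_le.
Qed.

Lemma oint2_cat_t phi K t1 t2 t3 a b : bdd2 phi K ->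
  oint2 phi t1 t2 a b + oint2 phi t2 t3 a b = oint2 phi t1 t3 a b.
Proof. by move=> H; apply: oint_cat; exact: bdd2_inner H. Qed.

Lemma oint2_cat_x phi K t1 t2 a b c : bdd2 phi K ->
  oint2 phi t1 t2 a b + oint2 phi t1 t2 b c = oint2 phi t1 t2 a c.
Proof.
move=> H; rewrite /oint2 -ointD; try exact: bdd2_inner H.
by congr oint; apply/funext => t; apply: oint_cat; exact: bdd2_slice H.
Qed.

Lemma oint2B phi psi K L t1 t2 a b : bdd2 phi K -> bdd2 psi L ->
  oint2 (fun p => phi p - psi p) t1 t2 a b = oint2 phi t1 t2 a b - oint2 psi t1 t2 a b.
Proof.
move=> H1 H2; rewrite /oint2 -ointB; [|exact: bdd2_inner H1|exact: bdd2_inner H2].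
congr oint; apply/funext => t; apply: ointB; [exact: bdd2_slice H1|exact: bdd2_slice H2].
Qed.

Lemma eq_oint2 phi psi t1 t2 a b : t1 <= t2 -> a <= b ->
  (forall t x, t1 <= t <= t2 -> a <= x <= b -> phi (t, x) = psi (t, x)) ->
  oint2 phi t1 t2 a b = oint2 psi t1 t2 a b.
Proof.
move=> t12 ab H; apply: eq_oint => t; rewrite (min_idPl t12) (max_idPr t12) => tt.
by apply: eq_oint => x; rewrite (min_idPl ab) (max_idPr ab); exact: H.
Qed.

Lemma oint2_cst k t1 t2 a b : oint2 (fun=> k) t1 t2 a b = k * (b - a) * (t2 - t1).
Proof. by rewrite /oint2 (eq_oint (g := fun=> k * (b - a))) ?oint_cst// => t _; rewrite oint_cst. Qed.

Lemma bdd2_cst (k : R) : bdd2 (fun=> k) `|k|.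
Proof. by split => //; exact: measurable_cst. Qed.

Lemma oint2_norm_le phi K t1 t2 a b : bdd2 phi K -> t1 <= t2 -> a <= b ->
  `|oint2 phi t1 t2 a b| <= K * (b - a) * (t2 - t1).
Proof.
move=> H t12 ab; rewrite -(ger0_norm (_ : 0 <= t2 - t1)) ?subr_ge0//.
apply: oint_norm_le; first exact: bdd2_inner H.
move=> t _; rewrite -(ger0_norm (_ : 0 <= b - a)) ?subr_ge0//.
exact: bdd2_inner_le.
Qed.

Lemma oint2_dominated (phi_ : nat -> R * R -> R) phi K t1 t2 a b :
  (forall n, bdd2 (phi_ n) K) -> bdd2 phi K ->
  (forall p, phi_ n p @[n --> \oo] --> phi p) ->
  oint2 (phi_ n) t1 t2 a b @[n --> \oo] --> oint2 phi t1 t2 a b.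
Proof.
move=> H_ H cv; apply: (oint_dominated (M := K * `|b - a|)).
- by move=> n; exact: bdd2_inner_measurable (H_ n).
- by move=> n t _; exact: bdd2_inner_le.
- move=> t _; apply: (oint_dominated (M := K)) => //.
  + by move=> n; apply: measurable_fun_pair2; exact: (H_ n).1.
  + by move=> n x _; exact: (H_ n).2.
  + by apply: measurable_fun_pair2; exact: H.1.
- exact: bdd2_inner_measurable H.
Qed.

End measurability.

(** * Entropy balances for (u - c)^+ *)

Section kruzkov.
Context {R : realType}.
Implicit Types (f : R -> R) (u g : R * R -> R).
Implicit Types (t s x y a b c e d M L A : R).

Definition srcG g t x : R := oint (fun y => g (t, y)) 0 x.

Lemma srcGB g M t a b : bdd2 g M -> srcG g t b - srcG g t a = oint (fun x => g (t, x)) a b.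
Proof.
by move=> H; rewrite /srcG -(oint_cat 0 a b (bdd2_slice t H)) (addrC (oint _ 0 a)) addrK.
Qed.

(** The boundary terms of the balance of the entropy (u - c)^+ on a rectangle. Its flux is f (max u
    c) - f c, whose constant cancels between a and b. *)
Definition kruzkov f u c t1 t2 a b : R :=
  oint (fun z => Num.max (u (t2, z) - c) 0) a b
  - oint (fun z => Num.max (u (t1, z) - c) 0) a b
  - oint (fun t => f (Num.max (u (t, a)) c) - f (Num.max (u (t, b)) c)) t1 t2.

Lemma kruzkov_flux_cont f u c x : continuous f -> continuous u ->
  continuous (fun t => f (Num.max (u (t, x)) c)).
Proof.
move=> cf cu t; apply: (@continuous_comp _ _ _ (fun t => Num.max (u (t, x)) c) f); last exact: cf.
apply: (@continuous_max _ _ (fun t => u (t, x)) (fun=> c)); last exact: cvg_cst.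
exact: slice_t_continuous.
Qed.

Lemma loc_int_kruzkov_flux f u c x : continuous f -> continuous u ->
  loc_int (fun t => f (Num.max (u (t, x)) c)).
Proof. by move=> cf cu; apply: continuous_loc_int; exact: (kruzkov_flux_cont cf cu). Qed.

Lemma kruzkov_cat_t f u c t1 t2 t3 a b : continuous f -> continuous u ->
  kruzkov f u c t1 t2 a b + kruzkov f u c t2 t3 a b = kruzkov f u c t1 t3 a b.
Proof.
move=> cf cu.
have lf : loc_int (fun t => f (Num.max (u (t, a)) c) - f (Num.max (u (t, b)) c)).
  by apply: loc_intB; exact: (@loc_int_kruzkov_flux f u _ _ cf cu).
by rewrite /kruzkov -(oint_cat t1 t2 t3 lf); lra.
Qed.

Lemma kruzkov_cat_x f u c t1 t2 a m b : continuous f -> continuous u ->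
  kruzkov f u c t1 t2 a m + kruzkov f u c t1 t2 m b = kruzkov f u c t1 t2 a b.
Proof.
move=> cf cu; rewrite /kruzkov.
rewrite -(oint_cat a m b (loc_int_pos t2 c cu)) -(oint_cat a m b (loc_int_pos t1 c cu)).
by rewrite !ointB; try exact: (@loc_int_kruzkov_flux f u _ _ cf cu); lra.
Qed.

Lemma kruzkov_above f u g M c t1 t2 a b : rect_balance f u (srcG g) M -> bdd2 g M ->
  t1 <= t2 -> a <= b ->
  (forall t x, t1 <= t <= t2 -> a <= x <= b -> c <= u (t, x)) ->
  kruzkov f u c t1 t2 a b = oint2 g t1 t2 a b.
Proof.
move=> B bg t12 ab uc; have cu := rb_cont B; have cq := rb_flux_cont B.
have E t : t1 <= t <= t2 -> oint (fun z => Num.max (u (t, z) - c) 0) a b =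
    oint (fun z => u (t, z)) a b - c * (b - a).
  move=> tt; rewrite -oint_cst -ointB; [|exact: loc_int_slice_x|exact: loc_int_cst].
  apply: eq_oint => z; rewrite (min_idPl ab) (max_idPr ab) => zab.
  by apply/max_idPl; rewrite subr_ge0; exact: uc.
rewrite /kruzkov !E ?lexx ?t12//.
have := rb_eq B t1 t2 a b; rewrite ointD; last exact: (loc_int_source _ _ B); last first.
  by apply: loc_intB; exact: (loc_int_slice_t (h := fun p => f (u p))).
have -> : oint (fun t => srcG g t b - srcG g t a) t1 t2 = oint2 g t1 t2 a b.
  by congr oint; apply/funext => t; exact: srcGB bg.
have -> : oint (fun t => f (Num.max (u (t, a)) c) - f (Num.max (u (t, b)) c)) t1 t2 =
   oint (fun t => f (u (t, a)) - f (u (t, b))) t1 t2.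
  apply: eq_oint => t; rewrite (min_idPl t12) (max_idPr t12) => tt.
  by rewrite !(max_idPl _)// ; apply: uc; rewrite // ?lexx ab.
by lra.
Qed.

Lemma kruzkov_below f u c t1 t2 a b : t1 <= t2 -> a <= b ->
  (forall t x, t1 <= t <= t2 -> a <= x <= b -> u (t, x) <= c) ->
  kruzkov f u c t1 t2 a b = 0.
Proof.
move=> t12 ab uc.
have E t : t1 <= t <= t2 -> oint (fun z => Num.max (u (t, z) - c) 0) a b = 0.
  move=> tt; rewrite (eq_oint (g := fun=> 0)) ?oint_cst ?mul0r// => z.
  rewrite (min_idPl ab) (max_idPr ab) => zab.
  by apply/max_idPr; rewrite subr_le0; exact: uc.
rewrite /kruzkov !E ?lexx ?t12// (eq_oint (g := fun=> 0)) ?oint_cst ?mul0r ?subr0// => t.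
rewrite (min_idPl t12) (max_idPr t12) => tt.
by rewrite !(max_idPr _) ?subrr//; apply: uc; rewrite // ?lexx ab.
Qed.

(** Both (u - c)^+ and f (max u c) are Lipschitz in c. The constant involves the sides of the
    rectangle and not the behaviour of u near the level c, which is what later bounds the source
    over thin bands of levels. *)
Lemma kruzkov_lipschitz f u c c' A L t1 t2 a b : continuous f -> continuous u ->
  t1 <= t2 -> a <= b -> `|c| <= A -> `|c'| <= A -> 0 <= L ->
  (forall x y, `|x| <= A -> `|y| <= A -> `|f y - f x| <= L * `|y - x|) ->
  (forall t x, t1 <= t <= t2 -> a <= x <= b -> `|u (t, x)| <= A) ->
  `|kruzkov f u c t1 t2 a b - kruzkov f u c' t1 t2 a b| <=
    (2 * (b - a) + 2 * L * (t2 - t1)) * `|c - c'|.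
Proof.
move=> cf cu t12 ab cA c'A L0 fL uA.
have maxA z w : `|z| <= A -> `|w| <= A -> `|Num.max z w| <= A.
  by move=> ? ?; case: (leP z w).
have maxL (z w w' : R) : `|Num.max z w - Num.max z w'| <= `|w - w'|.
  have [h1|h1] := leP z w; have [h2|h2] := leP z w'; rewrite ?subrr ?normr0//.
  - rewrite [leRHS]ger0_norm; last by clear -h1 h2; lra.
    by rewrite ger0_norm; clear -h1 h2; lra.
  - rewrite [leRHS]ler0_norm; last by clear -h1 h2; lra.
    by rewrite ler0_norm; clear -h1 h2; lra.
have E t : `|oint (fun z => Num.max (u (t, z) - c) 0) a b -
             oint (fun z => Num.max (u (t, z) - c') 0) a b| <= `|c - c'| * (b - a).
  rewrite -ointB; try exact: loc_int_pos.
  rewrite -(ger0_norm (_ : 0 <= b - a)) ?subr_ge0//; apply: oint_norm_le.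
    by apply: loc_intB; exact: loc_int_pos.
  move=> z _; have := maxL 0 (u (t, z) - c) (u (t, z) - c').
  rewrite !(maxC 0); have -> : u (t, z) - c - (u (t, z) - c') = - (c - c') by lra.
  by rewrite normrN.
have B : `|oint (fun t => f (Num.max (u (t, a)) c) - f (Num.max (u (t, b)) c)) t1 t2 -
   oint (fun t => f (Num.max (u (t, a)) c') - f (Num.max (u (t, b)) c')) t1 t2|
   <= 2 * (L * `|c - c'|) * (t2 - t1).
  have H k : loc_int (fun t => f (Num.max (u (t, a)) k) - f (Num.max (u (t, b)) k)).
    by apply: loc_intB; exact: (@loc_int_kruzkov_flux f u _ _ cf cu).
  rewrite -ointB// -(ger0_norm (_ : 0 <= t2 - t1)) ?subr_ge0//; apply: oint_norm_le.
    exact: loc_intB.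
  move=> t; rewrite (min_idPl t12) (max_idPr t12) => tt.
  have K x : a <= x <= b -> `|f (Num.max (u (t, x)) c) - f (Num.max (u (t, x)) c')| <= L * `|c - c'|.
    move=> xab; apply: le_trans (fL _ _ _ _) _; try by apply: maxA => //; exact: uA.
    by apply: ler_wpM2l.
  have Ka : a <= a <= b by rewrite lexx.
  have Kb : a <= b <= b by rewrite lexx ab.
  have := K _ Ka; have := K _ Kb; rewrite !ler_norml => /andP[h1 h2] /andP[h3 h4].
  by apply/andP; split; [clear -h2 h3|clear -h1 h4]; lra.
rewrite /kruzkov; move: (E t1) (E t2) B; rewrite !ler_norml.
move=> /andP[h1 h2] /andP[h3 h4] /andP[h5 h6].
by apply/andP; split; [clear -h2 h3 h6|clear -h1 h4 h5]; lra.
Qed.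

Definition above u g c p : R := if c < u p then g p else 0.
Definition nearby u c e p : R := if `|u p - c| <= e then 1 else 0.

Lemma bdd2_if (P : R * R -> bool) phi K : 0 <= K -> measurable_fun setT P ->
  bdd2 phi K -> bdd2 (fun p => if P p then phi p else 0) K.
Proof.
move=> K0 mP [mphi phiK]; split; first exact: measurable_fun_ifT.
by move=> p; case: ifP; rewrite ?normr0.
Qed.

Lemma bdd2_above u g c M : 0 <= M -> continuous u -> bdd2 g M -> bdd2 (above u g c) M.
Proof.
move=> M0 cu bg; apply: bdd2_if => //; apply: measurable_fun_ltr => //.
exact: continuous2_measurable.
Qed.

Lemma bdd2_nearby u c e : continuous u -> bdd2 (nearby u c e) 1.
Proof.
move=> cu; apply: (@bdd2_if _ (fun=> 1)) => //; last first.
  by have := @bdd2_cst R 1; rewrite normr1.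
apply: measurable_fun_ler => //; apply: measurableT_comp => //.
by apply: measurable_funB => //; exact: continuous2_measurable.
Qed.

(** Both sides are additive under subdivision. On small cells u varies by less than e / 2, so either
    u stays on one side of c and the balance is exact, or the cell lies in {|u - c| <= e}. There the
    entropy estimate and the trivial bound on the source each cost M times the area, hence 2 M. *)
Lemma kruzkov_bisection f u g M c t1 t2 a b e : rect_balance f u (srcG g) M -> bdd2 g M ->
  t1 <= t2 -> a <= b -> 0 < e ->
  `|kruzkov f u c t1 t2 a b - oint2 (above u g c) t1 t2 a b| <=
    2 * M * oint2 (nearby u c e) t1 t2 a b.
Proof.
move=> B bg t12 ab e0; have cu := rb_cont B; have cf := rb_flux B; have M0 := rb_ge0 B.
have ba := bdd2_above c M0 cu bg; have bn := bdd2_nearby c e cu.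
have e20 : 0 < e / 2 by rewrite divr_gt0.
have [d d0 ud] := box_uniform t1 t2 a b cu e20.
have main (n : nat) : forall s1 s2 x y, t1 <= s1 -> s1 <= s2 -> s2 <= t2 ->
    a <= x -> x <= y -> y <= b -> s2 - s1 < d * 2 ^+ n -> y - x < d * 2 ^+ n ->
    `|kruzkov f u c s1 s2 x y - oint2 (above u g c) s1 s2 x y| <=
      2 * M * oint2 (nearby u c e) s1 s2 x y.
  elim: n => [|n ih] s1 s2 x y ts s12 st ax xy yb sd xd.
    rewrite expr0 mulr1 in sd xd.
    have osc s z : s1 <= s <= s2 -> x <= z <= y -> `|u (s, z) - u (s1, x)| < e / 2.
      move=> /andP[h1 h2] /andP[h3 h4]; apply: ud.
      - by rewrite ts (le_trans s12).
      - by rewrite ax (le_trans xy).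
      - by rewrite ger0_norm ?subr_ge0//; clear -h2 sd; lra.
      - by rewrite ger0_norm ?subr_ge0//; clear -h4 xd; lra.
    have [hc|hc] := ltP (c + e / 2) (u (s1, x)).
      have uc s z : s1 <= s <= s2 -> x <= z <= y -> c < u (s, z).
        move=> hs hz; have := osc s z hs hz; rewrite ltr_norml => /andP[h _].
        by clear -h hc; lra.
      rewrite (kruzkov_above B bg)//; last by move=> s z hs hz; apply/ltW/uc.
      rewrite (@eq_oint2 _ (above u g c) g)//; last by move=> s z hs hz; rewrite /above uc.
      rewrite subrr normr0 !mulr_ge0//; apply: oint_ge0 => // s _; apply: oint_ge0 => // z _.
      by rewrite /nearby; case: ifP.
    have [hc'|hc'] := ltP (u (s1, x)) (c - e / 2).
      have uc s z : s1 <= s <= s2 -> x <= z <= y -> u (s, z) <= c.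
        move=> hs hz; have := osc s z hs hz; rewrite ltr_norml => /andP[_ h].
        by clear -h hc'; lra.
      rewrite kruzkov_below//.
      rewrite (@eq_oint2 _ (above u g c) (fun=> 0))//; last first.
        by move=> s z hs hz; rewrite /above ltNge uc.
      rewrite oint2_cst !mul0r subrr normr0 !mulr_ge0//; apply: oint_ge0 => // s _.
      by apply: oint_ge0 => // z _; rewrite /nearby; case: ifP.
    rewrite (@eq_oint2 _ (nearby u c e) (fun=> 1))//; last first.
      move=> s z hs hz; rewrite /nearby ifT//.
      have := osc s z hs hz; rewrite ltr_norml ler_norml => /andP[h1 h2].
      by apply/andP; split; [clear -h1 hc'|clear -h2 hc]; lra.
    rewrite oint2_cst mul1r; apply: le_trans (ler_normB _ _) _.
    have -> : 2 * M * ((y - x) * (s2 - s1)) = M * (y - x) * (s2 - s1) + M * (y - x) * (s2 - s1).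
      by lra.
    apply: lerD; first exact: (entropy_estimate c B).
    exact: oint2_norm_le.
  pose s3 := (s1 + s2) / 2; pose z := (x + y) / 2.
  have h1 : s1 <= s3 by clear -s12; rewrite /s3; lra.
  have h2 : s3 <= s2 by clear -s12; rewrite /s3; lra.
  have h3 : x <= z by clear -xy; rewrite /z; lra.
  have h4 : z <= y by clear -xy; rewrite /z; lra.
  have h5 : s3 - s1 < d * 2 ^+ n by move: sd; rewrite exprS /s3; clear; lra.
  have h6 : s2 - s3 < d * 2 ^+ n by move: sd; rewrite exprS /s3; clear; lra.
  have h7 : z - x < d * 2 ^+ n by move: xd; rewrite exprS /z; clear; lra.
  have h8 : y - z < d * 2 ^+ n by move: xd; rewrite exprS /z; clear; lra.
  have q1 := ih s1 s3 x z ts h1 (le_trans h2 st) ax h3 (le_trans h4 yb) h5 h7.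
  have q2 := ih s1 s3 z y ts h1 (le_trans h2 st) (le_trans ax h3) h4 yb h5 h8.
  have q3 := ih s3 s2 x z (le_trans ts h1) h2 st ax h3 (le_trans h4 yb) h6 h7.
  have q4 := ih s3 s2 z y (le_trans ts h1) h2 st (le_trans ax h3) h4 yb h6 h8.
  rewrite -(kruzkov_cat_t c s1 s3 s2 x y cf cu) -!(kruzkov_cat_x c _ _ x z y cf cu).
  rewrite -(oint2_cat_t s1 s3 s2 x y ba) -!(oint2_cat_x _ _ x z y ba).
  rewrite -(oint2_cat_t s1 s3 s2 x y bn) -!(oint2_cat_x _ _ x z y bn).
  have tri (k1 k2 o1 o2 r1 r2 : R) : `|k1 - o1| <= r1 -> `|k2 - o2| <= r2 ->
      `|k1 + k2 - (o1 + o2)| <= r1 + r2.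
    by move=> h h'; rewrite opprD addrACA; apply: le_trans (ler_normD _ _) _; exact: lerD.
  by rewrite !mulrDr; apply: (tri); [exact: (tri _ _ _ _ _ _ q1 q2)|exact: (tri _ _ _ _ _ _ q3 q4)].
pose n := Num.truncn (Num.max (t2 - t1) (b - a) / d).
have nlt : Num.max (t2 - t1) (b - a) < d * 2 ^+ n.+1.
  rewrite mulrC -ltr_pdivrMr//; apply: lt_le_trans (truncnS_gt _) _.
  by rewrite -natrX ler_nat ltnW// ltn_expl.
by move: nlt; rewrite gt_max => /andP[h1 h2]; apply: (main n.+1).
Qed.

End kruzkov.

(** * Exact entropy balances and bands of levels *)

Section renormalization.
Context {R : realType}.
Implicit Types (f : R -> R) (u g : R * R -> R) (N : set R).
Implicit Types (t s x y a b c e d M L A z lo hi : R).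
Notation mu := (@lebesgue_measure R).

Lemma cvg_eventually (h : nat -> R) (l : R) n0 :
  (forall n, (n0 <= n)%N -> h n = l) -> h n @[n --> \oo] --> l.
Proof.
move=> H; apply: cvg_near_cst; near=> n; apply: H; near: n; exact: nbhs_infty_ge.
Unshelve. all: by end_near. Qed.

Lemma cvg_harmonicr : (n.+1%:R^-1 : R) @[n --> \oo] --> (0 : R).
Proof. exact: cvg_harmonic. Qed.

Definition level u c p : R := if u p == c then 1 else 0.

Lemma bdd2_level u c : continuous u -> bdd2 (level u c) 1.
Proof.
move=> cu; have -> : level u c = fun p => if `|u p - c| <= 0 then 1 else 0.
  apply/funext => p; rewrite /level normr_le0 subr_eq0//.
exact: bdd2_nearby.
Qed.

Lemma kruzkov_level f u g M c t1 t2 a b : rect_balance f u (srcG g) M -> bdd2 g M ->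
  t1 <= t2 -> a <= b ->
  `|kruzkov f u c t1 t2 a b - oint2 (above u g c) t1 t2 a b| <=
    2 * M * oint2 (level u c) t1 t2 a b.
Proof.
move=> B bg t12 ab; have cu := rb_cont B.
have cv : oint2 (nearby u c n.+1%:R^-1) t1 t2 a b @[n --> \oo] --> oint2 (level u c) t1 t2 a b.
  apply: (oint2_dominated (K := 1)); first by move=> n; exact: bdd2_nearby.
    exact: bdd2_level.
  move=> p; rewrite /nearby /level; have [->|up] := eqVneq (u p) c.
    apply: (@cvg_eventually _ _ 0) => n _; rewrite subrr normr0 ifT// invr_ge0//.
  have u0 : 0 < `|u p - c| by rewrite normr_gt0 subr_eq0.
  apply: (@cvg_eventually _ _ (Num.truncn `|u p - c|^-1)) => n hn.
  rewrite ifF//; apply/negbTE; rewrite -ltNge -[ltRHS]invrK ltf_pV2 ?posrE ?invr_gt0//.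
  by apply: lt_le_trans (truncnS_gt _) _; rewrite ler_nat.
have {}cv : 2 * M * oint2 (nearby u c n.+1%:R^-1) t1 t2 a b @[n --> \oo] -->
   2 * M * oint2 (level u c) t1 t2 a b by apply: cvgM => //; exact: cvg_cst.
apply: (ler_cvg_to (cvg_cst _) cv); apply: nearW => n.
by apply: kruzkov_bisection => //; rewrite invr_gt0.
Qed.

Definition loc_lip f := forall A, exists2 L, 0 <= L &
  forall x y, `|x| <= A -> `|y| <= A -> `|f y - f x| <= L * `|y - x|.

(* Both sides are right-continuous in [c], and for all but countably many [c]
   the level set [u = c] is negligible. *)
Lemma kruzkov_eq f u g M c t1 t2 a b : rect_balance f u (srcG g) M -> bdd2 g M ->
  loc_lip f -> t1 <= t2 -> a <= b ->
  kruzkov f u c t1 t2 a b = oint2 (above u g c) t1 t2 a b.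
Proof.
move=> B bg lf t12 ab; have cu := rb_cont B; have cf := rb_flux B; have M0 := rb_ge0 B.
have [A0 A00 uA0] := box_bounded t1 t2 a b cu.
pose A := Num.max A0 (`|c| + 1).
have uA t x : t1 <= t <= t2 -> a <= x <= b -> `|u (t, x)| <= A.
  by move=> ht hx; rewrite le_max uA0.
have [L L0 fL] := lf A.
pose c_ n := c + n.+1%:R^-1.
have cA : `|c| <= A by rewrite le_max lerDl ler01 orbT.
have c_A n : `|c_ n| <= A.
  rewrite le_max; apply/orP; right; apply: le_trans (ler_normD _ _) _; rewrite lerD2l.
  by rewrite ger0_norm ?invr_ge0// invf_le1// ler1n.
have cvc : c_ n @[n --> \oo] --> c.
  by rewrite -[X in _ --> X]addr0; apply: cvgD; [exact: cvg_cst|exact: cvg_harmonicr].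
have cv1 : kruzkov f u (c_ n) t1 t2 a b @[n --> \oo] --> kruzkov f u c t1 t2 a b.
  apply/cvgrPdist_le => e e0.
  pose k := 2 * (b - a) + 2 * L * (t2 - t1) + 1.
  have k0 : 0 < k.
    by rewrite ltr_wpDl// addr_ge0// !mulr_ge0// subr_ge0.
  have /cvgrPdist_le/(_ (e / k) (divr_gt0 e0 k0)) := cvc.
  apply: filterS => n h; apply: le_trans (kruzkov_lipschitz cf cu t12 ab cA (c_A n) L0 fL uA) _.
  apply: (@le_trans _ _ (k * `|c - c_ n|)).
    by rewrite ler_wpM2r// /k lerDl.
  by rewrite mulrC -ler_pdivlMr.
have ba c' : bdd2 (above u g c') M by exact: bdd2_above.
have cv2 : oint2 (above u g (c_ n)) t1 t2 a b @[n --> \oo] --> oint2 (above u g c) t1 t2 a b.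
  apply: (oint2_dominated (K := M)) => //.
  move=> p; rewrite /above; have [cp|pc] := ltP c (u p).
    have H : \forall n \near \oo, c_ n < u p by move: cvc => /cvgr_lt; apply.
    apply: cvg_near_cst; near=> n; rewrite ifT//; near: n; exact: H.
  apply: (@cvg_eventually _ _ 0) => n _; rewrite ifF//; apply/negbTE.
  by rewrite -leNgt (le_trans pc)// lerDl invr_ge0.
(* The levels c_n are distinct, so each point lies on at most one of the sets {u = c_n} and their
   indicators tend to 0 pointwise. No individual c_n has to be chosen with a negligible level
   set. *)
have cv3 : 2 * M * oint2 (level u (c_ n)) t1 t2 a b @[n --> \oo] --> (0 : R).
  rewrite -(mulr0 (2 * M)); apply: cvgM; first exact: cvg_cst.
  rewrite (_ : 0 = oint2 (fun=> 0) t1 t2 a b); last by rewrite oint2_cst !mul0r.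
  apply: (oint2_dominated (K := 1)).
  - by move=> n; exact: bdd2_level.
  - by have := @bdd2_cst R 0; rewrite normr0 => -[? H]; split => // p; rewrite normr0.
  move=> p; rewrite /level; have [cp|pc] := ltP c (u p); last first.
    apply: (@cvg_eventually _ _ 0) => n _; rewrite ifF//; apply/negbTE.
    by rewrite lt_eqF// (le_lt_trans pc)// ltrDl invr_gt0.
  have H : \forall n \near \oo, c_ n < u p by move: cvc => /cvgr_lt; apply.
  apply: cvg_near_cst; near=> n; rewrite ifF//.
  by apply/negbTE; rewrite gt_eqF//; near: n; exact: H.
have cvl : `|kruzkov f u (c_ n) t1 t2 a b - oint2 (above u g (c_ n)) t1 t2 a b|
    @[n --> \oo] --> `|kruzkov f u c t1 t2 a b - oint2 (above u g c) t1 t2 a b|.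
  by apply: cvg_norm; exact: (cvgB cv1 cv2).
apply/eqP; rewrite -subr_eq0 -normr_le0; apply: (ler_cvg_to cvl cv3).
by apply: nearW => n; exact: (kruzkov_level _ B bg).
Unshelve. all: by end_near. Qed.

(** The source integrated over a band of levels is of the order of the width of the band, even where
    the band occupies a large area: by the exact entropy balance it is a difference of boundary
    terms. *)
Lemma above_lipschitz f u g M A L t1 t2 a b c c' : rect_balance f u (srcG g) M -> bdd2 g M ->
  loc_lip f -> t1 <= t2 -> a <= b -> 0 <= L -> `|c| <= A -> `|c'| <= A ->
  (forall x y, `|x| <= A -> `|y| <= A -> `|f y - f x| <= L * `|y - x|) ->
  (forall t x, t1 <= t <= t2 -> a <= x <= b -> `|u (t, x)| <= A) ->
  `|oint2 (above u g c) t1 t2 a b - oint2 (above u g c') t1 t2 a b| <=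
    (2 * (b - a) + 2 * L * (t2 - t1)) * `|c - c'|.
Proof.
move=> B bg lf t12 ab L0 cA c'A fL uA; rewrite -!(kruzkov_eq _ B bg lf t12 ab).
exact: (kruzkov_lipschitz (rb_flux B) (rb_cont B) t12 ab cA c'A L0 fL uA).
Qed.

(** The indicator of the union of the cells ]c_j, c_{j+1}] selected by k. The cells are open on the
    left to match the strict inequality in [above], of which each is a difference. *)
Fixpoint cellsum (k : nat -> bool) (c : nat -> R) n z : R :=
  if n is m.+1 then
    cellsum k c m z + (if k m && (c m < z <= c m.+1) then 1 else 0)
  else 0.

Lemma cellsum_gt (k : nat -> bool) (c : nat -> R) n z : {homo c : i j / (i <= j)%N >-> i <= j} -> c n < z ->
  cellsum k c n z = 0.
Proof.
move=> hc; elim: n => //= n ih cz; rewrite ih; last exact: le_lt_trans (hc _ _ (leqnSn n)) cz.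
by rewrite [z <= _]leNgt cz !andbF addr0.
Qed.

Lemma cellsum_in (k : nat -> bool) (c : nat -> R) n j z : {homo c : i j / (i <= j)%N >-> i <= j} -> (j < n)%N ->
  c j < z <= c j.+1 -> cellsum k c n z = (k j)%:R.
Proof.
move=> hc; elim: n => //= n ih; rewrite ltnS leq_eqVlt => /predU1P[<- cz|jn cz].
  rewrite cellsum_gt//; last by case/andP: cz.
  by rewrite cz andbT add0r; case: (k j).
rewrite ih//; have /andP[_ zj] := cz.
by rewrite ltNge (le_trans zj (hc _ _ jn)) andbF addr0.
Qed.

Lemma cellsum_bounds (k : nat -> bool) (c : nat -> R) n z : {homo c : i j / (i <= j)%N >-> i <= j} ->
  0 <= cellsum k c n z <= 1.
Proof.
move=> hc; elim: n => [|n ih] /=; first by rewrite lexx ler01.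
have [/andP[kn /andP[cz zc]]|_] := ifPn; last by rewrite addr0.
by rewrite cellsum_gt// add0r ler01 lexx.
Qed.

Lemma cellsum_measurable (k : nat -> bool) (c : nat -> R) n : measurable_fun setT (cellsum k c n).
Proof.
elim: n => [|n ih] /=; first exact: measurable_cst.
apply: measurable_funD => //; apply: measurable_fun_ifT => //.
apply: measurable_and => //; apply: measurable_and.
  exact: measurable_fun_ltr.
exact: measurable_fun_ler.
Qed.

Lemma oint_indic_itv lo hi c c' : lo <= c -> c <= c' -> c' <= hi ->
  oint (fun z => if c < z <= c' then 1 else 0) lo hi = c' - c.
Proof.
move=> lc cc' chi.
have li : loc_int (fun z => if c < z <= c' then 1 else 0 : R).
  apply: (bounded_loc_int (M := 1)).
    apply: measurable_fun_ifT => //; apply: measurable_and; first exact: measurable_fun_ltr.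
    exact: measurable_fun_ler.
  by move=> z; case: ifP; rewrite ?normr1// normr0.
rewrite -(oint_cat lo c hi li) -(oint_cat c c' hi li).
have -> : oint (fun z => if c < z <= c' then 1 else 0) lo c = 0.
  rewrite (eq_oint (g := fun=> 0)) ?oint_cst ?mul0r// => z.
  by rewrite (max_idPr lc) ltNge => /andP[_ ->].
have -> : oint (fun z => if c < z <= c' then 1 else 0) c c' = c' - c.
  rewrite ointE// -Rintegral_itv_obnd_cbnd; last first.
    by apply: integrableS (li c c') => //; apply: subset_itvr; rewrite bnd_simp.
  rewrite (@eq_Rintegral _ _ _ mu _ (fun=> 1)); last first.
    by move=> z; rewrite inE/= in_itv/= => ->.
  rewrite Rintegral_itv_obnd_cbnd; last first.
    by apply: integrableS (@loc_int_cst R 1 c c') => //; apply: subset_itvr; rewrite bnd_simp.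
  by rewrite -ointE// oint_cst mul1r.
have -> : oint (fun z => if c < z <= c' then 1 else 0) c' hi = 0.
  rewrite ointE// -Rintegral_itv_obnd_cbnd; last first.
    by apply: integrableS (li c' hi) => //; apply: subset_itvr; rewrite bnd_simp.
  rewrite (@eq_Rintegral _ _ _ mu _ (fun=> 0)); last first.
    by move=> z; rewrite inE/= in_itv/= => /andP[cz _]; rewrite [z <= _]leNgt cz andbF.
  rewrite Rintegral_itv_obnd_cbnd; last first.
    by apply: integrableS (@loc_int_cst R 0 c' hi) => //; apply: subset_itvr; rewrite bnd_simp.
  by rewrite -ointE// oint_cst mul0r.
by rewrite add0r addr0.
Qed.

(** The band estimate is summed over the selected cells, whose widths add up to the integral of
    [cellsum]. *)
Lemma cellsum_estimate f u g M A L t1 t2 a b (k : nat -> bool) (c : nat -> R) n : rect_balance f u (srcG g) M ->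
  bdd2 g M -> loc_lip f -> t1 <= t2 -> a <= b -> 0 <= L ->
  (forall x y, `|x| <= A -> `|y| <= A -> `|f y - f x| <= L * `|y - x|) ->
  (forall t x, t1 <= t <= t2 -> a <= x <= b -> `|u (t, x)| <= A) ->
  {homo c : i j / (i <= j)%N >-> i <= j} -> (forall i, (i <= n)%N -> `|c i| <= A) ->
  `|oint2 (fun p => cellsum k c n (u p) * g p) t1 t2 a b| <=
    (2 * (b - a) + 2 * L * (t2 - t1)) * oint (cellsum k c n) (- A) A.
Proof.
move=> B bg lf t12 ab L0 fL uA hc.
have cu := rb_cont B; have M0 := rb_ge0 B.
have lcs m : loc_int (cellsum k c m).
  apply: (bounded_loc_int (M := 1)); first exact: cellsum_measurable.
  by move=> z; have /andP[h1 h2] := cellsum_bounds k m z hc; rewrite ger0_norm.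
have bcs m : bdd2 (fun p => cellsum k c m (u p) * g p) M.
  split.
    apply: measurable_funM; last exact: bg.1.
    by apply: measurableT_comp; [exact: cellsum_measurable|exact: continuous2_measurable].
  move=> p; have /andP[h1 h2] := cellsum_bounds k m (u p) hc.
  by rewrite normrM ger0_norm// -[leRHS]mul1r ler_pM//; exact: bg.2.
elim: n => [|n ih] cA /=.
  rewrite oint_cst mul0r mulr0 (_ : (fun p => _) = fun=> 0); last by apply/funext => p; rewrite mul0r.
  by rewrite oint2_cst !mul0r normr0.
have {}ih := ih (fun i ni => cA i (leqW ni)).
have [kn|kn] := boolP (k n); last first.
  rewrite (_ : (fun p => _) = fun p => cellsum k c n (u p) * g p); last first.
    by apply/funext => p /=; rewrite addr0.
  by rewrite (_ : (fun z => cellsum k c n z + 0) = cellsum k c n)//; apply/funext => z; rewrite addr0.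
move=> /=; have cn : c n <= c n.+1 by exact: hc.
have An : `|c n| <= A by exact: cA.
have An1 : `|c n.+1| <= A by exact: cA.
rewrite ointD//; last first.
  apply: (bounded_loc_int (M := 1)).
    apply: measurable_fun_ifT => //; apply: measurable_and; first exact: measurable_fun_ltr.
    exact: measurable_fun_ler.
  by move=> z; case: ifP; rewrite ?normr1// normr0.
rewrite oint_indic_itv//; last first.
- by move: An1; rewrite ler_norml => /andP[].
- by move: An; rewrite ler_norml => /andP[].
have ba := bdd2_above (c n) M0 cu bg; have ba1 := bdd2_above (c n.+1) M0 cu bg.
rewrite (_ : (fun p => _) = fun p => cellsum k c n (u p) * g p -
    (above u g (c n.+1) p - above u g (c n) p)); last first.
  apply/funext => p /=; rewrite mulrDl; congr (_ + _); rewrite /above.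
  have [h1|h1] := ltP (c n) (u p); have [h2|h2] := ltP (c n.+1) (u p) => /=.
  - by rewrite mul0r subrr oppr0.
  - by rewrite mul1r sub0r opprK.
  - by move: (lt_le_trans h2 h1); rewrite ltNge cn.
  - by rewrite mul0r subrr oppr0.
have bd : bdd2 (fun p => above u g (c n.+1) p - above u g (c n) p) (M + M).
  split; first by apply: measurable_funB; [exact: ba1.1|exact: ba.1].
  by move=> p; apply: le_trans (ler_normB _ _) _; apply: lerD; [exact: ba1.2|exact: ba.2].
rewrite (oint2B _ _ _ _ (bcs n) bd) (oint2B _ _ _ _ ba1 ba) mulrDr.
apply: le_trans (ler_normB _ _) _; apply: lerD => //.
apply: le_trans (above_lipschitz B bg lf t12 ab L0 An1 An fL uA) _.
by rewrite ger0_norm ?subr_ge0.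
Qed.

End renormalization.

(** * Vanishing of the source over a null set of levels *)

Section null_levels.
Context {R : realType}.
Implicit Types (f : R -> R) (u g : R * R -> R) (N : set R).
Implicit Types (t s x y a b e d M L A z lo hi : R).
Notation mu := (@lebesgue_measure R).

Lemma cellsum_cover (c : nat -> R) n z : c 0%N < z <= c n ->
  exists2 j, (j < n)%N & c j < z <= c j.+1.
Proof.
elim: n => [/andP[h1 h2]|n ih /andP[h1 h2]]; first by move: h1; rewrite ltNge h2.
have [zn|nz] := leP z (c n).
  by have [j jn cj] := ih ltac:(by rewrite h1); exists j => //; apply: leqW.
by exists n; rewrite // nz.
Qed.

Lemma oint_null N lo hi : measurable N -> mu N = 0%E -> lo <= hi ->
  oint (\1_N) lo hi = 0.
Proof.
move=> mN N0 lohi; rewrite ointE// /Rintegral.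
rewrite (@ae_eq_integral _ _ _ mu `[lo, hi] (cst 0%E)) ?integral0//.
- by apply/measurable_EFinP; apply: measurable_funTS; exact: measurable_indic.
- exists N; split => // z /= H; apply: contrapT => Nz; apply: H => _.
  by rewrite indicE memNset.
Qed.

Lemma bdd2_cutoff u g N M : 0 <= M -> measurable N -> continuous u -> bdd2 g M ->
  bdd2 (fun p => \1_N (u p) * g p) M.
Proof.
move=> M0 mN cu bg; split.
  apply: measurable_funM; last exact: bg.1.
  apply: measurableT_comp; last exact: continuous2_measurable.
  exact: measurable_indic.
move=> p; rewrite indicE; case: (_ \in _); last by rewrite mul0r normr0.
by rewrite mul1r; exact: bg.2.
Qed.

(** Keep the cells of a regular grid that meet N. As the mesh tends to 0 their union decreases to N
    in the sense of pointwise convergence of indicators, so its length tends to 0, and with it the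
    integral of the source over the corresponding bands. *)
Lemma source_null_levels f u g M N t1 t2 a b : rect_balance f u (srcG g) M ->
  bdd2 g M -> loc_lip f -> closed N -> mu N = 0%E -> t1 <= t2 -> a <= b ->
  oint2 (fun p => \1_N (u p) * g p) t1 t2 a b = 0.
Proof.
move=> B bg lf cN N0 t12 ab; have cu := rb_cont B; have M0 := rb_ge0 B.
have mN := closed_measurable cN.
have [A0 A00 uA0] := box_bounded t1 t2 a b cu.
(* The margin 1 puts every value of u on the rectangle inside ]- A, A], which excludes its left
   end. *)
pose A := A0 + 1; have A_gt0 : 0 < A by rewrite /A; lra.
have uA t x : t1 <= t <= t2 -> a <= x <= b -> `|u (t, x)| <= A.
  by move=> ht hx; apply: le_trans (uA0 _ _ ht hx) _; rewrite lerDl.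
have [L L0 fL] := lf A.
pose h n : R := 2 * A / n.+1%:R.
have h0 n : 0 < h n by rewrite divr_gt0// mulr_gt0.
pose c n j := - A + j%:R * h n.
have hc n : {homo c n : i j / (i <= j)%N >-> i <= j}.
  by move=> i j ij; rewrite lerD2l ler_wpM2r ?ler_nat// ltW.
have c0 n : c n 0%N = - A by rewrite /c mul0r addr0.
have cn n : c n n.+1 = A by rewrite /c /h mulrCA mulfV// mulr1; lra.
have cA n i : (i <= n.+1)%N -> `|c n i| <= A.
  by move=> ni; rewrite ler_norml -(c0 n) hc//= -[leRHS](cn n) hc.
pose k n j := `[< exists2 w, N w & c n j < w <= c n j.+1 >].
pose D n := cellsum (k n) (c n) n.+1.
pose chi := \1_(N `&` [set` `]- A, A]]) : R -> R.
have mI : measurable (N `&` [set` `]- A, A]]) by apply: measurableI.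
have Dchi z : D n z @[n --> \oo] --> chi z.
  have [zA|zA] := boolP (- A < z <= A); last first.
    have -> : chi z = 0.
      by rewrite /chi indicE memNset// => -[_ /=]; rewrite in_itv/= (negbTE zA).
    apply: (@cvg_eventually _ _ _ 0) => n _; rewrite /D.
    elim: {1 3}n.+1 (leqnn n.+1) => //= m ih mn; rewrite ih ?(ltnW mn)// add0r ifF//.
    apply/negbTE/nandP; right; apply: contra zA => /andP[h1 h2].
    rewrite (le_lt_trans _ h1)/=; last by rewrite -(c0 n) hc.
    by rewrite (le_trans h2)// -(cn n) hc.
  have Dk n : exists2 j, D n z = (k n j)%:R & c n j < z <= c n j.+1.
    have [|j jn cj] := @cellsum_cover (c n) n.+1 z; first by rewrite c0 cn.
    by exists j => //; apply: cellsum_in.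
  have [Nz|nNz] := pselect (N z).
    have -> : chi z = 1 by rewrite /chi indicE mem_set//; split => //=; rewrite in_itv.
    apply: (@cvg_eventually _ _ _ 0) => n _; have [j -> cj] := Dk n.
    by rewrite /k asboolT//; exists z.
  have -> : chi z = 0 by rewrite /chi indicE memNset// => -[].
  have : nbhs z (~` N) by apply: open_nbhs_nbhs; split => //; exact: closed_openC.
  move=> /nbhs_ballP[r /= r0 rN].
  (* As N is closed, z has distance at least r from it; once the mesh 2 A / (n + 1) is below r, the
     cell of z misses N. *)
  apply: (@cvg_eventually _ _ _ (Num.truncn (2 * A / r))) => n hn.
  have [j -> cj] := Dk n; rewrite /k asboolF// => -[w Nw cw].
  have : ~ N w; last by [].
  apply: rN; rewrite /ball/=; apply: (@lt_trans _ _ (h n)).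
    have hE : c n j.+1 = c n j + h n by rewrite /c -natr1 mulrDl mul1r addrA.
    move: cj cw; rewrite hE => /andP[? ?] /andP[? ?].
    by rewrite ltr_norml; apply/andP; split; lra.
  rewrite /h ltr_pdivrMr// [ltRHS]mulrC -ltr_pdivrMr//; apply: lt_le_trans (truncnS_gt _) _.
  by rewrite ler_nat.
have D1 n z : 0 <= D n z <= 1 by apply: cellsum_bounds.
have bD n : bdd2 (fun p => D n (u p) * g p) M.
  split.
    apply: measurable_funM; last exact: bg.1.
    by apply: measurableT_comp; [exact: cellsum_measurable|exact: continuous2_measurable].
  move=> p; have /andP[h1 h2] := D1 n (u p).
  by rewrite normrM ger0_norm// -[leRHS]mul1r ler_pM//; exact: bg.2.
have bchi : bdd2 (fun p => chi (u p) * g p) M by exact: bdd2_cutoff.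
have cv1 : oint2 (fun p => D n (u p) * g p) t1 t2 a b @[n --> \oo] -->
    oint2 (fun p => chi (u p) * g p) t1 t2 a b.
  apply: (oint2_dominated (K := M)) => // p.
  by apply: cvgM; [exact: Dchi|exact: cvg_cst].
have cv2 : oint (D n) (- A) A @[n --> \oo] --> (0 : R).
  have <- : oint chi (- A) A = 0.
    apply: oint_null => //; last by clear -A_gt0; lra.
    apply/eqP; rewrite eq_le measure_ge0 andbT -N0; apply: le_measure; rewrite ?inE//.
  apply: (oint_dominated (M := 1)) => //.
  - by move=> n; exact: cellsum_measurable.
  - by move=> n z _; have /andP[h1 h2] := D1 n z; rewrite ger0_norm.
  - exact: measurable_indic.
pose C := 2 * (b - a) + 2 * L * (t2 - t1).
have cv3 : C * oint (D n) (- A) A @[n --> \oo] --> (0 : R).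
  by rewrite -(mulr0 C); apply: cvgM => //; exact: cvg_cst.
have cv1' : `|oint2 (fun p => D n (u p) * g p) t1 t2 a b| @[n --> \oo] -->
    `|oint2 (fun p => chi (u p) * g p) t1 t2 a b| by exact: cvg_norm.
have : `|oint2 (fun p => chi (u p) * g p) t1 t2 a b| <= 0.
  apply: (ler_cvg_to cv1' cv3); apply: nearW => n.
  exact: (cellsum_estimate (k n) B bg lf t12 ab L0 fL uA (hc n) (cA n)).
rewrite normr_le0 => /eqP <-; apply: eq_oint2 => // t x ht hx; congr (_ * _).
have uI : u (t, x) \in [set` `]- A, A]].
  rewrite inE/= in_itv/=; have := uA0 _ _ ht hx; rewrite ler_norml => /andP[h1 h2].
  by apply/andP; split; [clear -h1|clear -h2]; rewrite /A; lra.
by rewrite /chi !indicE in_setI uI andbT.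
Qed.

(** Rational end points suffice by continuity of the integral. In the plane they allow the
    exceptional times to be collected over countably many intervals. *)
Lemma ae_of_oint_zero (h : R -> R) M : measurable_fun setT h -> (forall x, `|h x| <= M) ->
  (forall a b : rat, oint h (ratr a) (ratr b) = 0) -> {ae mu, forall x, h x = 0}.
Proof.
move=> mh hM h0.
have h0' a b : oint h a b = 0.
  have lh := bounded_loc_int mh hM.
  apply/eqP; rewrite -normr_le0; apply/ler_addgt0Pr => e e0; rewrite add0r.
  have M0 : 0 <= M by apply: le_trans (hM 0).
  pose r := e / (2 * (M + 1)).
  have r0 : 0 < r by rewrite divr_gt0// mulr_gt0// ltr_wpDl.
  have near_rat z : exists q : rat, `|ratr q - z| <= r.
    have zr : z < z + r by rewrite ltrDl.
    have [q] := rat_in_itvoo zr; rewrite in_itv/= => /andP[q1 q2].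
    by exists q; rewrite ger0_norm; [rewrite lerBlDl ltW|rewrite subr_ge0 ltW].
  have [qa ha] := near_rat a; have [qb hb] := near_rat b.
  rewrite -(oint_cat a (ratr qa) b lh) -(oint_cat (ratr qa) (ratr qb) b lh) h0 add0r.
  apply: le_trans (ler_normD _ _) _.
  have -> : e = (M + 1) * r + (M + 1) * r.
    rewrite -mulrDl -mulr2n -mulr_natl /r mulrC divfK// mulf_neq0// gt_eqF// ltr_wpDl//.
  apply: lerD.
    apply: le_trans (oint_norm_le lh (M := M) _) _; first by move=> x _.
    by apply: ler_pM => //; rewrite lerDl.
  apply: le_trans (oint_norm_le lh (M := M) _) _; first by move=> x _.
  by rewrite distrC; apply: ler_pM => //; rewrite lerDl.
have := ae_oint_deriv mh hM.
apply: filterS; first exact: (ae_filter_ringOfSetsType mu).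
move=> x hx; apply/eqP; rewrite -normr_le0; apply/ler_addgt0Pr => e e0; rewrite add0r.
have [d d0 H] := hx e e0.
have d20 : 0 < d / 2 by rewrite divr_gt0.
have dE : x + d / 2 - x = d / 2 by rewrite (addrC x) addrK.
have := H (x + d / 2); rewrite dE h0' sub0r normrN (gtr0_norm d20) normrM (gtr0_norm d20).
move=> /(_ _); rewrite ler_pM2r//; apply.
by rewrite ltr_pdivrMr// ltr_pMr// ltr1n.
Qed.

Lemma ae_oint2_zero phi M : bdd2 phi M ->
  (forall t1 t2 a b, t1 <= t2 -> a <= b -> oint2 phi t1 t2 a b = 0) ->
  (mu \x mu)%E [set p | phi p != 0] = 0%E.
Proof.
move=> bphi phi0.
have ph t1 t2 a b : oint2 phi t1 t2 a b = 0.
  have [t12|/ltW t21] := leP t1 t2; have [ab|/ltW ba] := leP a b.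
  - exact: phi0.
  - rewrite /oint2 (eq_oint (g := fun t => - oint (fun x => phi (t, x)) b a)).
      by rewrite ointN ?oppr0 -?/(oint2 _ _ _ _ _) ?phi0 ?oppr0//; exact: (bdd2_inner _ _ bphi).
    by move=> t _; rewrite oint_swap.
  - by rewrite /oint2 oint_swap -/(oint2 _ _ _ _ _) phi0 ?oppr0.
  - rewrite /oint2 oint_swap (eq_oint (g := fun t => - oint (fun x => phi (t, x)) b a)).
      by rewrite ointN ?oppr0 -?/(oint2 _ _ _ _ _) ?phi0 ?oppr0//; exact: (bdd2_inner _ _ bphi).
    by move=> t _; rewrite oint_swap.
have mS : measurable [set p | phi p != 0].
  have := bphi.1 measurableT [set~ 0]; rewrite setTI; move=> /(_ (measurableC (measurable_set1 _))).
  by congr measurable; apply/seteqP; split => p /= /eqP.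
have aet : {ae mu, forall t, forall q : rat * rat, oint (fun x => phi (t, x)) (ratr q.1) (ratr q.2) = 0}.
  have ae1 (q : rat * rat) : {ae mu, forall t, oint (fun x => phi (t, x)) (ratr q.1) (ratr q.2) = 0}.
    apply: (ae_of_oint_zero (M := M * `|ratr q.2 - ratr q.1|)).
    - exact: (bdd2_inner_measurable _ _ bphi).
    - by move=> t; exact: bdd2_inner_le.
    - by move=> t1 t2; exact: ph.
  (* The pairs of rationals are enumerated by their codes; integers that code nothing are sent to
     the pair (0, 0). *)
  have : {ae mu, forall t, forall n, oint (fun x => phi (t, x))
      (ratr (odflt (0, 0) (unpickle n : option (rat * rat))).1)
      (ratr (odflt (0, 0) (unpickle n : option (rat * rat))).2) = 0}.
    by apply: ae_foralln => n; exact: ae1.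
  apply: filterS; first exact: (ae_filter_ringOfSetsType mu).
  by move=> t H q; have := H (pickle q); rewrite pickleK.
rewrite /product_measure1/=.
apply/eqP; rewrite eq_le; apply/andP; split; last first.
  by apply: integral_ge0 => t _; exact: measure_ge0.
rewrite (@ae_eq_integral _ _ _ mu setT (cst 0%E)) ?integral0//.
- exact: measurable_fun_xsection.
- move: aet; apply: filterS; first exact: (ae_filter_ringOfSetsType mu).
  move=> t H _ /=.
  have [A [mA A0 HA]] : {ae mu, forall x, phi (t, x) = 0}.
    apply: (ae_of_oint_zero (M := M)).
    - by apply: measurable_fun_pair2; exact: bphi.1.
    - by move=> x; exact: bphi.2.
    - by move=> q r; exact: (H (q, r)).
  apply/eqP; rewrite eq_le measure_ge0 andbT -A0; apply: le_measure; rewrite ?inE//.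
    exact: measurable_xsection.
  by move=> x; rewrite /xsection/= inE/= => /eqP px; apply: HA.
Qed.

End null_levels.

(** * Characteristics off the inflection set *)

Section curve_balance.
Context {R : realType}.
Implicit Types (f ga c lam v : R -> R) (u g : R * R -> R) (Z : set (R * R)).
Implicit Types (t s r x y a b d e h M K : R).

Lemma continuous_eps (h : R -> R) x e : continuous h -> 0 < e ->
  exists2 d, 0 < d & forall y, `|y - x| < d -> `|h y - h x| < e.
Proof.
move=> ch e0; have : \forall y \near x, `|h x - h y| < e by move: (ch x) => /cvgr_dist_lt; apply.
move=> /nbhs_ballP[d /= d0 H]; exists d => // y yx; rewrite distrC; apply: H.
by rewrite /ball/= distrC.
Qed.

Lemma ler_dist_between t s r : Num.min t s <= r <= Num.max t s -> `|r - t| <= `|s - t|.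
Proof.
rewrite ge_min le_max => /andP[/orP[?|?] /orP[?|?]];
  by case: (ger0P (r - t)) => ?; case: (ger0P (s - t)) => ?; lra.
Qed.

Definition derives_on s1 s2 c lam := forall t, s1 <= t <= s2 -> forall e, 0 < e ->
  exists2 d, 0 < d & forall s, s1 <= s <= s2 -> `|s - t| < d ->
    `|c s - c t - lam t * (s - t)| <= e * `|s - t|.

Lemma curve_continuous u c : continuous u -> continuous c -> continuous (fun t => u (t, c t)).
Proof.
move=> cu cc t; apply: (@continuous_comp _ _ _ (fun t => (t, c t)) u); last exact: cu.
exact: (cvg_pair cvg_id (cc t)).
Qed.

Lemma srcG_curve_measurable g M c : bdd2 g M -> continuous c ->
  measurable_fun setT (fun t => srcG g t (c t)).
Proof.
move=> [mg bg] cc; apply: (measurable_oint mg bg); first exact: measurable_cst.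
exact: continuous_measurable_fun.
Qed.

Lemma srcG_norm g M t x : bdd2 g M -> `|srcG g t x| <= M * `|x|.
Proof. by move=> bg; have := bdd2_inner_le t 0 x bg; rewrite subr0. Qed.

Lemma loc_int_srcG_curve g M c : 0 <= M -> bdd2 g M -> continuous c ->
  loc_int (fun t => srcG g t (c t)).
Proof.
move=> M0 bg cc a b.
have [K K0 HK] := @box_bounded _ (fun p => c p.1) a b 0 0
  (fun p => continuous_comp (@cvg_fst _ _ _ _ _) (cc p.1)).
apply: (bounded_integrable_itv (M := M * K)); first exact: srcG_curve_measurable bg cc.
move=> t tt; apply: le_trans (srcG_norm _ _ bg) _; rewrite ler_wpM2l//.
by apply: (HK t 0) => //; rewrite lexx.
Qed.

(** The rectangle balance between x = 0 and a moving boundary. The source term is merely measurable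
    in time, so its integral is subtracted first; what remains is differentiable at every time and
    the fundamental theorem applies. *)
Lemma curve_balance f u g M c lam s1 s2 : rect_balance f u (srcG g) M -> bdd2 g M ->
  continuous c -> continuous lam -> s1 <= s2 -> derives_on s1 s2 c lam ->
  oint (fun x => u (s2, x)) 0 (c s2) - oint (fun x => u (s1, x)) 0 (c s1) =
  oint (fun r => lam r * u (r, c r) - f (u (r, c r)) + f (u (r, 0)) + srcG g r (c r)) s1 s2.
Proof.
move=> B bg cc cl s12 dc; have cu := rb_cont B; have cq := rb_flux_cont B; have M0 := rb_ge0 B.
pose S r := srcG g r (c r); have lS : loc_int S := loc_int_srcG_curve M0 bg cc.
pose D r := lam r * u (r, c r) - f (u (r, c r)) + f (u (r, 0)).
have cD : continuous D.
  move=> r; apply: cvgD; last exact: (@slice_t_continuous _ (fun p => f (u p)) 0 cq).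
  apply: cvgB; last exact: (@curve_continuous (fun p => f (u p)) c cq cc).
  by apply: cvgM; [exact: cl|exact: (@curve_continuous u c)].
pose F t := oint (fun x => u (t, x)) 0 (c t) - oint S s1 t.
rewrite (ointD s1 s2 (continuous_loc_int cD) lS).
suff : F s2 - F s1 = oint D s1 s2.
  move=> <-; rewrite -?/S /F oint_refl; lra.
apply: oint_of_derivative => // t tt e e0.
(* The errors, in units of k |s - t|: |lam| + 1 from the variation of u between the curves, |u| from
   the derivative of c, and 2 + M from freezing the fluxes and the source. *)
pose C := 3 + `|lam t| + `|u (t, c t)| + M.
have C0 : 0 < C.
  by rewrite /C; have := normr_ge0 (lam t); have := normr_ge0 (u (t, c t)); clear -M0; lra.
pose k := e / C; have k0 : 0 < k by rewrite divr_gt0.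
have [d1 d10 h1] := @box_uniform _ u t t (c t) (c t) k cu k0.
have [d2 d20 h2] := @box_uniform _ _ t t (c t) (c t) k cq k0.
have [d3 d30 h3] := @box_uniform _ _ t t 0 0 k cq k0.
have [d4 d40 h4] := dc t tt k k0.
have [d5 d50 h5] := dc t tt 1 ltr01.
have [d6 d60 h6] := @continuous_eps c t k cc k0.
have [d7 d70 h7] := @continuous_eps c t d1 cc d10.
pose d := Num.min (Num.min (Num.min d1 d2) (Num.min d3 d4)) (Num.min (Num.min d5 d6) d7).
exists d; first by rewrite /d !lt_min d10 d20 d30 d40 d50 d60.
move=> s ss; rewrite /d !lt_min => /andP[/andP[/andP[sd1 sd2] /andP[sd3 sd4]] /andP[/andP[sd5 sd6] sd7]].
have btw r := @ler_dist_between t s r.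
have E1 : `|oint (fun x => u (s, x)) (c t) (c s) - u (t, c t) * (c s - c t)|
    <= k * ((`|lam t| + 1) * `|s - t|).
  rewrite -oint_cst -ointB; [|exact: loc_int_slice_x|exact: loc_int_cst].
  have : `|c s - c t| <= (`|lam t| + 1) * `|s - t|.
    have := h5 s ss sd5; rewrite mul1r mulrDl mul1r -normrM => H.
    have := ler_normD (c s - c t - lam t * (s - t)) (lam t * (s - t)); rewrite subrK.
    by move: H; set A := `|_ - _|; set A' := `|_|; set A'' := `|_|; set A''' := `|_|; lra.
  move=> H; apply: (le_trans (oint_norm_le (M := k) _ _)).
  - by apply: loc_intB; [exact: loc_int_slice_x|exact: loc_int_cst].
  - move=> x xx; apply/ltW/h1; rewrite ?lexx//.
    apply: le_lt_trans (h7 s sd7).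
    exact: ler_dist_between.
  - by rewrite ler_wpM2l// ltW.
have E2 : `|u (t, c t) * (c s - c t - lam t * (s - t))| <= `|u (t, c t)| * (k * `|s - t|).
  by rewrite normrM ler_wpM2l//; exact: h4.
have lq x : loc_int (fun r => f (u (r, x))) by apply: (loc_int_slice_t (h := fun p => f (u p))).
have lG x : loc_int (fun r => srcG g r x).
  by apply: (loc_int_srcG_curve M0 bg); exact: cst_continuous.
have E3 : `|oint (fun r => f (u (r, 0)) - f (u (r, c t)) + srcG g r (c t) - S r
     - (f (u (t, 0)) - f (u (t, c t)))) t s| <= (2 * k + M * k) * `|s - t|.
  apply: oint_norm_le.
    apply: loc_intB; last exact: loc_int_cst.
    apply: loc_intB => //; apply: loc_intD => //; exact: loc_intB.
  move=> r /btw rt.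
  have A1 : `|f (u (r, c t)) - f (u (t, c t))| < k.
    by apply: h2; rewrite ?lexx ?subrr ?normr0//; apply: le_lt_trans rt sd2.
  have A2 : `|f (u (r, 0)) - f (u (t, 0))| < k.
    by apply: h3; rewrite ?lexx ?subrr ?normr0//; apply: le_lt_trans rt sd3.
  have A3 : `|srcG g r (c t) - S r| <= M * k.
    rewrite /S; apply: le_trans (rb_lip B _ _ _) _; rewrite ler_wpM2l// ltW// distrC.
    by apply: h6; apply: le_lt_trans rt sd6.
  move: A1 A2 A3; rewrite !ltr_norml !ler_norml => /andP[? ?] /andP[? ?] /andP[? ?].
  by apply/andP; split; lra.
have EF : F s - F t - D t * (s - t) =
  (oint (fun x => u (s, x)) (c t) (c s) - u (t, c t) * (c s - c t))
  + u (t, c t) * (c s - c t - lam t * (s - t))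
  + oint (fun r => f (u (r, 0)) - f (u (r, c t)) + srcG g r (c t) - S r
     - (f (u (t, 0)) - f (u (t, c t)))) t s.
  have R1 := rb_eq B t s 0 (c t).
  have -> : F s - F t = oint (fun x => u (s, x)) (c t) (c s) +
     (oint (fun x => u (s, x)) 0 (c t) - oint (fun x => u (t, x)) 0 (c t)) - oint S t s.
    have := oint_cat 0 (c t) (c s) (loc_int_slice_x s cu).
    have := oint_cat s1 t s lS; rewrite /F; lra.
  have -> : oint (fun r => f (u (r, 0)) - f (u (r, c t)) + srcG g r (c t) - S r
     - (f (u (t, 0)) - f (u (t, c t)))) t s =
     oint (fun r => f (u (r, 0)) - f (u (r, c t)) + (srcG g r (c t) - srcG g r 0)) t s - oint S t s
     - (f (u (t, 0)) - f (u (t, c t))) * (s - t).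
    rewrite ointB; [|apply: loc_intB => //; apply: loc_intD => //; exact: loc_intB|exact: loc_int_cst].
    rewrite oint_cst; congr (_ - _); rewrite ointB => //; last by apply: loc_intD => //; exact: loc_intB.
    by congr (oint _ _ _ - _); apply/funext => r; rewrite [srcG g r 0]oint_refl subr0.
  by rewrite R1 /D; lra.
rewrite EF; apply: le_trans (ler_normD _ _) _; apply: le_trans (lerD (ler_normD _ _) (lexx _)) _.
have -> : e = k * C by rewrite /k divfK// gt_eqF.
move: E1 E2 E3; set A1 := `|_|; set A2 := `|_ * _|; set A3 := `|oint _ _ _|.
by rewrite /C; set z := `|s - t|; lra.
Qed.

End curve_balance.

(** * Thin strips along a characteristic *)

Section strip.
Context {R : realType}.
Implicit Types (f ga c lam v : R -> R) (u g : R * R -> R) (Z : R * R -> bool).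
Implicit Types (t s r x y a b d e h M K sg : R).

(** For lam = f'(u), f lies above (sg = 1) or below (sg = -1) its tangent; eta is uniform in t so
    that a strip of constant width fits. *)
Definition tangent_side f u ga lam sg s1 s2 := exists2 eta : R, 0 < eta &
  forall t w, s1 <= t <= s2 -> `|w - u (t, ga t)| < eta ->
    0 <= sg * (f w - f (u (t, ga t)) - lam t * (w - u (t, ga t))).

Definition source_quotient g h (p : R * R) := (srcG g p.1 (p.2 + h) - srcG g p.1 p.2) / h.

Definition strip_mean u ga h t := oint (fun x => u (t, x)) (ga t) (ga t + h) / h.

Lemma source_quotient_le g M h p : bdd2 g M -> h != 0 -> `|source_quotient g h p| <= M.
Proof.
move=> bg h0; rewrite /source_quotient (srcGB _ _ _ bg) normrM normfV.
rewrite ler_pdivrMr ?normr_gt0//.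
by have := bdd2_inner_le p.1 p.2 (p.2 + h) bg; rewrite (addrC p.2) addrK.
Qed.

Lemma source_quotient_measurable g M h : bdd2 g M -> measurable_fun setT (source_quotient g h).
Proof.
move=> [mg bg]; apply: measurable_funM; last exact: measurable_cst.
have mg' : measurable_fun setT (fun q : (R * R) * R => g (q.1.1, q.2)).
  apply: (measurableT_comp mg).
  apply/measurable_fun_pairP; split; first exact: (measurableT_comp measurable_fst measurable_fst).
  exact: measurable_snd.
apply: measurable_funB; rewrite /srcG.
  apply: (@measurable_oint _ _ _ (fun q : (R * R) * R => g (q.1.1, q.2)) _ _ M) => //.
  by apply: measurable_funD; [exact: measurable_snd|exact: measurable_cst].
apply: (@measurable_oint _ _ _ (fun q : (R * R) * R => g (q.1.1, q.2)) _ _ M) => //.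
Qed.

Lemma curve_measurable (d0 : measure_display) (T : measurableType d0) (phi : R * R -> T) ga : measurable_fun setT phi ->
  continuous ga -> measurable_fun setT (fun t => phi (t, ga t)).
Proof.
move=> mphi cga; apply: (measurableT_comp mphi); apply/measurable_fun_pairP.
by split; [exact: measurable_id|exact: continuous_measurable_fun].
Qed.

Lemma strip_mean_cvg u ga t (h_ : nat -> R) : continuous u -> (forall n, h_ n != 0) ->
  h_ n @[n --> \oo] --> 0 -> strip_mean u ga (h_ n) t @[n --> \oo] --> u (t, ga t).
Proof.
move=> cu h0 ch; apply/cvgrPdist_le => e e0.
have [d d0 H] := @box_uniform _ u t t (ga t) (ga t) e cu e0.
move: ch => /cvgrPdist_lt/(_ d d0); apply: filterS => n; rewrite sub0r normrN => hn.
rewrite distrC /strip_mean; set h := h_ n in hn *.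
have h0' : h != 0 := h0 n.
have -> : u (t, ga t) = u (t, ga t) * (ga t + h - ga t) / h by rewrite addrAC subrr add0r mulfK.
rewrite -oint_cst -mulrBl -ointB; [|exact: loc_int_slice_x|exact: loc_int_cst].
rewrite normrM normfV ler_pdivrMr ?normr_gt0//.
have -> : `|h| = `|ga t + h - ga t| by rewrite addrAC subrr add0r.
apply: oint_norm_le; first by apply: loc_intB; [exact: loc_int_slice_x|exact: loc_int_cst].
move=> x xx; apply/ltW/H; rewrite ?lexx ?subrr ?normr0//.
apply: le_lt_trans hn; have := ler_dist_between xx; by rewrite (_ : ga t + h - ga t = h)// addrAC subrr add0r.
Qed.

(** Subtract the balances along ga and ga + h. The flux left over is the remainder f(w) - f(v) - lam
    (w - v), where v and w are the values of u on the two curves, and it has the sign sg. Since h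
    may have either sign, a remainder of one sign bounds the increment of the mean from both
    sides. *)
Lemma strip_inequality f u g M ga lam sg s1 s2 : rect_balance f u (srcG g) M -> bdd2 g M ->
  continuous ga -> continuous lam -> s1 <= s2 -> derives_on s1 s2 ga lam ->
  tangent_side f u ga lam sg s1 s2 ->
  exists2 d, 0 < d & forall h, h != 0 -> `|h| < d ->
    0 <= sg * h * (oint (fun r => source_quotient g h (r, ga r)) s1 s2
      - (strip_mean u ga h s2 - strip_mean u ga h s1)).
Proof.
move=> B bg cga cl s12 dga [eta eta0 tan].
have cu := rb_cont B; have cq := rb_flux_cont B; have M0 := rb_ge0 B.
have [K K0 HK] := @box_bounded _ (fun p => ga p.1) s1 s2 0 0
  (fun p => continuous_comp (@cvg_fst _ _ _ _ _) (cga p.1)).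
have [d d0 H] := @box_uniform _ u s1 s2 (- K) K eta cu eta0.
exists d => // h h0 hd.
have cgah : continuous (fun t => ga t + h).
  by move=> t; apply: cvgD; [exact: cga|exact: cvg_cst].
have dgah : derives_on s1 s2 (fun t => ga t + h) lam.
  move=> t tt e e0; have [d' d'0 H'] := dga t tt e e0; exists d' => // s ss st.
  by rewrite (_ : ga s + h - (ga t + h) = ga s - ga t); [exact: H'|lra].
have C0 := curve_balance B bg cga cl s12 dga.
have C1 := curve_balance B bg cgah cl s12 dgah.
have cD c : continuous c -> continuous (fun r => lam r * u (r, c r) - f (u (r, c r)) + f (u (r, 0))).
  move=> cc r; apply: cvgD; last exact: (@slice_t_continuous _ (fun p => f (u p)) 0 cq).
  apply: cvgB; last exact: (@curve_continuous _ (fun p => f (u p)) c cq cc).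
  by apply: cvgM; [exact: cl|exact: (@curve_continuous _ u c)].
pose D c r := lam r * u (r, c r) - f (u (r, c r)) + f (u (r, 0)).
have lD c : continuous c -> loc_int (D c) by move=> cc; apply: continuous_loc_int; exact: cD.
have lS c : continuous c -> loc_int (fun t => srcG g t (c t)) by move=> cc; exact: (@loc_int_srcG_curve _ g M c M0 bg cc).
have lQ : loc_int (fun r => source_quotient g h (r, ga r)).
  apply: (bounded_loc_int (M := M)); last by move=> r; exact: source_quotient_le.
  by apply: curve_measurable => //; exact: source_quotient_measurable bg.
have SM t : h * strip_mean u ga h t =
    oint (fun x => u (t, x)) 0 (ga t + h) - oint (fun x => u (t, x)) 0 (ga t).
  rewrite /strip_mean mulrC divfK//.
  by have := oint_cat 0 (ga t) (ga t + h) (loc_int_slice_x t cu); clear; lra.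
have lin (a1 a2 b1 b2 e0 e1 g0 g1 : R) : a2 - a1 = e0 + g0 -> b2 - b1 = e1 + g1 ->
    g1 - g0 - (b2 - a2 - (b1 - a1)) = e0 - e1.
  by clear; lra.
have -> : sg * h * (oint (fun r => source_quotient g h (r, ga r)) s1 s2
      - (strip_mean u ga h s2 - strip_mean u ga h s1)) =
   sg * oint (fun r => D ga r - D (fun t => ga t + h) r) s1 s2.
  rewrite -mulrA; congr (_ * _); rewrite mulrBr mulrBr !SM.
  rewrite -(ointZ h s1 s2 lQ).
  have -> : (fun x => h * source_quotient g h (x, ga x)) =
     (fun r => srcG g r (ga r + h) - srcG g r (ga r)).
    by apply/funext => r; rewrite /source_quotient/= mulrC divfK.
  rewrite (ointB s1 s2 (lS _ cgah) (lS _ cga)) (ointB s1 s2 (lD _ cga) (lD _ cgah)).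
  move: C0 C1; rewrite (ointD s1 s2 (lD _ cga) (lS _ cga)) (ointD s1 s2 (lD _ cgah) (lS _ cgah)).
  exact: lin.
rewrite -(ointZ sg s1 s2 (loc_intB (lD _ cga) (lD _ cgah))).
apply: oint_ge0 => // r rr; rewrite /D.
have := tan r (u (r, ga r + h)) rr.
have /[swap]/[apply] : `|u (r, ga r + h) - u (r, ga r)| < eta.
  have := HK r 0 rr; rewrite lexx => /(_ isT) /= gaK.
  apply: H => //; [by rewrite -ler_norml|by rewrite subrr normr0|].
  by rewrite (_ : ga r + h - ga r = h)// addrAC subrr add0r.
have E (A A' A'' l X Y : R) : A - A' - l * (X - Y) = l * Y - A' + A'' - (l * X - A + A'').
  by clear; rewrite mulrBr; lra.
by rewrite (E _ _ (f (u (r, 0)))).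
Qed.

Lemma characteristic_bounds f u g M ga lam sg s1 s2 Z : rect_balance f u (srcG g) M -> bdd2 g M ->
  continuous ga -> continuous lam -> s1 <= s2 -> derives_on s1 s2 ga lam ->
  sg = 1 \/ sg = -1 -> tangent_side f u ga lam sg s1 s2 ->
  measurable_fun setT Z ->
  (forall p, ~~ Z p -> source_quotient g n.+1%:R^-1 p @[n --> \oo] --> g p /\
    source_quotient g (- n.+1%:R^-1) p @[n --> \oo] --> g p) ->
  oint (fun t => if Z (t, ga t) then - M else g (t, ga t)) s1 s2 <= u (s2, ga s2) - u (s1, ga s1)
    <= oint (fun t => if Z (t, ga t) then M else g (t, ga t)) s1 s2.
Proof.
move=> B bg cga cl s12 dga sg1 tan mZ offZ.
have cu := rb_cont B; have M0 := rb_ge0 B.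
have [d d0 H] := strip_inequality B bg cga cl s12 dga tan.
(* The upper bound comes from strips on the side where sg h > 0, the lower one from the opposite
   side. *)
have half (up : bool) (hs := if up then sg else - sg) (m := if up then M else - M) :
    exists h_ : nat -> R, [/\ forall n, h_ n != 0, h_ n @[n --> \oo] --> 0,
      forall p, ~~ Z p -> source_quotient g (h_ n) p @[n --> \oo] --> g p &
      forall n, 0 < hs * h_ n].
  have i0 n : 0 < n.+1%:R^-1 :> R by rewrite invr_gt0 ltr0n.
  have [E|E] : hs = 1 \/ hs = -1.
    by rewrite /hs; case: (up); case: sg1 => ->; rewrite ?opprK; tauto.
    exists (fun n => n.+1%:R^-1); split.
    - by move=> n; rewrite gt_eqF.
    - exact: cvg_harmonic.
    - by move=> p /offZ[].
    - by move=> n; rewrite E mul1r.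
  exists (fun n => - n.+1%:R^-1); split.
  - by move=> n; rewrite oppr_eq0 gt_eqF.
  - by rewrite -oppr0; apply: cvgN; exact: cvg_harmonic.
  - by move=> p /offZ[].
  - by move=> n; rewrite E mulN1r opprK.
have mcurve (m : R) (phi : R * R -> R) : measurable_fun setT phi ->
    measurable_fun setT (fun t => if Z (t, ga t) then m else phi (t, ga t)).
  move=> mphi; apply: (@curve_measurable _ _ (fun p => if Z p then m else phi p)) => //.
  by apply: measurable_fun_ifT => //; exact: measurable_cst.
have fin (up : bool) (m := if up then M else - M) : exists h_ : nat -> R,
   [/\ forall n, h_ n != 0, h_ n @[n --> \oo] --> 0,
     oint (fun t => if Z (t, ga t) then m else source_quotient g (h_ n) (t, ga t)) s1 s2
       @[n --> \oo] --> oint (fun t => if Z (t, ga t) then m else g (t, ga t)) s1 s2 &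
     \forall n \near \oo, 0 <= (if up then 1 else -1) *
       (oint (fun t => source_quotient g (h_ n) (t, ga t)) s1 s2
      - (strip_mean u ga (h_ n) s2 - strip_mean u ga (h_ n) s1))].
  have [h_ [h0 hc hg hs]] := half up; exists h_; split => //.
    apply: (@oint_dominated _ _ _ _ _ M).
    - by move=> n; apply: mcurve; exact: source_quotient_measurable bg.
    - move=> n t _; case: ifP => _; last exact: source_quotient_le.
      by rewrite /m; case: (up); rewrite ?normrN ger0_norm.
    - move=> t _; case: ifPn => [_|/hg//]; exact: cvg_cst.
    - by apply: mcurve; exact: bg.1.
  move: hc => /cvgrPdist_lt/(_ d d0); apply: filterS => n; rewrite sub0r normrN => hn.
  have := H (h_ n) (h0 n) hn; have := hs n; set X := oint _ _ _ - _.
  have -> : sg * h_ n * X = (if up then sg else - sg) * h_ n * ((if up then 1 else -1) * X).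
    by case: (up); lra.
  by move=> hp; rewrite pmulr_rge0.
have sq h : h != 0 -> loc_int (fun r => source_quotient g h (r, ga r)).
  move=> h0; apply: (bounded_loc_int (M := M)); last by move=> r; exact: source_quotient_le.
  by apply: curve_measurable => //; exact: source_quotient_measurable bg.
have sm h m : h != 0 -> `|m| <= M ->
   loc_int (fun t => if Z (t, ga t) then m else source_quotient g h (t, ga t)).
  move=> h0 mM; apply: (bounded_loc_int (M := M)).
    by apply: mcurve; exact: source_quotient_measurable bg.
  by move=> r; case: ifP => // _; exact: source_quotient_le.
have qb h t : h != 0 -> - M <= source_quotient g h (t, ga t) <= M.
  by move=> h0; rewrite -ler_norml; exact: source_quotient_le.
have cS (h_ : nat -> R) : (forall n, h_ n != 0) -> h_ n @[n --> \oo] --> 0 ->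
    strip_mean u ga (h_ n) s2 - strip_mean u ga (h_ n) s1 @[n --> \oo] -->
      u (s2, ga s2) - u (s1, ga s1).
  by move=> h0 hc; apply: cvgB; exact: strip_mean_cvg.
apply/andP; split.
  have [h_ [h0 hc /= ci le]] := fin false.
  apply: (ler_cvg_to ci (cS h_ h0 hc)).
  apply: filterS le => n le.
  apply: (@le_trans _ _ (oint (fun t => source_quotient g (h_ n) (t, ga t)) s1 s2)).
    apply: le_oint => //; [by apply: sm; rewrite // normrN ger0_norm|exact: sq|].
    by move=> t _; case: ifP => // _; have /andP[] := qb _ t (h0 n).
  by move: le; rewrite mulN1r oppr_ge0 subr_le0.
have [h_ [h0 hc /= ci le]] := fin true.
apply: (ler_cvg_to (cS h_ h0 hc) ci).
apply: filterS le => n le.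
apply: (@le_trans _ _ (oint (fun t => source_quotient g (h_ n) (t, ga t)) s1 s2)); last first.
  apply: le_oint => //; [exact: sq|by apply: sm; rewrite // ger0_norm|].
  by move=> t _; case: ifP => // _; have /andP[] := qb _ t (h0 n).
by move: le; rewrite mul1r subr_ge0.
Qed.

End strip.

(** * Lipschitz functions as integrals of bounded functions *)

Section lipschitz_cumulative.
Context {R : realType}.
Variables (v : R -> R) (M : R).
Hypothesis vM : forall s t, `|v t - v s| <= M * `|t - s|.

(** The added slope makes the function nondecreasing, so that it defines a Stieltjes measure. *)
Definition tilt t := v t + M * t.

Let tiltM s t : s <= t -> 0 <= tilt t - tilt s <= (2 * M + 1) * (t - s).
Proof.
move=> st; have := vM s t; rewrite (ger0_norm (_ : 0 <= t - s)) ?subr_ge0//.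
by rewrite ler_norml /tilt => /andP[? ?]; apply/andP; split; lra.
Qed.

Let tilt_nd : {homo tilt : s t / s <= t}.
Proof. by move=> s t /tiltM/andP[]; rewrite subr_ge0. Qed.

Let tilt_rc : right_continuous tilt.
Proof.
have M0 : 0 <= M.
  by have := vM 0 1; rewrite subr0 normr1 mulr1; exact: le_trans.
apply/right_continuousW => t; apply/cvgrPdist_lt => e e0.
apply/nbhs_ballP; exists (e / (2 * M + 1)) => [/=|s].
  by rewrite divr_gt0//; lra.
move=> /= ts; have {}ts : (2 * M + 1) * `|t - s| < e.
  by rewrite mulrC -ltr_pdivlMr//; lra.
apply: le_lt_trans ts; have [st|/ltW ts] := leP s t.
  by have /andP[? ?] := tiltM st; rewrite !ger0_norm ?subr_ge0//; exact: tilt_nd.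
have /andP[? ?] := tiltM ts; rewrite distrC (distrC t).
by rewrite !ger0_norm ?subr_ge0//; exact: tilt_nd.
Qed.

HB.instance Definition _ := isCumulative.Build R _ R tilt tilt_nd tilt_rc.

Local Open Scope ereal_scope.

(** The Stieltjes measure is an infimum over covers by half-open intervals, on each of which the
    Lipschitz bound applies. The constant 2 M + 1 is positive even when M = 0, which allows division
    by it. *)
Lemma tilt_measure_le (A : set (measurableTypeR R)) :
  lebesgue_stieltjes_measure tilt A <= (2 * M + 1)%:E * lebesgue_measure A.
Proof.
have L0 : (0 < 2 * M + 1)%R.
  have : (0 <= M)%R by have := vM 0 1; rewrite subr0 normr1 mulr1; exact: le_trans.
  by lra.
rewrite -lee_pdivrMl//; apply: le_ereal_inf_tmp => _ [C [mC AC] <-].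
rewrite lee_pdivrMl// -nneseriesZl; last by move=> i _; exact: wlength_ge0.
apply: (@le_trans _ _ (\sum_(k <oo) wlength tilt (C k))).
  by apply: ereal_inf_lbound; exists C.
apply: lee_nneseries => [i _ _|i _]; first exact: wlength_ge0.
have [->|[[x y] /= /ltW xy ->]] := (ocitvP _).1 (mC i); first by rewrite wlength0 [X in _ * X](wlength0 idfun) mule0.
by rewrite !wlength_itv_bnd// -EFinM lee_fin; have /andP[] := tiltM xy.
Qed.

Lemma tilt_measure_itv a b : (a <= b)%R ->
  lebesgue_stieltjes_measure tilt `]a, b]%classic = (tilt b - tilt a)%:E.
Proof.
move=> ab; rewrite /lebesgue_stieltjes_measure/= /measure_extension measurable_mu_extE/=.
  by rewrite wlength_itv_bnd.
exact: is_ocitv.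
Qed.

Lemma lipschitz_integral a b : (a <= b)%R ->
  exists k : R -> R, [/\ measurable_fun setT k, exists K, forall x, (`|k x| <= K)%R &
    forall s t, (a <= s)%R -> (s <= t)%R -> (t <= b)%R -> (v t - v s)%R = oint k s t].
Proof.
move=> ab; set L := (2 * M + 1)%R.
have M0 : (0 <= M)%R by have := vM 0 1; rewrite subr0 normr1 mulr1; exact: le_trans.
have L0 : (0 < L)%R by rewrite /L; lra.
have mD : measurable (`]a, b]%classic : set (measurableTypeR R)) by exact: measurable_itv.
have Doo : lebesgue_stieltjes_measure tilt `]a, b]%classic < +oo.
  by rewrite tilt_measure_itv// ltry.
pose nu : {finite_measure set (measurableTypeR R) -> \bar R} := mfrestr mD Doo.
have nuL A : measurable A -> nu A <= L%:E * lebesgue_measure A.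
  move=> mA; rewrite /nu/= /mfrestr/= /mrestr; apply: le_trans (tilt_measure_le _) _.
  rewrite lee_pmul2l// ; apply: le_measure; rewrite ?inE//; exact: measurableI.
have numu : nu `<< lebesgue_measure.
  move=> A nA B mB BA; apply/eqP; rewrite eq_le measure_ge0 andbT.
  by apply: le_trans (nuL _ mB) _; rewrite (nA _ mB BA) mule0.
have [h [h0 hfin ih hE]] := radon_nikodym_sigma_finite numu.
have mh : measurable_fun setT h by have /integrableP[] := ih.
have hh x : h x = (fine (h x))%:E by rewrite fineK.
(* The Radon-Nikodym density is bounded by L only almost everywhere; it is truncated to be bounded
   at every point. The truncation represents the same measure because nu <= L mu, applied on {h >
   L}. *)
pose m x := mine (h x) L%:E.
have mm : measurable_fun setT m by apply: measurable_mine => //; exact: measurable_cst.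
have m0 x : 0 <= m x by rewrite /m le_min h0 lee_fin ltW.
have mL x : m x <= L%:E by rewrite /m ge_min lexx orbT.
have mfin x : m x = (fine (m x))%:E.
  by rewrite fineK// ge0_fin_numE//; apply: le_lt_trans (mL x) _; rewrite ltry.
have trunc A : measurable A -> nu A = \int[lebesgue_measure]_(x in A) m x.
  move=> mA; rewrite hE//; apply/eqP; rewrite eq_le; apply/andP; split; last first.
    apply: ge0_le_integral => //; [exact: measurable_funTS|exact: measurable_funTS|].
    by move=> x _; rewrite /m ge_min lexx.
  pose H := [set x | L%:E < h x].
  have mH : measurable H.
    rewrite (_ : H = setT `&` h @^-1` `]L%:E, +oo[%classic).
      exact: (mh measurableT _ (emeasurable_itv _)).
    by rewrite setTI; apply/seteqP; split => x /=; rewrite in_itv/= andbT.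
  have dj : [disjoint A `&` H & A `\` H]%classic.
    by apply/disj_setPS => x [[_ ?] [_ ?]].
  have mAH : measurable (A `&` H) by exact: measurableI.
  have mAD : measurable (A `\` H) by exact: measurableD.
  have cut (F : measurableTypeR R -> \bar R) : measurable_fun setT F -> (forall x, 0 <= F x) ->
      \int[lebesgue_measure]_(x in A) F x =
      \int[lebesgue_measure]_(x in A `&` H) F x + \int[lebesgue_measure]_(x in A `\` H) F x.
    move=> mF F0; rewrite -[in LHS](setUIDK A H) ge0_integral_setU//.
    exact: measurable_funTS.
  rewrite (cut h mh h0) (cut m mm m0).
  apply: leeD.
    rewrite -hE//; apply: le_trans (nuL _ mAH) _.
    rewrite -integral_cst//; apply: ge0_le_integral => //; [by move=> x _; rewrite lee_fin ltW|exact: measurable_funTS|].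
    by move=> x [_ /= Hx]; rewrite /m le_min lexx ltW.
  apply: ge0_le_integral => //; [exact: measurable_funTS|exact: measurable_funTS|].
  by move=> x [_ /= Hx]; rewrite /m le_min lexx leNgt; apply/negP.
exists (fun x => fine (m x) - M)%R.
have mf : measurable_fun setT (fun x => fine (m x) - M)%R.
  by apply: measurable_funB; [exact: measurableT_comp|exact: measurable_cst].
have fL x : (0 <= fine (m x) <= L)%R by rewrite -!lee_fin -mfin m0 mL.
have mfK x : (`|fine (m x) - M| <= L + M)%R.
  have /andP[? ?] := fL x; rewrite ler_norml; apply/andP; split; lra.
split => //; first by exists (L + M)%R.
have lm : loc_int (fun x => fine (m x)).
  apply: (bounded_loc_int (M := L)); first exact: measurableT_comp.
  by move=> x; have /andP[? ?] := fL x; rewrite ger0_norm.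
move=> s t as_ st tb; rewrite (ointB _ _ lm (loc_int_cst _)) oint_cst (ointE _ st).
have -> : (\int[lebesgue_measure]_(x in `[s, t]) fine (m x) = tilt t - tilt s)%R.
  rewrite -Rintegral_itv_obnd_cbnd; last first.
    apply: (integrableS _ _ _ (lm s t)) => //.
    by move=> x; rewrite /= !in_itv/= => /andP[/ltW -> ->].
  rewrite /Rintegral; under eq_integral do rewrite -mfin.
  rewrite -trunc ?/nu/= /mfrestr/= /mrestr; last exact: measurable_itv.
  rewrite setIidl ?tilt_measure_itv//.
  by move=> x /=; rewrite !in_itv/= => /andP[sx xt]; rewrite (le_lt_trans as_)// (le_trans xt).
by rewrite /tilt; lra.
Qed.

End lipschitz_cumulative.

(** * A geometric source *)

Section closed_projection.
Context {R : realType}.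

Lemma closed_forall (T : topologicalType) (I : Type) (D : I -> Prop) (P : I -> set T) :
  (forall i, D i -> closed (P i)) -> closed [set x | forall i, D i -> P i x].
Proof.
move=> cP; rewrite (_ : [set _ | _] = \bigcap_(i in D) P i); first exact: closed_bigI.
by apply/seteqP; split.
Qed.

Lemma closed_ge0 (T : topologicalType) (F : T -> R) : continuous F -> closed [set x | 0 <= F x].
Proof.
by move=> cF; apply: (@preimage_closed _ _ F [set y | 0 <= y]) => [x _|]; [exact: cF|exact: closed_ge].
Qed.

Lemma closed_compact_projection (S T : topologicalType) (K : set S) (C : set (S * T)) :
  compact K -> closed C -> closed [set p | exists2 eta, K eta & C (eta, p)].
Proof.
move=> cK cC; rewrite -openC openE => p /= np.
have /compact_near_coveringP nc := cK.
have H := nc T (nbhs p) (fun q eta => ~ C (eta, q)) _.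
suff /H : forall eta, K eta -> \forall eta' \near eta & q \near p, ~ C (eta', q).
  by apply: filterS => q H' [eta Keta]; exact: H'.
move=> eta Keta; have : (~` C) (eta, p) by move=> /= Cp; apply: np; exists eta.
have oC : open (~` C) by rewrite openC.
move=> Cp; have : nbhs (eta, p) (~` C) by apply: open_nbhs_nbhs.
by apply: filterS => -[].
Qed.

End closed_projection.

Section touching.
Context {R : realType}.
Implicit Types (f eta : R -> R) (u : R * R -> R) (sg b : R) (m : nat) (p : R * R).

(* [eta] is the displacement of a path through [p].  The quotient is, for b != 0,
   the displacement [\int_0^s f' (u p + b r) dr] of a characteristic along which
   [u] grows at speed [b]. *)
Definition touching_path f u sg b m p eta :=
  let rho := m.+1%:R^-1 in
  [/\ eta 0 = 0,
    forall r s, `|r| <= rho -> `|s| <= rho -> `|eta r - eta s| <= m.+1%:R * `|r - s|,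
    forall s, `|s| <= rho -> 0 <= sg * (eta s - (f (u p + b * s) - f (u p)) / b),
    forall s, 0 <= s <= rho -> u p + b * s <= u (p.1 + s, p.2 + eta s) &
    forall s, - rho <= s <= 0 -> u (p.1 + s, p.2 + eta s) <= u p + b * s].

(** Confining all values of eta to [-1, 1] places the paths in a compact product; beyond the time
    span 1 / (m + 1) eta is otherwise arbitrary. *)
Definition touching f u sg b m := [set p | exists2 eta,
  (forall s, `[- 1, 1]%classic (eta s)) & touching_path f u sg b m p eta].

(** Each condition on (eta, p) is a family of weak inequalities between evaluations of eta at single
    times, hence closed for the product topology. The set is then a projection along a Tychonoff
    compact. *)
Lemma touching_closed f u sg b m : continuous f -> continuous u -> closed (touching f u sg b m).
Proof.
move=> cf cu; set rho : R := m.+1%:R^-1.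
have := @tychonoff R (fun=> R) (fun=> `[- 1, 1]%classic) (fun=> @segment_compact R (- 1) 1).
move=> /closed_compact_projection cp.
pose PS := ArrowAsProduct.prod__canonical__topology_structure_Topological (fun _ : R => R).
pose C : set (PS * (R * R)) := [set q | touching_path f u sg b m q.2 q.1].
suff cC : closed C by exact: (cp _ C cC).
have cev s : continuous (fun q : PS * (R * R) => q.1 s).
  move=> q; apply: (@continuous_comp _ _ _ fst (fun eta : PS => eta s)); first exact: cvg_fst.
  exact: (@proj_continuous R (fun=> R) s).
have csnd : continuous (fun q : PS * (R * R) => q.2) by move=> q; exact: cvg_snd.
have cuq : continuous (fun q : PS * (R * R) => u q.2).
  by move=> q; apply: (@continuous_comp _ _ _ snd u); [exact: cvg_snd|exact: cu].
have c1 : continuous (fun q : PS * (R * R) => q.2.1).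
  by move=> q; exact: (@continuous_comp _ _ _ snd fst q (csnd q) (@cvg_fst _ _ _ _ _)).
have c2 : continuous (fun q : PS * (R * R) => q.2.2).
  by move=> q; exact: (@continuous_comp _ _ _ snd snd q (csnd q) (@cvg_snd _ _ _ _ _)).
have c21 s : continuous (fun q : PS * (R * R) => q.2.1 + s).
  by move=> q; exact: (cvgD (c1 q) (cvg_cst s)).
have c22 s : continuous (fun q : PS * (R * R) => q.2.2 + q.1 s).
  by move=> q; exact: (cvgD (c2 q) (cev s q)).
have cup s : continuous (fun q : PS * (R * R) => u (q.2.1 + s, q.2.2 + q.1 s)).
  move=> q; apply: (@continuous_comp _ _ _ (fun q : PS * (R * R) => (q.2.1 + s, q.2.2 + q.1 s)) u);
    last exact: cu.
  exact: (cvg_pair (c21 s q) (c22 s q)).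
have cub s : continuous (fun q : PS * (R * R) => u q.2 + b * s).
  by move=> q; exact: (cvgD (cuq q) (cvg_cst (b * s))).
have k0 : continuous (fun q : PS * (R * R) => - `|q.1 0|).
  by move=> q; exact: (cvgN (cvg_norm (cev 0 q))).
have k1 r s : continuous (fun q : PS * (R * R) => m.+1%:R * `|r - s| - `|q.1 r - q.1 s|).
  move=> q; exact: (cvgB (cvg_cst (m.+1%:R * `|r - s|)) (cvg_norm (cvgB (cev r q) (cev s q)))).
have cfu s : continuous (fun q : PS * (R * R) => f (u q.2 + b * s)).
  by move=> q; exact: (@continuous_comp _ _ _ (fun q : PS * (R * R) => u q.2 + b * s) f q (cub s q) (cf _)).
have cfu0 : continuous (fun q : PS * (R * R) => f (u q.2)).
  by move=> q; exact: (@continuous_comp _ _ _ (fun q : PS * (R * R) => u q.2) f q (cuq q) (cf _)).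
have k2 s : continuous (fun q : PS * (R * R) => sg * (q.1 s - (f (u q.2 + b * s) - f (u q.2)) / b)).
  move=> q; exact: (cvgM (cvg_cst sg) (cvgB (cev s q) (cvgM (cvgB (cfu s q) (cfu0 q)) (cvg_cst b^-1)))).
have k3 s : continuous (fun q : PS * (R * R) => u (q.2.1 + s, q.2.2 + q.1 s) - (u q.2 + b * s)).
  by move=> q; exact: (cvgB (cup s q) (cub s q)).
have k4 s : continuous (fun q : PS * (R * R) => u q.2 + b * s - u (q.2.1 + s, q.2.2 + q.1 s)).
  by move=> q; exact: (cvgB (cub s q) (cup s q)).
rewrite (_ : C = [set q | 0 <= - `|q.1 0|] `&`
  [set q | forall rs : R * R, `|rs.1| <= rho /\ `|rs.2| <= rho ->
     0 <= m.+1%:R * `|rs.1 - rs.2| - `|q.1 rs.1 - q.1 rs.2|] `&`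
  [set q | forall s, `|s| <= rho ->
     0 <= sg * (q.1 s - (f (u q.2 + b * s) - f (u q.2)) / b)] `&`
  [set q | forall s, 0 <= s <= rho -> 0 <= u (q.2.1 + s, q.2.2 + q.1 s) - (u q.2 + b * s)] `&`
  [set q | forall s, - rho <= s <= 0 -> 0 <= u q.2 + b * s - u (q.2.1 + s, q.2.2 + q.1 s)]).
  apply: closedI; first apply: closedI; first apply: closedI; first apply: closedI.
  - exact: (closed_ge0 k0).
  - by apply: closed_forall => -[r s] _; exact: (closed_ge0 (k1 r s)).
  - by apply: closed_forall => s _; exact: (closed_ge0 (k2 s)).
  - by apply: closed_forall => s _; exact: (closed_ge0 (k3 s)).
  - by apply: closed_forall => s _; exact: (closed_ge0 (k4 s)).
apply/seteqP; split => [[eta p] /= [h0 h1 h2 h3 h4]|[eta p] /= [[[[h0 h1] h2] h3] h4]].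
  split; [split; [split; [split|]|]|] => //.
  - by move: h0 => /= ->; rewrite normr0 oppr0.
  - by move=> [r s] /= [rr ss]; rewrite subr_ge0; exact: h1.
  - by move=> s ss; rewrite subr_ge0; exact: h3.
  - by move=> s ss; rewrite subr_ge0; exact: h4.
split => //.
- by apply/eqP; rewrite -normr_le0 -oppr_ge0.
- by move=> r s rr ss; rewrite -subr_ge0; exact: (h1 (r, s)).
- by move=> s ss; rewrite -subr_ge0; exact: h3.
- by move=> s ss; rewrite -subr_ge0; exact: h4.
Qed.

(** The index is both the Lipschitz constant and the inverse of the time span, so raising it relaxes
    both. *)
Lemma touching_mono f u sg b m n : (m <= n)%N -> touching f u sg b m `<=` touching f u sg b n.
Proof.
move=> mn p [eta e1 [h0 h1 h2 h3 h4]]; exists eta => //.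
have rr : n.+1%:R^-1 <= m.+1%:R^-1 :> R by rewrite lef_pV2 ?posrE ?ltr0n// ler_nat.
split => //.
- move=> r s /le_trans/(_ rr) ? /le_trans/(_ rr) ?; apply: le_trans (h1 _ _ _ _) _ => //.
  by rewrite ler_wpM2r// ler_nat.
- by move=> s /le_trans/(_ rr); exact: h2.
- by move=> s /andP[? /le_trans/(_ rr) ?]; apply: h3; apply/andP.
- by move=> s /andP[sr ?]; apply: h4; apply/andP; split => //; apply: le_trans sr; rewrite lerN2.
Qed.

(* The value -1 is junk at the points near which f is neither convex nor
   concave. *)
Definition convexity (f2 : R -> R) (z : R) : R :=
  if `[< exists2 e : R, 0 < e & forall w, `|w - z| < e -> 0 <= f2 w >] then 1 else - 1.

(** The integer k codes a rational speed and an index of [touching]. The speed 0 is excluded since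
    the displacement in [touching_path] divides by it; failures return - M, the least value the
    supremum may take. *)
Definition speed_candidate f (f2 : R -> R) u M (k : nat) p : R :=
  if unpickle k is Some (q, m) then
    let b : R := ratr q in
    if (b != 0) && (`|b| <= M) && `[< touching f u (convexity f2 (u p)) b m p >] then b else - M
  else - M.

Definition touching_source f f2 u M p := sups (fun k => speed_candidate f f2 u M k p) 0.

Lemma convexity_measurable f2 u : continuous u ->
  measurable_fun setT (fun p => convexity f2 (u p)).
Proof.
move=> cu; pose P := [set z | exists2 e : R, 0 < e & forall w, `|w - z| < e -> 0 <= f2 w].
have oP : open P.
  rewrite openE => z [e e0 H]; apply/nbhs_ballP; exists (e / 2); first by rewrite /= divr_gt0.
  move=> w /= zw; exists (e / 2) => [|w' ww]; first by rewrite divr_gt0.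
  apply: H; rewrite (splitr e) (_ : w' - z = (w' - w) + (w - z)); last by lra.
  apply: le_lt_trans (ler_normD _ _) _; apply: ltrD => //; by rewrite distrC.
apply: measurable_fun_ifT; [|exact: measurable_cst..].
apply: (measurable_fun_bool true); rewrite setTI.
rewrite (_ : _ @^-1` _ = u @^-1` P).
  by apply: open_prod_measurable; apply: open_comp => // p _; exact: cu.
by apply/seteqP; split => p /= /asboolP.
Qed.

(** Touching sets are closed for a fixed sign; the sign depends on p, so the test is split according
    to it. *)
Lemma speed_candidate_measurable f f2 u M k : continuous f -> continuous u ->
  measurable_fun setT (speed_candidate f f2 u M k).
Proof.
move=> cf cu; rewrite /speed_candidate; case: unpickle => [[q m]|]; last exact: measurable_cst.
apply: measurable_fun_ifT; [|exact: measurable_cst..].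
apply: measurable_and; first exact: measurable_cst.
have E p : `[< touching f u (convexity f2 (u p)) (ratr q) m p >] =
   if convexity f2 (u p) == 1 then `[< touching f u 1 (ratr q) m p >] else
     `[< touching f u (- 1) (ratr q) m p >].
  rewrite /convexity; case: ifP => _; first by rewrite eqxx.
  by rewrite (_ : - 1 == 1 = false :> bool)//; apply/eqP; lra.
under eq_fun do rewrite E.
have mt sg : measurable_fun setT (fun p => `[< touching f u sg (ratr q) m p >]).
  apply: (measurable_fun_bool true); rewrite setTI.
  rewrite (_ : _ @^-1` _ = touching f u sg (ratr q) m).
    by apply: closed_prod_measurable; exact: touching_closed.
  by apply/seteqP; split => p /= /asboolP.
apply: measurable_fun_ifT => //.
apply: (measurable_fun_bool true); rewrite setTI.
rewrite (_ : _ @^-1` _ = (fun p => convexity f2 (u p)) @^-1` [set 1]).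
  by rewrite -[X in measurable X]setTI; apply: (@convexity_measurable f2 u cu).
by apply/seteqP; split => p /= /eqP.
Qed.

Lemma speed_candidate_le f f2 u M k p : 0 <= M -> `|speed_candidate f f2 u M k p| <= M.
Proof.
move=> M0; rewrite /speed_candidate; case: unpickle => [[q m]|]; last by rewrite normrN ger0_norm.
by case: ifP => [/andP[/andP[]]//|_]; rewrite normrN ger0_norm.
Qed.

Lemma speed_candidate_bound f f2 u M p : 0 <= M ->
  has_sup (range (fun k => speed_candidate f f2 u M k p)).
Proof.
move=> M0; split; first by exists (speed_candidate f f2 u M 0 p); exists 0%N.
exists M => _ [k _ <-]; have := speed_candidate_le f f2 u k p M0.
by rewrite ler_norml => /andP[].
Qed.

Lemma touching_sourceE f f2 u M p :
  touching_source f f2 u M p = sup (range (fun k => speed_candidate f f2 u M k p)).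
Proof. by rewrite /touching_source /sups; congr sup; apply/seteqP; split => _ [k _ <-]; exists k. Qed.

Lemma touching_source_measurable f f2 u M : continuous f -> continuous u -> 0 <= M ->
  measurable_fun setT (touching_source f f2 u M).
Proof.
move=> cf cu M0; apply: measurable_fun_sups.
  by move=> p _; have [_] := speed_candidate_bound f f2 u p M0.
by move=> k; exact: speed_candidate_measurable.
Qed.

Lemma touching_source_le f f2 u M p : 0 <= M -> `|touching_source f f2 u M p| <= M.
Proof.
move=> M0; rewrite touching_sourceE; have [ne ub] := speed_candidate_bound f f2 u p M0.
have h k : - M <= speed_candidate f f2 u M k p <= M by rewrite -ler_norml speed_candidate_le.
rewrite ler_norml; apply/andP; split.
  have /andP[h0 _] := h 0%N; apply: le_trans h0 _.
  by apply: (ub_le_sup ub); exists 0%N.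
by apply: ge_sup => // _ [k _ <-]; have /andP[] := h k.
Qed.

Lemma touching_source_eq f f2 u M p a : 0 <= M -> `|a| <= M ->
  (forall q : rat, ratr q != 0 :> R -> ratr q < a -> exists m, touching f u (convexity f2 (u p)) (ratr q) m p) ->
  (forall q : rat, ratr q != 0 :> R -> a < ratr q -> forall m, ~ touching f u (convexity f2 (u p)) (ratr q) m p) ->
  touching_source f f2 u M p = a.
Proof.
move=> M0; rewrite ler_norml => /andP[Ma aM] below above; rewrite touching_sourceE.
have [ne ub] := speed_candidate_bound f f2 u p M0.
apply/eqP; rewrite eq_le; apply/andP; split.
  apply: ge_sup => // _ [k _ <-]; rewrite /speed_candidate.
  case: unpickle => [[q m]|]//; case: ifP => [/andP[/andP[q0 _] /asboolP tq]|//].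
  by rewrite leNgt; apply/negP => aq; exact: above tq.
rewrite leNgt; apply/negP => /[dup] sa.
have /andP[sM _] : - M <= touching_source f f2 u M p <= M.
  by rewrite -ler_norml; exact: touching_source_le.
rewrite touching_sourceE in sM.
move: sa; set s := sup _ in sM *; move=> sa _.
(* A second rational is taken when the first one happens to be 0. *)
have [q /andP[sq qa] q0] : exists2 q : rat, s < ratr q < a & ratr q != 0 :> R.
  have [q1] := rat_in_itvoo sa; rewrite in_itv/= => /andP[s1 a1].
  have [E|] := eqVneq (ratr q1 : R) 0; last by exists q1; rewrite ?s1.
  have [q2] := rat_in_itvoo a1; rewrite in_itv/= => /andP[s2 a2].
  exists q2; first by rewrite (lt_trans s1 s2).
  by rewrite gt_eqF// -E.
have [m tm] := below q q0 qa.
have : ratr q <= s.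
  apply: (ub_le_sup ub); exists (pickle (q, m)) => //.
  rewrite /speed_candidate pickleK q0/= (asboolT tm) andbT.
  by rewrite ifT// ler_norml (le_trans sM (ltW sq)) (le_trans (ltW qa) aM).
by rewrite leNgt sq.
Qed.

End touching.

(** * Existence and crossing of touching paths *)

Section crossing.
Context {R : realType}.
Implicit Types (f ga lam : R -> R) (u : R * R -> R).
Implicit Types (t s r x y a b d e z w rho M sg ep : R).

Lemma separated_countable (T : set R) rho : 0 < rho ->
  (forall t t', T t -> T t' -> t < t' -> t' - t <= rho -> False) -> countable T.
Proof.
move=> rho0 sep; apply/countable_injP; exists (fun t => pickle (Num.floor (t / rho))).
move=> t t'; rewrite !inE => Tt Tt' /(pcan_inj pickleK) E.
have F x : (Num.floor (x / rho))%:~R * rho <= x < (Num.floor (x / rho))%:~R * rho + rho.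
  have /andP[h1 h2] := Num.Theory.floor_itv (x / rho).
  rewrite -ler_pdivlMr// h1/=; move: h2; rewrite ltr_pdivrMr// intrD mulrDl mul1r.
  by [].
have /andP[h1 h2] := F t; have /andP[h3 h4] := F t'; rewrite -E in h3 h4.
case: (ltgtP t t') => // tt; exfalso.
  by apply: (sep t t') => //; move: h1 h4; set k := _ * _; clear; lra.
by apply: (sep t' t) => //; move: h3 h2; set k := _ * _; clear; lra.
Qed.

Lemma IVT_cont_itv (h : R -> R) a b : a <= b -> cont_itv a b h -> h a <= 0 <= h b ->
  exists2 c, a <= c <= b & h c = 0.
Proof.
move=> ab ch /andP[ha hb].
pose S := [set c | a <= c <= b /\ h c <= 0].
have Sa : S a by rewrite /S/= lexx ab.
have hS : has_sup S by split; [exists a|exists b => c [/andP[]]].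
set c := sup S.
have ac : a <= c by apply: (ub_le_sup hS.2).
have cb : c <= b by apply: ge_sup; [exists a|move=> x [/andP[]]].
have cI : a <= c <= b by rewrite ac.
exists c => //; apply/eqP; rewrite eq_le; apply/andP; split; rewrite leNgt; apply/negP => hc.
  have [d d0 H] := ch c cI _ hc.
  have [x [/andP[ax xb] hx] cx] := sup_adherent d0 hS.
  have xc : x <= c by apply: (ub_le_sup hS.2); rewrite /S/= ax xb.
  have /H : a <= x <= b by rewrite ax.
  have -> : `|x - c| < d by rewrite distrC ger0_norm ?subr_ge0//; move: cx; rewrite -/c; clear; lra.
  by move=> /(_ isT); rewrite ltr_norml => /andP[+ _]; clear -hx hc; lra.
have nhc : 0 < - h c by lra.
have [d d0 H] := ch c cI _ nhc.
have {}cb : c < b.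
  rewrite lt_neqAle cb andbT; apply/eqP => E; move: hc; rewrite E.
  by clear -hb; lra.
pose x := Num.min b (c + d / 2).
have cx : c < x by rewrite /x lt_min cb; clear -d0; lra.
have xb : x <= b by rewrite /x ge_min lexx.
have xd : x <= c + d / 2 by rewrite /x ge_min lexx orbT.
have xI : a <= x <= b by rewrite xb (le_trans ac (ltW cx)).
have := H x xI; rewrite ger0_norm ?subr_ge0 ?(ltW cx)//.
have -> : x - c < d by clear -xd d0; lra.
move=> /(_ isT); rewrite ltr_norml => /andP[_ hx].
have : x <= c by apply: (ub_le_sup hS.2); split => //; clear -hx; lra.
by rewrite leNgt cx.
Qed.

(** The curve and its speed are extended continuously to the whole line, while the differential
    equation is required on [s1, s2] only. *)
Record char_on f1 u ga lam s1 s2 : Prop := CharOn {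
  ch_ga : continuous ga;
  ch_lam : continuous lam;
  ch_der : derives_on s1 s2 ga lam;
  ch_speed : forall t, s1 <= t <= s2 -> lam t = f1 (u (t, ga t)) }.

(** The quotient is a primitive in s of f1 (z + b s), just as ga is a primitive of lam. *)
Lemma level_curve_diff f f1 u ga lam s1 s2 t s b z :
  (forall z, slope_at f z (f1 z)) -> continuous f1 -> char_on f1 u ga lam s1 s2 ->
  b != 0 -> s1 <= t <= s2 -> s1 <= t + s <= s2 ->
  ga (t + s) - ga t - (f (z + b * s) - f z) / b =
  oint (fun r => lam (t + r) - f1 (z + b * r)) 0 s.
Proof.
move=> sf cf1 ch b0 tt ts.
pose F r := ga (t + r) - f (z + b * r) / b.
pose B r := lam (t + r) - f1 (z + b * r).
have cB : continuous B.
  move=> r; apply: cvgB.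
    apply: (@continuous_comp _ _ _ (fun r => t + r) lam); last exact: ch_lam ch _.
    by apply: cvgD; [exact: cvg_cst|exact: cvg_id].
  apply: (@continuous_comp _ _ _ (fun r => z + b * r) f1); last exact: cf1.
  by apply: cvgD; [exact: cvg_cst|apply: cvgM; [exact: cvg_cst|exact: cvg_id]].
have H lo hi : lo <= hi -> s1 <= t + lo -> t + hi <= s2 -> F hi - F lo = oint B lo hi.
  move=> lohi slo shi; apply: oint_of_derivative => // r rr e e0.
  have e20 : 0 < e / 2 by rewrite divr_gt0.
  have tr : s1 <= t + r <= s2 by move: rr => /andP[k1 k2]; apply/andP; split; clear -slo shi k1 k2; lra.
  have [d1 d10 h1] := ch_der ch tr e20.
  have [d2 d20 h2] := sf (z + b * r) _ e20.
  exists (Num.min d1 (d2 / `|b|)); first by rewrite lt_min d10 divr_gt0// normr_gt0.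
  move=> q qq; rewrite lt_min => /andP[q1 q2].
  have tq : s1 <= t + q <= s2 by move: qq => /andP[k1 k2]; apply/andP; split; clear -slo shi k1 k2; lra.
  have E1 : `|ga (t + q) - ga (t + r) - lam (t + r) * (q - r)| <= e / 2 * `|q - r|.
    have := h1 (t + q) tq; rewrite (_ : t + q - (t + r) = q - r); last by clear; lra.
    exact.
  have E2 : `|f (z + b * q) - f (z + b * r) - f1 (z + b * r) * (b * (q - r))|
      <= e / 2 * (`|b| * `|q - r|).
    have := h2 (z + b * q); rewrite (_ : z + b * q - (z + b * r) = b * (q - r)); last by clear; lra.
    rewrite normrM; apply.
    by rewrite mulrC -ltr_pdivlMr// normr_gt0.
  have -> : F q - F r - B r * (q - r) =
     (ga (t + q) - ga (t + r) - lam (t + r) * (q - r)) -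
     (f (z + b * q) - f (z + b * r) - f1 (z + b * r) * (b * (q - r))) / b.
    rewrite [in RHS]mulrBl [in RHS]mulrBl.
    rewrite (_ : f1 (z + b * r) * (b * (q - r)) / b = f1 (z + b * r) * (q - r)).
      by rewrite /F /B; clear; lra.
    by rewrite mulrCA mulrC mulKf.
  apply: le_trans (ler_normB _ _) _; rewrite [leRHS](_ : _ = e / 2 * `|q - r| + e / 2 * `|q - r|).
    2: by rewrite -mulrDl -splitr.
  apply: lerD => //.
  rewrite normrM normfV ler_pdivrMr ?normr_gt0//; apply: le_trans E2 _.
  by rewrite -!mulrA (mulrC `|b|).
have F0 : F s - F 0 = ga (t + s) - ga t - (f (z + b * s) - f z) / b.
  by rewrite /F addr0 mulr0 addr0 mulrBl; clear; lra.
rewrite -F0; move: tt ts => /andP[t1 t2] /andP[ts1 ts2].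
have [s0|/ltW s0] := leP 0 s; first by apply: H; rewrite ?addr0.
by rewrite oint_swap -[oint _ s 0]/(oint B s 0) -H ?addr0// [RHS]opprB.
Qed.

Definition convex_side f1 sg z rho := forall w w', `|w - z| <= rho -> `|w' - z| <= rho ->
  w <= w' -> 0 <= sg * (f1 w' - f1 w).

Lemma convex_side_sign f1 sg z rho w w' k : convex_side f1 sg z rho ->
  `|w - z| <= rho -> `|w' - z| <= rho -> 0 <= k * (w' - w) -> 0 < k -> 0 <= k * (sg * (f1 w' - f1 w)).
Proof. by move=> H ww ww' + k0; rewrite !(pmulr_rge0 _ k0) subr_ge0; exact: H. Qed.

(** Where f' is monotone, comparing u along the curve with z + b r compares the two speeds, hence
    the displacements. The factor s in the hypothesis reverses the comparison backward in time; ep =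
    1 serves to construct touching paths and ep = -1 to exclude them. *)
Lemma level_sign f f1 u ga lam s1 s2 t s b rho sg ep :
  (forall z, slope_at f z (f1 z)) -> continuous f1 -> char_on f1 u ga lam s1 s2 ->
  b != 0 -> s1 <= t <= s2 -> s1 <= t + s <= s2 -> ep = 1 \/ ep = -1 ->
  convex_side f1 sg (u (t, ga t)) rho ->
  (forall r, Num.min 0 s <= r <= Num.max 0 s ->
    [/\ `|u (t + r, ga (t + r)) - u (t, ga t)| <= rho, `|b * r| <= rho &
      0 <= ep * s * (u (t + r, ga (t + r)) - (u (t, ga t) + b * r))]) ->
  0 <= ep * (sg * (ga (t + s) - ga t - (f (u (t, ga t) + b * s) - f (u (t, ga t))) / b)).
Proof.
move=> sf cf1 ch b0 tt ts ep1 side H.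
rewrite (level_curve_diff (u (t, ga t)) sf cf1 ch b0 tt ts); set z := u (t, ga t) in H side *.
pose B r := lam (t + r) - f1 (z + b * r).
have cB : continuous B.
  move=> r; apply: cvgB.
    apply: (@continuous_comp _ _ _ (fun r => t + r) lam); last exact: ch_lam ch _.
    by apply: cvgD; [exact: cvg_cst|exact: cvg_id].
  apply: (@continuous_comp _ _ _ (fun r => z + b * r) f1); last exact: cf1.
  by apply: cvgD; [exact: cvg_cst|apply: cvgM; [exact: cvg_cst|exact: cvg_id]].
rewrite -/B mulrA -ointZ; last exact: continuous_loc_int.
have P r : Num.min 0 s <= r <= Num.max 0 s -> s != 0 -> 0 <= s * (ep * sg * B r).
  move=> rr s0; have [h1 h2 h3] := H r rr; rewrite /B (ch_speed ch); last first.
    move: tt ts rr; rewrite ge_min le_max => /andP[? ?] /andP[? ?] /andP[/orP[?|?] /orP[?|?]];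
      by apply/andP; split; lra.
  set w' := u _ in h1 h3 *.
  have {}h2 : `|z + b * r - z| <= rho by rewrite addrAC subrr add0r.
  set w := z + b * r in h2 h3 *.
  have [k|k|k] := ltgtP (ep * s) 0.
  - have := @convex_side_sign f1 sg z rho w' w (- (ep * s)) side h1 h2.
    by rewrite mulNr -mulrN opprB => /(_ h3); rewrite oppr_gt0 => /(_ k); clear; lra.
  - have := @convex_side_sign f1 sg z rho w w' (ep * s) side h2 h1 h3 k.
    by clear; lra.
  - by exfalso; move: k s0; case: ep1 => ->; rewrite ?mul1r ?mulN1r => /eqP; rewrite ?oppr_eq0 => ->.
have [->|s0] := eqVneq s 0; first by rewrite oint_refl.
have [sp|/ltW sn] := leP 0 s.
  apply: oint_ge0 => // r rr; have := P r; rewrite (min_idPl sp) (max_idPr sp) => /(_ rr s0).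
  by rewrite pmulr_rge0// lt_neqAle eq_sym s0.
rewrite oint_swap -ointN; last by apply: loc_intZ; exact: continuous_loc_int.
apply: oint_ge0 => // r rr; have := P r; rewrite (min_idPr sn) (max_idPl sn) => /(_ rr s0).
by rewrite nmulr_rge0 ?oppr_ge0// lt_neqAle s0.
Qed.

Lemma characteristic_lipschitz f1 u ga lam s1 s2 : char_on f1 u ga lam s1 s2 ->
  exists2 K, 0 < K & forall s t, s1 <= s <= s2 -> s1 <= t <= s2 -> `|ga s - ga t| <= K * `|s - t|.
Proof.
move=> ch.
have [K K0 HK] := @box_bounded _ (fun p => lam p.1) s1 s2 0 0
  (fun p => continuous_comp (@cvg_fst _ _ _ _ _) (@ch_lam f1 u ga lam s1 s2 ch p.1)).
have H s t : s <= t -> s1 <= s -> t <= s2 -> `|ga t - ga s| <= K * `|t - s|.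
  move=> st s1s ts2.
  have -> : ga t - ga s = oint lam s t.
    apply: oint_of_derivative => //; first exact: ch_lam ch.
    move=> r rr e e0; have [|d d0 h] := ch_der ch (t := r) _ e0.
      by move: rr => /andP[? ?]; apply/andP; split; lra.
    exists d => // q qq; apply: h.
    by move: qq => /andP[? ?]; apply/andP; split; lra.
  apply: oint_norm_le; first by apply: continuous_loc_int; exact: ch_lam ch.
  move=> r; rewrite (min_idPl st) (max_idPr st) => /andP[? ?]; apply: (HK r 0); rewrite ?lexx//.
  by apply/andP; split; lra.
exists K => // s t /andP[? ?] /andP[? ?]; have /orP[st|ts] := le_total s t.
  by rewrite distrC (distrC s); exact: H.
exact: H.
Qed.

(** One m supplies both a large Lipschitz constant and a small time span. *)
Lemma exists_small_inv x : exists m, x <= m.+1%:R /\ forall d, 0 < d -> x * d >= 1 -> m.+1%:R^-1 <= d.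
Proof.
have [m xm] : exists m, x <= m.+1%:R.
  exists (Num.bound `|x|); apply: le_trans (ler_norm x) _; apply: ltW.
  by apply: lt_le_trans (archi_boundP (normr_ge0 x)) _; rewrite ler_nat.
exists m; split => // d d0 xd; rewrite -div1r ler_pdivrMr ?ltr0n//.
by apply: le_trans xd _; rewrite mulrC ler_pM2l.
Qed.

(** The touching path is the characteristic itself: its values grow at speed a > b near t, so it
    carries values ahead of z + b s, and by monotonicity of f' it is also ahead of the curve along
    which u would grow at speed b. *)
Lemma touching_of_slope f f1 u ga lam s1 s2 t a b rho sg :
  (forall z, slope_at f z (f1 z)) -> continuous f1 -> char_on f1 u ga lam s1 s2 ->
  b != 0 -> s1 < t < s2 -> 0 < rho -> convex_side f1 sg (u (t, ga t)) rho -> b < a ->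
  slope_at (fun s => u (s, ga s)) t a ->
  exists m, touching f u sg b m (t, ga t).
Proof.
move=> sf cf1 ch b0 /andP[t1 t2] rho0 side ba sl.
have [K K0 HK] := characteristic_lipschitz ch.
have [d1 d10 h1] := sl (a - b) (ltac:(by rewrite subr_gt0)).
have tt : s1 <= t <= s2 by rewrite !ltW.
set z := u (t, ga t) in side *.
(* The slope tolerance a - b is what keeps the increments of u ahead of b s. With it, C |s| bounds
   both these increments and b s, so |s| <= rho / C keeps all values where f' is monotone. *)
pose C := `|a| + (a - b) + `|b| + 1.
have C0 : 0 < C by have := normr_ge0 a; have := normr_ge0 b; rewrite /C; clear -ba; lra.
pose d := Num.min (Num.min d1 (rho / C)) (Num.min (t - s1) (s2 - t)).
have d0 : 0 < d by rewrite /d !lt_min d10 divr_gt0//= !subr_gt0 t1.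
have [m [Km md]] := exists_small_inv (Num.max (K + 1) (2 / d)).
have {}md : m.+1%:R^-1 <= d / 2.
  apply: md; first by rewrite divr_gt0.
  apply: (@le_trans _ _ (2 / d * (d / 2))); first by rewrite mulrA divfK ?gt_eqF// divff.
  by apply: ler_wpM2r; [rewrite divr_ge0// ltW|rewrite le_max lexx orbT].
have {}Km : K + 1 <= m.+1%:R by apply: le_trans Km; rewrite le_max lexx.
set q : R := m.+1%:R^-1 in md *; exists m.
have q0 : 0 < q by rewrite invr_gt0 ltr0n.
have dd s : `|s| <= q -> [/\ `|s| < d1, `|s| * C <= rho & s1 <= t + s <= s2].
  move=> sq; have : `|s| < d by apply: le_lt_trans sq _; apply: le_lt_trans md _; clear -d0; lra.
  rewrite /d !lt_min => /andP[/andP[? sr] /andP[sl1 sl2]]; split => //.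
    by rewrite -ler_pdivlMr// ltW.
  by move: sl1 sl2; rewrite !ltr_norml => /andP[? ?] /andP[? ?]; apply/andP; split; lra.
have vb s : `|s| <= q -> [/\ `|u (t + s, ga (t + s)) - z| <= rho, `|b * s| <= rho &
    0 <= s * (u (t + s, ga (t + s)) - (z + b * s))].
  move=> /dd[sd sr ts]; have := h1 (t + s); rewrite (_ : t + s - t = s); last by clear; lra.
  move=> /(_ sd); set w := u (t + s, _); rewrite -/z => hw; split.
  - apply: le_trans sr; rewrite /C.
    have := ler_normD (w - z - a * s) (a * s); rewrite subrK normrM => hn.
    have p : 0 <= (`|b| + 1) * `|s| by apply: mulr_ge0 => //; have := normr_ge0 b; clear; lra.
    by move: p hw hn; set A := `|w - z - a * s|; clear; lra.
  - apply: le_trans sr; rewrite normrM mulrC ler_wpM2l// /C.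
    by have := normr_ge0 a; clear -ba; lra.
  - move: hw; rewrite ler_norml => /andP[hw1 hw2].
    have [sp|/ltW sn] := leP 0 s.
      apply: mulr_ge0 => //; move: hw1; rewrite ger0_norm//; clear; lra.
    rewrite -mulrNN; apply: mulr_ge0; first by rewrite oppr_ge0.
    by move: hw2; rewrite ler0_norm//; clear; lra.
(* Outside the time span the displacement is set to 0, to remain in [-1, 1]. *)
exists (fun s => if `|s| <= q then ga (t + s) - ga t else 0).
  move=> s /=; rewrite in_itv/=; case: ifP => [sq|_]; last by clear; apply/andP; split; lra.
  rewrite -ler_norml; have [_ _ ts] := dd s sq; apply: le_trans (HK _ _ ts tt) _.
  rewrite (_ : t + s - t = s); last by clear; lra.
  apply: (@le_trans _ _ (m.+1%:R * q)); last by rewrite divff.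
  by apply: ler_pM => //; [exact: ltW|clear -Km; lra].
split; rewrite -/q.
- by rewrite normr0 (ltW q0) addr0 subrr.
- move=> r s rq sq; rewrite rq sq; have [_ _ ts] := dd s sq; have [_ _ tr] := dd r rq.
  rewrite (_ : ga (t + r) - ga t - (ga (t + s) - ga t) = ga (t + r) - ga (t + s)); last by clear; lra.
  apply: le_trans (HK _ _ tr ts) _; rewrite (_ : t + r - (t + s) = r - s); last by clear; lra.
  by rewrite ler_wpM2r//; clear -Km; lra.
- move=> s sq; rewrite sq; have [_ _ ts] := dd s sq.
  have := @level_sign f f1 u ga lam s1 s2 t s b rho sg 1 sf cf1 ch b0 tt ts (or_introl erefl) side.
  rewrite !mul1r; apply => r rr.
  have rs : `|r| <= `|s| by have := ler_dist_between rr; rewrite !subr0.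
  have [h2 h3 h4] := vb r (le_trans rs sq); split => //.
  have [r0|r0] := eqVneq r 0.
    by rewrite r0 !addr0 mulr0 addr0 subrr mulr0.
  move: rr h4; rewrite ge_min le_max => /andP[/orP[?|?] /orP[?|?]].
  + by exfalso; move/eqP: r0; apply; apply: le_anti; apply/andP.
  + have rp : 0 < r by rewrite lt_neqAle eq_sym r0.
    by rewrite (pmulr_rge0 _ rp) pmulr_rge0//; apply: lt_le_trans rp _.
  + have rn : r < 0 by rewrite lt_neqAle r0.
    by rewrite (nmulr_rge0 _ rn) nmulr_rge0//; apply: le_lt_trans rn.
  + by have -> : r = s by apply: le_anti; apply/andP.
- move=> s /andP[sp sq]; have [|_ _] := vb s; first by rewrite ger0_norm.
  rewrite ger0_norm// sq /=.
  rewrite (addrC _ (ga (t + s) - _)) subrK.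
  move: sp; rewrite le_eqVlt => /predU1P[<- _|sp]; first by rewrite mulr0 !addr0.
  by rewrite pmulr_rge0// subr_ge0.
- move=> s /andP[sq sn]; have {}sq : `|s| <= q by rewrite ler0_norm//; clear -sq; lra.
  have [_ _] := vb s sq; rewrite sq /= (addrC _ (ga (t + s) - _)) subrK.
  move: sn; rewrite le_eqVlt => /predU1P[-> _|sn]; first by rewrite mulr0 !addr0.
  by rewrite nmulr_rge0// subr_le0.
Qed.

(** Since u grows along ga no faster than b' < b, the path from t is ahead of ga at time t', and the
    path from t', followed backward, is ahead of ga at time t. So the two paths meet at some time t
    + c. There u is at least its value at t plus b c by the first path, and at most its value at t'
    minus b (t' - t - c) by the second. Hence u grows by at least b (t' - t) along ga, a
    contradiction. *)
Lemma touching_separated f f1 u ga lam s1 s2 t t' b b' m rho sg :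
  (forall z, slope_at f z (f1 z)) -> continuous f1 -> char_on f1 u ga lam s1 s2 ->
  b != 0 -> s1 <= t -> t < t' -> t' <= s2 -> t' - t <= m.+1%:R^-1 -> b' < b -> sg = 1 \/ sg = -1 ->
  convex_side f1 sg (u (t, ga t)) rho -> convex_side f1 sg (u (t', ga t')) rho ->
  (forall s, t <= s <= t' -> `|u (s, ga s) - u (t, ga t)| <= rho /\ `|u (s, ga s) - u (t', ga t')| <= rho) ->
  `|b| * (t' - t) <= rho ->
  (forall s, t <= s <= t' -> u (s, ga s) - u (t, ga t) <= b' * (s - t)) ->
  (forall s, t <= s <= t' -> u (t', ga t') - u (s, ga s) <= b' * (t' - s)) ->
  touching f u sg b m (t, ga t) -> touching f u sg b m (t', ga t') -> False.
Proof.
move=> sf cf1 ch b0 s1t tt' t's2 ttm bb sg1 side side' near brho sl sl'.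
set D := t' - t in ttm brho *; have D0 : 0 < D by rewrite subr_gt0.
move=> [eta eta1 [h0 h1 h2 h3 h4]] [eta' eta1' [h0' h1' h2' h3' h4']].
set rhom := _^-1 in ttm h1 h2 h3 h4 h1' h2' h3' h4'.
have tD : t + D = t' by rewrite /D; clear; lra.
have tD' : t' + - D = t by rewrite /D; clear; lra.
have tI : s1 <= t <= s2 by apply/andP; split; clear -s1t tt' t's2; lra.
have tI' : s1 <= t' <= s2 by apply/andP; split; clear -s1t tt' t's2; lra.
have I1 : s1 <= t + D <= s2 by rewrite tD.
have I2 : s1 <= t' + - D <= s2 by rewrite tD'.
have L1 := @level_sign f f1 u ga lam s1 s2 t D b rho sg (-1) sf cf1 ch b0 tI I1 (or_intror erefl) side.
have L2 := @level_sign f f1 u ga lam s1 s2 t' (- D) b rho sg (-1) sf cf1 ch b0 tI' I2 (or_intror erefl) side'.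
have bD r : 0 <= r <= D -> `|b * r| <= rho.
  move=> /andP[r0 rD]; apply: le_trans brho; rewrite normrM ler_wpM2l//.
  by rewrite ger0_norm.
have {}L1 : 0 <= sg * (eta D + ga t - ga t').
  have : 0 <= -1 * (sg * (ga (t + D) - ga t - (f (u (t, ga t) + b * D) - f (u (t, ga t))) / b)).
    apply: L1 => r; rewrite (min_idPl (ltW D0)) (max_idPr (ltW D0)) => rr.
    have tr : t <= t + r <= t' by move: rr => /andP[k1 k2]; apply/andP; split; rewrite -?tD; clear -k1 k2; lra.
    have [n1 n2] := near _ tr; split => //; first exact: bD.
    have := sl _ tr; move: rr => /andP[r0 rD].
    rewrite (_ : t + r - t = r); last by clear; lra.
    move=> hs; have : b' * r <= b * r by rewrite ler_wpM2r// ltW.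
    rewrite mulN1r mulNr -mulrN opprB => hb; apply: mulr_ge0; first exact: ltW.
    by move: hs hb; clear; lra.
  have := h2 D; rewrite (ger0_norm (ltW D0)) => /(_ ttm); rewrite tD /=.
  by set k := _ / b; clear; lra.
have {}L2 : 0 <= sg * (eta' (- D) + ga t' - ga t).
  have : 0 <= -1 * (sg * (ga (t' - D) - ga t' - (f (u (t', ga t') + b * (- D)) - f (u (t', ga t'))) / b)).
    have D0' : - D <= 0 by rewrite oppr_le0 ltW.
    apply: L2 => r; rewrite (min_idPr D0') (max_idPl D0') => rr.
    have tr : t <= t' + r <= t' by move: rr => /andP[k1 k2]; apply/andP; split; rewrite -?tD'; clear -k1 k2; lra.
    have [n1 n2] := near _ tr; split => //.
      by rewrite -normrN -mulrN; apply: bD; move: rr => /andP[? ?]; apply/andP; split; lra.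
    have := sl' _ tr; move: rr => /andP[rD r0].
    rewrite (_ : t' - (t' + r) = - r); last by clear; lra.
    move=> hs; have : b' * (- r) <= b * (- r) by rewrite ler_wpM2r ?oppr_ge0// ltW.
    rewrite mulN1r opprK => hb; apply: mulr_ge0; first exact: ltW.
    by move: hs hb; clear; lra.
  have := h2' (- D); rewrite normrN (ger0_norm (ltW D0)) => /(_ ttm); rewrite tD' /=.
  by set k := _ / b; clear; lra.
pose h s := sg * (ga t + eta s - (ga t' + eta' (s - D))).
have ch' : cont_itv 0 D h.
  have nsg : `|sg| = 1 by case: sg1 => ->; rewrite ?normrN normr1.
  apply: (lipschitz_cont_itv (k := m.+1%:R + m.+1%:R)) => r s /andP[r0 rD] /andP[s0 sD].
  rewrite /h -mulrBr normrM nsg mul1r.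
  have e1 : `|eta r - eta s| <= m.+1%:R * `|r - s|.
    by apply: h1; rewrite ger0_norm//; [apply: le_trans rD _|apply: le_trans sD _].
  have e2 : `|eta' (r - D) - eta' (s - D)| <= m.+1%:R * `|r - s|.
    have := h1' (r - D) (s - D); rewrite (_ : r - D - (s - D) = r - s); last by clear; lra.
    apply; rewrite ler0_norm ?subr_le0// opprB; apply: le_trans ttm; clear -r0 s0; lra.
  rewrite (_ : ga t + eta r - (ga t' + eta' (r - D)) - (ga t + eta s - (ga t' + eta' (s - D))) =
    (eta r - eta s) - (eta' (r - D) - eta' (s - D))); last by clear; lra.
  apply: le_trans (ler_normB _ _) _; rewrite mulrDl; exact: lerD.
have hI : h 0 <= 0 <= h D.
  rewrite /h subrr h0' h0 sub0r !addr0; apply/andP; split.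
    rewrite (_ : sg * _ = - (sg * (eta' (- D) + ga t' - ga t))) ?oppr_le0//.
    by rewrite -mulrN; congr (_ * _); clear; lra.
  by move: L1; rewrite (addrC (eta _)).
have [c /andP[c0 cD] /eqP] := IVT_cont_itv (ltW D0) ch' hI.
rewrite /h mulf_eq0; case/orP => [/eqP E|]; first by case: sg1 => E1; move: E; rewrite E1 => E2; clear -E2; exfalso; lra.
rewrite subr_eq0 => /eqP E.
have := h3 c; rewrite c0 (le_trans cD ttm) => /(_ isT) /=; rewrite E.
have := h4' (c - D); have -> : - rhom <= c - D <= 0 by apply/andP; split; clear -c0 cD ttm; lra.
move=> /(_ isT) /=; rewrite (_ : t' + (c - D) = t + c); last by rewrite /D; clear; lra.
move=> /[swap] /le_trans/[apply].
have := sl t'; rewrite lexx (ltW tt') => /(_ isT); rewrite -/D.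
have : b' * D < b * D by rewrite ltr_pM2r.
by rewrite mulrBr; clear; lra.
Qed.

Lemma slope_le_lipschitz (v : R -> R) t a M d : 0 < d -> slope_at v t a ->
  (forall s, `|s - t| < d -> `|v s - v t| <= M * `|s - t|) -> `|a| <= M.
Proof.
move=> d0 sl lip; rewrite leNgt; apply/negP => aM.
have e0 : 0 < (`|a| - M) / 2 by rewrite divr_gt0// subr_gt0.
have [d' d'0 h] := sl _ e0.
pose k := Num.min d d' / 2; have k0 : 0 < k by rewrite /k divr_gt0// lt_min d0.
have kd : k < Num.min d d' by rewrite /k gtr_pMr ?lt_min ?d0// invf_lt1//; clear; lra.
move: kd; rewrite lt_min => /andP[kd kd'].
have E : t + k - t = k by clear; lra.
have := lip (t + k); rewrite E (gtr0_norm k0) => /(_ kd) h1.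
have := h (t + k); rewrite E (gtr0_norm k0) => /(_ kd') h2.
have := ler_normB (v (t + k) - v t) (v (t + k) - v t - a * k).
rewrite (_ : _ - (_ - a * k) = a * k); last by clear; lra.
rewrite normrM (gtr0_norm k0) => h3.
have : `|a| * k <= M * k + (`|a| - M) / 2 * k by apply: le_trans h3 _; exact: lerD.
by rewrite -mulrDl ler_pM2r//; clear -aM; lra.
Qed.

End crossing.

(** * Local sign conditions on the flux *)

Section C2_flux.
Context {R : realType}.
Implicit Types (f : R -> R) (z w e sg : R).

Lemma derivable_slope (F : R -> R) z : derivable F z 1 -> slope_at F z (derive1 F z).
Proof.
move=> dF e e0.
have : h^-1 *: (F (h + z) - F z) @[h --> 0^'] --> derive1 F z.
  have /cvg_ex[l Fl] := dF; rewrite derive1E /derive.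
  have -> : lim (h^-1 *: ((F \o shift z) (h *: 1) - F z) @[h --> 0^']) = l.
    exact: (cvg_lim (@Rhausdorff R) Fl).
  apply: cvg_trans Fl; apply: near_eq_cvg; near=> h; by rewrite /= [h *: 1]mulr1.
move=> /cvgrPdist_lt/(_ e e0) => /nbhs_ballP[d /= d0 df].
exists d => // y yd.
have [->|yx] := eqVneq y z; first by rewrite !subrr mulr0 subrr normr0 mulr0.
have yx0 : y - z != 0 by rewrite subr_eq0.
have /df : ball (0 : R) d (y - z) by rewrite /ball/= sub0r normrN.
move=> /(_ yx0); rewrite subrK => H.
have yxp : 0 < `|y - z| by rewrite normr_gt0.
rewrite -ler_pdivrMr// -normfV -normrM mulrBl mulfK// distrC.
by move: (ltW H); rewrite /GRing.scale/= mulrC.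
Unshelve. all: by end_near. Qed.

Lemma mean_value (F : R -> R) z w : (forall z, derivable F z 1) ->
  exists2 c, Num.min z w <= c <= Num.max z w & F w - F z = derive1 F c * (w - z).
Proof.
move=> dF.
have H a b : a < b -> exists2 c, a <= c <= b & F b - F a = derive1 F c * (b - a).
  move=> ab; have dv x : x \in `]a, b[ -> is_derive x 1 F (derive1 F x).
    by move=> _; rewrite derive1E; apply: derivableP.
  have cF : {within `[a, b], continuous F}.
    by apply: derivable_within_continuous => x _.
  by have [c + ->] := MVT ab dv cF; rewrite in_itv/= => /andP[/ltW ac /ltW cb]; exists c; rewrite ?ac.
have [zw|wz|<-] := ltgtP z w; last by exists z; rewrite ?lexx// !subrr mulr0.
  exact: H.
have [c cc E] := H _ _ wz; exists c => //.
by apply: oppr_inj; rewrite opprB E -mulrN opprB.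
Qed.

Lemma C2_slope f z : C2 f -> slope_at f z (derive1 f z).
Proof. by case=> d1 _ _; exact: (@derivable_slope f z (d1 z)). Qed.

Lemma C2_continuous1 f : C2 f -> continuous (derive1 f).
Proof. by case=> _ d2 _ z; apply: differentiable_continuous; exact/derivable1_diffP. Qed.

Lemma C2_continuous f : C2 f -> continuous f.
Proof. by case=> d1 _ _ z; apply: differentiable_continuous; exact/derivable1_diffP. Qed.

Lemma derive1_monotone_side f sg z e w w' : C2 f ->
  (forall y, `|y - z| < e -> 0 <= sg * derive1n 2 f y) ->
  `|w - z| < e -> `|w' - z| < e -> 0 <= sg * (derive1 f w' - derive1 f w) * (w' - w).
Proof.
move=> [d1 d2 _] H wz w'z; have [c cc ->] := mean_value w w' d2.
rewrite mulrA -mulrA; apply: mulr_ge0; last by rewrite -expr2 sqr_ge0.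
apply: H; move: cc wz w'z; rewrite ge_min le_max !ltr_norml.
by move=> /andP[/orP[?|?] /orP[?|?]] /andP[? ?] /andP[? ?]; apply/andP; split; lra.
Qed.

Lemma C2_convex_side f sg z e y : C2 f ->
  (forall y, `|y - z| < e -> 0 <= sg * derive1n 2 f y) -> `|y - z| < e / 2 ->
  convex_side (derive1 f) sg y (e / 4).
Proof.
move=> f_C2 H yz w w' wy w'y; rewrite le_eqVlt => /predU1P[->|ww]; first by rewrite subrr mulr0.
have h x : `|x - y| <= e / 4 -> `|x - z| < e.
  move=> xy; have e0 : 0 < e by have := normr_ge0 (y - z); clear -yz; lra.
  rewrite (_ : x - z = x - y + (y - z)); last by clear; lra.
  by apply: le_lt_trans (ler_normD _ _) _; clear -xy yz e0; lra.
have := derive1_monotone_side f_C2 H (h w wy) (h w' w'y).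
by rewrite pmulr_lge0// subr_gt0.
Qed.

Lemma C2_tangent f sg z e y w : C2 f ->
  (forall y, `|y - z| < e -> 0 <= sg * derive1n 2 f y) -> `|y - z| < e / 2 -> `|w - y| < e / 2 ->
  0 <= sg * (f w - f y - derive1 f y * (w - y)).
Proof.
move=> f_C2 H yz wy; have [d1 _ _] := f_C2.
have e0 : 0 < e by have := normr_ge0 (y - z); clear -yz; lra.
have [c cc ->] := mean_value y w d1; rewrite -mulrBl mulrA.
have cy : `|c - y| <= `|w - y| by exact: ler_dist_between.
have cz : `|c - z| < e.
  rewrite (_ : c - z = c - y + (y - z)); last by clear; lra.
  by apply: le_lt_trans (ler_normD _ _) _; clear -cy wy yz; lra.
have yz' : `|y - z| < e by clear -yz e0; lra.
have M := derive1_monotone_side f_C2 H yz' cz.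
move: cc; have [yw|wy'|<-] := ltgtP y w; last by rewrite subrr mulr0.
  move=> /andP[+ _]; rewrite le_eqVlt => /predU1P[<-|yc]; first by rewrite subrr mulr0 mul0r.
  have cy0 : 0 < c - y by rewrite subr_gt0.
  have wy0 : 0 < w - y by rewrite subr_gt0.
  by move: M; rewrite (pmulr_lge0 _ cy0) (pmulr_lge0 _ wy0).
move=> /andP[_]; rewrite le_eqVlt => /predU1P[->|yc]; first by rewrite subrr mulr0 mul0r.
have cy0 : c - y < 0 by rewrite subr_lt0.
have wy0 : w - y < 0 by rewrite subr_lt0.
by move: M; rewrite (nmulr_lge0 _ cy0) (nmulr_lge0 _ wy0).
Qed.

Lemma convexity_pm (f2 : R -> R) z : convexity f2 z = 1 \/ convexity f2 z = -1.
Proof. by rewrite /convexity; case: ifP => _; [left|right]. Qed.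

(** The recorded sign may differ from sg when f is affine near z; it is 1 whenever that is possible,
    so if it is -1 then sg is -1 as well. *)
Lemma convexity_side f sg z e : C2 f -> sg = 1 \/ sg = -1 -> 0 < e ->
  (forall y, `|y - z| < e -> 0 <= sg * derive1n 2 f y) ->
  exists2 rho, 0 < rho & convex_side (derive1 f) (convexity (derive1n 2 f) z) z rho.
Proof.
move=> f_C2 sg1 e0 H; rewrite /convexity; case: ifPn => [/asboolP[d d0 Hd]|/asboolPn N].
  exists (d / 4); first by rewrite divr_gt0.
  apply: (C2_convex_side (z := z)) => //; last by rewrite subrr normr0 divr_gt0.
  by move=> y yz; rewrite mul1r; exact: Hd.
case: sg1 H => -> H.
  by exfalso; apply: N; exists e => // w /H; rewrite mul1r.
exists (e / 4); first by rewrite divr_gt0.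
by apply: (C2_convex_side (z := z)) => //; rewrite subrr normr0 divr_gt0.
Qed.

End C2_flux.

Section clamp.
Context {R : realType}.
Implicit Types s t a b : R.

Definition clamp a b t := Num.max a (Num.min t b).

Lemma clamp_itv a b t : a <= b -> a <= clamp a b t <= b.
Proof. by move=> ab; rewrite /clamp le_max lexx ge_max ab ge_min lexx orbT. Qed.

Lemma clampE a b t : a <= t <= b -> clamp a b t = t.
Proof. by move=> /andP[ta tb]; rewrite /clamp (min_idPl tb) (max_idPr ta). Qed.

Lemma clamp_lipschitz a b s t : `|clamp a b t - clamp a b s| <= `|t - s|.
Proof.
have min1 x y : x <= y -> 0 <= Num.min y b - Num.min x b <= y - x.
  move=> xy; rewrite /Num.min; case: (ltP y b) => ?; case: (ltP x b) => ?;
    by apply/andP; split; lra.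
have max1 x y : x <= y -> 0 <= Num.max a y - Num.max a x <= y - x.
  move=> xy; rewrite /Num.max; case: (ltP a y) => ?; case: (ltP a x) => ?;
    by apply/andP; split; lra.
have H x y : x <= y -> 0 <= clamp a b y - clamp a b x <= y - x.
  move=> xy; have /andP[m0 m1] := min1 _ _ xy.
  have /andP[M0 M1] := max1 (Num.min x b) (Num.min y b) (ltac:(by rewrite -subr_ge0)).
  by rewrite M0 (le_trans M1).
have /orP[st|ts] := le_total s t.
  by have /andP[? ?] := H _ _ st; rewrite !ger0_norm ?subr_ge0// -subr_ge0.
by have /andP[? ?] := H _ _ ts; rewrite distrC (distrC t) !ger0_norm ?subr_ge0// -subr_ge0.
Qed.

End clamp.

(** * The derivative of u along a characteristic, off the inflection set *)

Section local_primitive.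
Context {R : realType}.
Let mu := @lebesgue_measure R.
Implicit Types (f ga lam : R -> R) (u g : R * R -> R) (Z : R * R -> bool).
Implicit Types (t s x y a b d e h M K sg rho : R).

(** Speeds below the slope a are always touching. A time is bad if some rational speed q above a
    still is; a rational q' between a and q and a common modulus n then bound the growth of u near
    that time. For fixed q, q', n and sign, two bad times cannot be close, so the bad times are
    countable. *)
Lemma touching_source_characteristic f u M ga lam s1 s2 : C2 f ->
  char_on (derive1 f) u ga lam s1 s2 -> 0 <= M ->
  (forall s t, s1 <= s <= s2 -> s1 <= t <= s2 -> `|u (s, ga s) - u (t, ga t)| <= M * `|s - t|) ->
  (forall t, s1 <= t <= s2 -> exists2 rho, 0 < rho &
    convex_side (derive1 f) (convexity (derive1n 2 f) (u (t, ga t))) (u (t, ga t)) rho) ->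
  exists2 C : set R, countable C & forall t a, s1 < t < s2 -> ~ C t ->
    slope_at (fun s => u (s, ga s)) t a ->
    touching_source f (derive1n 2 f) u M (t, ga t) = a.
Proof.
move=> f_C2 ch M0 lip sides.
have sf := fun z => @C2_slope R f z f_C2; have cf1 := C2_continuous1 f_C2.
set f2 := derive1n 2 f; pose v t := u (t, ga t).
(* The boolean fixes the sign of convexity, so that two times of one class have paths comparable on
   the same side. The radius (M + |q|) / (m + 1) covers the variation of u and of q s within the
   time span. *)
pose T (i : bool * rat * rat * nat) : set R := [set t | let: (o, q, q', m) := i in
  [/\ s1 < t < s2 /\ (convexity f2 (v t) == 1) = o, ratr q != 0 :> R, ratr q' < ratr q :> R,
    touching f u (convexity f2 (v t)) (ratr q) m (t, ga t) &
    convex_side (derive1 f) (convexity f2 (v t)) (v t) ((M + `|ratr q|) / m.+1%:R) /\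
    forall s, s1 <= s <= s2 -> `|s - t| <= m.+1%:R^-1 ->
      (t <= s -> v s - v t <= ratr q' * (s - t)) /\ (s <= t -> v t - v s <= ratr q' * (t - s))]].
exists (\bigcup_i T i).
  apply: bigcup_countable => [|i _]; first exact: countableP.
  move: i => [] [] [] o q q' m.
  have m0 : 0 < m.+1%:R^-1 :> R by rewrite invr_gt0.
  apply: (separated_countable m0) => t t' [[tI ct] q0 qq tc [side sl]].
  move=> [[tI' ct'] _ _ tc' [side' sl']] tt tm.
  have cE : convexity f2 (v t') = convexity f2 (v t).
    have N : (-1 == 1 :> R) = false by apply/eqP; lra.
    by move: ct ct'; have [->|->] := convexity_pm f2 (v t); have [->|->] := convexity_pm f2 (v t');
      rewrite // ?eqxx ?N => <-.
  rewrite cE in side' tc'.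
  move: tI tI' => /andP[t1 t2] /andP[t1' t2'].
  apply: (@touching_separated R f (derive1 f) u ga lam s1 s2 t t' (ratr q) (ratr q') m _ _
    sf cf1 ch q0 (ltW t1) tt (ltW t2') tm qq (convexity_pm f2 (v t)) side side') => //.
  - move=> s /andP[ts st'].
    have sI : s1 <= s <= s2 by apply/andP; split; [clear -ts t1|clear -st' t2']; lra.
    have tI : s1 <= t <= s2 by apply/andP; split; apply: ltW.
    have tI' : s1 <= t' <= s2 by apply/andP; split; apply: ltW.
    have bnd x : x <= m.+1%:R^-1 -> M * x <= (M + `|ratr q|) / m.+1%:R.
      move=> xm; apply: (@le_trans _ _ (M / m.+1%:R)); first by rewrite ler_wpM2l.
      by rewrite ler_pM2r// lerDl.
    split.
      apply: le_trans (lip _ _ sI tI) _; rewrite [`|s - t|]ger0_norm ?subr_ge0//; apply: bnd.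
      by apply: le_trans tm; rewrite lerD2r.
    apply: le_trans (lip _ _ sI tI') _; rewrite [`|s - t'|]distrC [`|t' - s|]ger0_norm ?subr_ge0//; apply: bnd.
    by apply: le_trans tm; rewrite lerD2l lerN2.
  - apply: (@le_trans _ _ (`|ratr q| / m.+1%:R)); first by rewrite ler_wpM2l.
    by rewrite ler_pM2r// lerDr.
  - move=> s /andP[ts st']; apply: (proj1 (sl s _ _)) => //.
      by apply/andP; split; [clear -ts t1|clear -st' t2']; lra.
    by rewrite ger0_norm ?subr_ge0//; apply: le_trans tm; rewrite lerD2r.
  - move=> s /andP[ts st']; apply: (proj2 (sl' s _ _)) => //.
      by apply/andP; split; [clear -ts t1|clear -st' t2']; lra.
    by rewrite distrC ger0_norm ?subr_ge0//; apply: le_trans tm; rewrite lerD2l lerN2.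
move=> t a tI nC sla.
have tcc : s1 <= t <= s2 by move: tI => /andP[/ltW -> /ltW ->].
have [t1 t2] := andP tI.
have [rho rho0 side] := sides t tcc.
have aM : `|a| <= M.
  apply: (@slope_le_lipschitz _ v t a M (Num.min (t - s1) (s2 - t))) => //.
    by rewrite lt_min !subr_gt0 t1.
  move=> s; rewrite lt_min !ltr_norml => /andP[/andP[? ?] /andP[? ?]].
  by apply: lip => //; apply/andP; split; lra.
apply: touching_source_eq => // q q0 qa.
  exact: (touching_of_slope sf cf1 ch q0 tI rho0 side qa sla).
move=> m tc; apply: nC.
have [q'] := rat_in_itvoo qa; rewrite in_itv/= => /andP[aq' q'q].
have [d d0 hd] := sla (ratr q' - a) (ltac:(by rewrite subr_gt0)).
pose L := M + `|ratr q| + 1; have L0 : 0 < L by rewrite /L; have := normr_ge0 (ratr q : R); clear -M0; lra.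
pose dd := Num.min (d / 2) (rho / L).
have dd0 : 0 < dd by rewrite /dd lt_min !divr_gt0.
have [m' [_ m'd]] := exists_small_inv (dd^-1).
have {}m'd := m'd dd dd0; rewrite mulVf ?gt_eqF// lexx in m'd; have {}m'd := m'd isT.
(* Larger than the index of the touching path, and large enough for the slope and monotonicity
   estimates to hold within 1 / (n + 1). *)
pose n := maxn m m'; have nm' : n.+1%:R^-1 <= dd.
  by apply: le_trans m'd; rewrite lef_pV2 ?posrE ?ltr0n// ler_nat ltnS leq_maxr.
have [nd nr] : n.+1%:R^-1 <= d / 2 /\ n.+1%:R^-1 * L <= rho.
  by move: nm'; rewrite /dd le_min => /andP[-> ?]; rewrite -ler_pdivlMr.
exists (convexity f2 (v t) == 1, q, q', n) => //; split => //.
- by apply: touching_mono tc; rewrite leq_maxl.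
- split.
    move=> w w' wt w't; apply: side; [apply: le_trans wt _|apply: le_trans w't _];
    apply: le_trans nr; rewrite mulrC ler_wpM2l ?invr_ge0// /L lerDl//.
  move=> s sI sn; have sd : `|s - t| < d.
    by apply: le_lt_trans sn _; apply: le_lt_trans nd _; clear -d0; lra.
  have := hd s sd; rewrite -/(v s) -/(v t) ler_norml => /andP[h1 h2]; split => st.
    by move: h2; rewrite ger0_norm ?subr_ge0//; clear; lra.
  by move: h1; rewrite distrC ger0_norm ?subr_ge0//; clear; lra.
Qed.

Lemma eq_oint_ae (F G : R -> R) s1 s2 : s1 <= s2 ->
  measurable_fun setT F -> measurable_fun setT G ->
  {ae mu, forall x, s1 < x < s2 -> F x = G x} -> oint F s1 s2 = oint G s1 s2.
Proof.
move=> s12 mF mG H; rewrite !ointE// /Rintegral; congr fine.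
have pt (x : R) : {ae mu, forall y, y <> x}.
  exists [set x]; split; [exact: measurable_set1|exact: lebesgue_measure_set1|].
  by move=> y /= /contrapT.
apply: ae_eq_integral => //.
- by apply: measurable_funTS; exact/measurable_EFinP.
- by apply: measurable_funTS; exact/measurable_EFinP.
have FF := ae_filter_ringOfSetsType mu.
have := @filterI _ _ FF _ _ H (@filterI _ _ FF _ _ (pt s1) (pt s2)).
apply: (@filterS _ _ FF).
move=> x [h [/= x1 x2]].
rewrite in_itv/= => /andP[sx xs]; congr EFin; apply: h.
by rewrite !lt_neqAle sx xs !andbT; apply/andP; split; apply/eqP => E; [apply: x1|apply: x2]; rewrite E.
Qed.

(* On [Z] the two one-sided difference quotients of the source need not have a
   limit, and only the trivial bounds are kept there. *)
Lemma characteristic_primitive_local f u g M ga lam s1 s2 sg Z : C2 f ->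
  rect_balance f u (srcG g) M -> bdd2 g M -> char_on (derive1 f) u ga lam s1 s2 -> s1 <= s2 ->
  sg = 1 \/ sg = -1 -> tangent_side f u ga lam sg s1 s2 ->
  (forall t, s1 <= t <= s2 -> exists2 rho, 0 < rho &
    convex_side (derive1 f) (convexity (derive1n 2 f) (u (t, ga t))) (u (t, ga t)) rho) ->
  measurable_fun setT Z ->
  (forall p, ~~ Z p -> source_quotient g n.+1%:R^-1 p @[n --> \oo] --> g p /\
    source_quotient g (- n.+1%:R^-1) p @[n --> \oo] --> g p) ->
  u (s2, ga s2) - u (s1, ga s1) = oint (fun t =>
    if Z (t, ga t) then touching_source f (derive1n 2 f) u M (t, ga t) else g (t, ga t)) s1 s2.
Proof.
move=> f_C2 B bg ch s12 sg1 tan sides mZ offZ; have M0 := rb_ge0 B; have cu := rb_cont B.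
have cga := ch_ga ch; have clam := ch_lam ch; have cf := rb_flux B.
pose v t := u (t, ga t).
pose lower t := if Z (t, ga t) then - M else g (t, ga t).
pose upper t := if Z (t, ga t) then M else g (t, ga t).
have bounds s t : s1 <= s -> s <= t -> t <= s2 -> oint lower s t <= v t - v s <= oint upper s t.
  move=> s1s st ts2; apply: (characteristic_bounds (lam := lam) (sg := sg) B bg cga clam st) => //.
    move=> r /andP[sr rt] e e0; have [|d d0 h] := ch_der ch (t := r) _ e0.
      by apply/andP; split; lra.
    by exists d => // q /andP[sq qt]; apply: h; apply/andP; split; lra.
  have [eta eta0 h] := tan; exists eta => // r w /andP[sr rt]; apply: h.
  by apply/andP; split; lra.
have mcurve (h1 h2 : R * R -> R) : measurable_fun setT h1 -> measurable_fun setT h2 ->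
    measurable_fun setT (fun t => if Z (t, ga t) then h1 (t, ga t) else h2 (t, ga t)).
  move=> m1 m2; apply: (@curve_measurable _ _ _ (fun p => if Z p then h1 p else h2 p)) => //.
  exact: measurable_fun_ifT.
have [mg gM] := bg.
have mlower : measurable_fun setT lower by apply: (@mcurve (fun=> - M) g) => //; exact: measurable_cst.
have mupper : measurable_fun setT upper by apply: (@mcurve (fun=> M) g) => //; exact: measurable_cst.
have lowerM t : `|lower t| <= M by rewrite /lower; case: ifP => // _; rewrite normrN ger0_norm.
have upperM t : `|upper t| <= M by rewrite /upper; case: ifP => // _; rewrite ger0_norm.
have lipw s t : s1 <= s -> s <= t -> t <= s2 -> `|v t - v s| <= M * (t - s).
  move=> s1s st ts2; have /andP[lo up] := bounds s t s1s st ts2.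
  have l1 := oint_norm_le (bounded_loc_int mlower lowerM) (a := s) (b := t) (fun x _ => lowerM x).
  have l2 := oint_norm_le (bounded_loc_int mupper upperM) (a := s) (b := t) (fun x _ => upperM x).
  move: l1 l2; rewrite (ger0_norm (_ : 0 <= t - s)) ?subr_ge0// !ler_norml.
  move=> /andP[l1 _] /andP[_ l2]; apply/andP; split.
    exact: le_trans lo.
  exact: le_trans up _.
have lip s t : s1 <= s <= s2 -> s1 <= t <= s2 -> `|v s - v t| <= M * `|s - t|.
  move=> /andP[? ?] /andP[? ?]; have /orP[st|ts] := le_total s t.
    by rewrite distrC [`|s - t|]distrC [`|t - s|]ger0_norm ?subr_ge0//; exact: lipw.
  by rewrite [`|s - t|]ger0_norm ?subr_ge0//; exact: lipw.
have [C cC HC] := touching_source_characteristic f_C2 ch M0 lip sides.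
have clampI t := clamp_itv t s12; have clamp_id := @clampE _ s1 s2.
have vlip s t : `|v (clamp s1 s2 t) - v (clamp s1 s2 s)| <= M * `|t - s|.
  by apply: le_trans (lip _ _ (clampI t) (clampI s)) _; rewrite ler_wpM2l// clamp_lipschitz.
(* It remains to identify the density k almost everywhere. At times where k is the derivative of v,
   it equals the touching source on [Z] up to countably many times; off [Z] it is squeezed between
   [lower] and [upper], which both equal g there. *)
have [k [mk [K kK] Hk]] := lipschitz_integral vlip s12.
have vk s t : s1 <= s <= s2 -> s1 <= t <= s2 -> v t - v s = oint k s t.
  move=> sI tI; have := Hk; move: (sI) (tI) => /andP[s1s ss2] /andP[s1t ts2] H.
  have /orP[st|ts] := le_total s t.
    by have := H s t s1s st ts2; rewrite !clamp_id.
  by have := H t s s1t ts ss2; rewrite !clamp_id// => E; rewrite oint_swap -E opprB.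
rewrite -/(v s2) -/(v s1) vk ?lexx ?s12//.
apply: eq_oint_ae => //.
  apply: (@mcurve (touching_source f (derive1n 2 f) u M) g) => //.
  exact: touching_source_measurable.
have FF := ae_filter_ringOfSetsType mu.
have nC : {ae mu, forall t, ~ C t}.
  exists C; split; [exact: countable_measurable|exact: countable_lebesgue_measure0|].
  by move=> t /= /contrapT.
have dk := ae_oint_deriv mk kK; have dl := ae_oint_deriv mlower lowerM.
have du := ae_oint_deriv mupper upperM.
have := @filterI _ _ FF _ _ (@filterI _ _ FF _ _ nC dk) (@filterI _ _ FF _ _ dl du).
apply: (@filterS _ _ FF).
move=> t [[/= Ct kt] [lt ut]] tI.
have [t1 t2] := andP tI.
have tcc : s1 <= t <= s2 by rewrite !ltW.
have slk : slope_at v t (k t).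
  move=> e e0; have [d d0 h] := kt e e0.
  exists (Num.min d (Num.min (t - s1) (s2 - t))); first by rewrite !lt_min d0 !subr_gt0 t1.
  move=> s; rewrite !lt_min => /andP[sd]; rewrite !ltr_norml => /andP[/andP[? ?] /andP[? ?]].
  by rewrite vk//; [exact: h|apply/andP; split; lra].
case: ifPn => Zt; first by rewrite (HC t (k t) tI Ct slk).
have E1 : lower t = g (t, ga t) by rewrite /lower (negbTE Zt).
have E2 : upper t = g (t, ga t) by rewrite /upper (negbTE Zt).
apply/eqP; rewrite eq_le; apply/andP; split; apply/ler_addgt0Pr => e e0.
  have e20 : 0 < e / 2 by rewrite divr_gt0.
  have [d1 d10 h1] := slk _ e20; have [d2 d20 h2] := ut _ e20.
  pose h := Num.min (Num.min d1 d2) (s2 - t) / 2.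
  have hm : 0 < Num.min (Num.min d1 d2) (s2 - t) by rewrite !lt_min d10 d20 subr_gt0.
  have h0 : 0 < h by rewrite divr_gt0.
  have : h < Num.min (Num.min d1 d2) (s2 - t) by rewrite /h; clear -hm; lra.
  rewrite !lt_min => /andP[/andP[hd1 hd2] hs].
  have E : t + h - t = h by clear; lra.
  have := h1 (t + h); have := h2 (t + h); rewrite !E (gtr0_norm h0) => /(_ hd2) k2 /(_ hd1) k1.
  have /andP[_ b2] := bounds t (t + h) (ltW t1) (ltac:(by rewrite lerDl ltW)) (ltac:(by clear -hs; lra)).
  move: k1 k2; rewrite E2 !ler_norml => /andP[k1 _] /andP[_ k2].
  rewrite -(ler_pM2r h0) mulrDl; move: k1 k2 b2; rewrite [e](splitr e) mulrDl.
  by set A := v _ - v _; set G := oint _ _ _; clear; lra.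
have e20 : 0 < e / 2 by rewrite divr_gt0.
have [d1 d10 h1] := slk _ e20; have [d2 d20 h2] := lt _ e20.
pose h := Num.min (Num.min d1 d2) (s2 - t) / 2.
have hm : 0 < Num.min (Num.min d1 d2) (s2 - t) by rewrite !lt_min d10 d20 subr_gt0.
have h0 : 0 < h by rewrite divr_gt0.
have : h < Num.min (Num.min d1 d2) (s2 - t) by rewrite /h; clear -hm; lra.
rewrite !lt_min => /andP[/andP[hd1 hd2] hs].
have E : t + h - t = h by clear; lra.
have := h1 (t + h); have := h2 (t + h); rewrite !E (gtr0_norm h0) => /(_ hd2) k2 /(_ hd1) k1.
have /andP[b2 _] := bounds t (t + h) (ltW t1) (ltac:(by rewrite lerDl ltW)) (ltac:(by clear -hs; lra)).
move: k1 k2; rewrite E1 !ler_norml => /andP[_ k1] /andP[k2 _].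
rewrite -(ler_pM2r h0) mulrDl; move: k1 k2 b2; rewrite [e](splitr e) mulrDl.
by set A := v _ - v _; set G := oint _ _ _; clear; lra.
Qed.

End local_primitive.

(** * The set where one-sided means of the source fail to converge *)

Section source_oscillation.
Context {R : realType}.
Let mu := @lebesgue_measure R.
Implicit Types (g : R * R -> R) (M : R) (p : R * R).

Definition quotient_error g (n : nat) p :=
  `|source_quotient g n.+1%:R^-1 p - g p| + `|source_quotient g (- n.+1%:R^-1) p - g p|.

(** For a bounded nonnegative error, a zero upper limit is equivalent to convergence to 0; in this
    form measurability is immediate. *)
Definition oscillating g p : bool := limn_sup (fun n => quotient_error g n p) != 0.

Lemma quotient_error_bound g M n p : bdd2 g M -> 0 <= quotient_error g n p <= 4 * M.
Proof.
move=> bg; have n0 : n.+1%:R^-1 != 0 :> R by rewrite invr_neq0.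
have := source_quotient_le p bg n0; have n0' : - n.+1%:R^-1 != 0 :> R by rewrite oppr_eq0.
have := source_quotient_le p bg n0'; have := bg.2 p; rewrite /quotient_error addr_ge0//=.
have := ler_normB (source_quotient g n.+1%:R^-1 p) (g p).
have := ler_normB (source_quotient g (- n.+1%:R^-1) p) (g p).
set A := `|_ - _|; set A' := `|_ - _|; set A1 := `|_|; set A2 := `|_|; set A3 := `|_|.
by clear; lra.
Qed.

Lemma quotient_error_measurable g M n : bdd2 g M -> measurable_fun setT (quotient_error g n).
Proof.
move=> bg; apply: measurable_funD; apply: measurableT_comp => //.
  by apply: measurable_funB; [exact: source_quotient_measurable bg|exact: bg.1].
by apply: measurable_funB; [exact: source_quotient_measurable bg|exact: bg.1].
Qed.

Let error_ub g M p : bdd2 g M -> has_ubound (range (fun n => quotient_error g n p)).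
Proof. by move=> bg; exists (4 * M) => _ [n _ <-]; have /andP[] := quotient_error_bound n p bg. Qed.

Let error_lb g M p : bdd2 g M -> has_lbound (range (fun n => quotient_error g n p)).
Proof. by move=> bg; exists 0 => _ [n _ <-]; have /andP[] := quotient_error_bound n p bg. Qed.

Lemma oscillating_measurable g M : bdd2 g M -> measurable_fun setT (oscillating g).
Proof.
move=> bg; have mf : measurable_fun setT (fun p => limn_sup (fun n => quotient_error g n p)).
  apply: measurable_fun_limn_sup.
  - by move=> p _; exact: error_ub bg.
  - by move=> p _; exact: error_lb bg.
  - by move=> n; exact: quotient_error_measurable bg.
apply: (measurable_fun_bool true); rewrite setTI.
rewrite (_ : _ @^-1` _ = (fun p => limn_sup (fun n => quotient_error g n p)) @^-1` [set~ 0]).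
  by rewrite -[X in measurable X]setTI; apply: mf => //; exact: measurableC.
by apply/seteqP; split => p /= /eqP.
Qed.

Lemma not_oscillating_cvg g M p : bdd2 g M -> ~~ oscillating g p ->
  source_quotient g n.+1%:R^-1 p @[n --> \oo] --> g p /\
  source_quotient g (- n.+1%:R^-1) p @[n --> \oo] --> g p.
Proof.
move=> bg; rewrite /oscillating negbK => /eqP os0.
have cs : sups (fun n => quotient_error g n p) @ \oo --> 0.
  have c := cvg_sups_inf (error_ub p bg) (error_lb p bg).
  have E : limn_sup (fun n => quotient_error g n p) =
     inf (range (sups (fun n => quotient_error g n p))) by apply/cvg_lim.
  by rewrite -E os0 in c.
have ce e : 0 < e -> \forall n \near \oo, quotient_error g n p < e.
  move=> e0; move: cs => /cvgrPdist_lt/(_ e e0); apply: filterS => n; rewrite sub0r normrN.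
  move=> /(le_lt_trans (ler_norm _)); apply: le_lt_trans.
  have hs : has_ubound (sdrop (fun n => quotient_error g n p) n).
    by exists (4 * M) => _ [k _ <-]; have /andP[] := quotient_error_bound k p bg.
  by apply: (ub_le_sup hs); exists n => /=.
split; apply/cvgrPdist_lt => e e0; move: (ce e e0); apply: filterS => n; apply: le_lt_trans;
  rewrite distrC /quotient_error ?lerDl ?lerDr//.
Qed.

Lemma oscillating_null g M : bdd2 g M -> (mu \x mu)%E [set p | oscillating g p] = 0%E.
Proof.
move=> bg; have mS : measurable [set p | oscillating g p].
  by have := oscillating_measurable bg measurableT (Y := [set true]); rewrite setTI; apply.
rewrite /product_measure1/=; rewrite integral0_eq// => t _.
have [A [mA A0 HA]] := ae_oint_deriv (measurable_fun_pair2 t bg.1) (fun x => bg.2 (t, x)).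
apply/eqP; rewrite eq_le measure_ge0 andbT -A0; apply: le_measure; rewrite ?inE//.
  exact: measurable_xsection.
move=> x; rewrite /xsection/= inE/= => os; apply: HA => /= H.
move: os; rewrite /oscillating => /negP; apply; apply/eqP.
apply: (cvg_limn_inf_sup _).2.
have side (h_ : nat -> R) : (forall n, h_ n != 0) -> h_ n @[n --> \oo] --> 0 ->
    source_quotient g (h_ n) (t, x) @[n --> \oo] --> g (t, x).
  move=> h0 hc; apply/cvgrPdist_le => e e0; have [d d0 Hd] := H e e0.
  move: hc => /cvgrPdist_lt/(_ d d0); apply: filterS => n; rewrite sub0r normrN => hn.
  have E : x + h_ n - x = h_ n by rewrite addrAC subrr add0r.
  have := Hd (x + h_ n); rewrite E => /(_ hn).
  rewrite /source_quotient/= (srcGB _ _ _ bg) distrC => Hq.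
  rewrite -(ler_pM2r (_ : 0 < `|h_ n|)) ?normr_gt0// -normrM mulrBl divfK//.
have hp : n.+1%:R^-1 @[n --> \oo] --> (0 : R) by exact: cvg_harmonic.
have hn : - n.+1%:R^-1 @[n --> \oo] --> (0 : R) by rewrite -oppr0; apply: cvgN.
have n0 n : n.+1%:R^-1 != 0 :> R by rewrite invr_neq0.
have n0' n : - n.+1%:R^-1 != 0 :> R by rewrite oppr_eq0.
have z (h_ : nat -> R) : source_quotient g (h_ n) (t, x) @[n --> \oo] --> g (t, x) ->
    `|source_quotient g (h_ n) (t, x) - g (t, x)| @[n --> \oo] --> 0.
  move=> c; rewrite -(normr0 R) -(subrr (g (t, x))); apply: cvg_norm; apply: cvgB => //; exact: cvg_cst.
rewrite -(addr0 0); apply: cvgD; [exact: z (side _ n0 hp)|exact: z (side _ n0' hn)].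
Qed.

End source_oscillation.

(** * Crossing the inflection set *)

Section inflection_set.
Context {R : realType}.
Implicit Types (f : R -> R) (z : R).

Lemma clos_Infl_sign f z : C2 f ->
  (~ clos_Infl f z) <-> exists sg e : R, [/\ sg = 1 \/ sg = -1, 0 < e &
    forall y, `|y - z| < e -> 0 <= sg * derive1n 2 f y].
Proof.
have lin (A B : R) : 0 <= A -> B < 0 -> A - B < - B -> False by lra.
move=> [_ _ c2]; split; last first.
  move=> [sg [e [sg1 e0 H]]] [lp ln].
  have zB : nbhs z [set y | `|y - z| < e].
    by apply/nbhs_ballP; exists e => // y /=; rewrite distrC.
  case: sg1 => E; rewrite E in H.
    have [y [_ /= fy /H]] := ln _ zB; by rewrite mul1r leNgt fy.
  have [y [_ /= fy /H]] := lp _ zB; by rewrite mulN1r oppr_ge0 leNgt fy.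
have sign (sg : R) : ~ limit_point [set y | sg * derive1n 2 f y < 0] z ->
    exists2 e : R, 0 < e & forall y, `|y - z| < e -> 0 <= sg * derive1n 2 f y.
  move=> /existsNP[U] /not_implyP[/nbhs_ballP[e /= e0 zU] /forallNP H].
  have Hy y : `|y - z| < e -> y != z -> 0 <= sg * derive1n 2 f y.
    move=> yz ynz; rewrite leNgt; apply/negP => fy; apply: (H y); split => //.
    by apply: zU; rewrite /ball/= distrC.
  (* Limit points disregard z itself, so the sign of f'' at z is recovered from its neighbours by
     continuity. *)
  exists e => // y yz; have [E|] := eqVneq y z; last exact: Hy.
  rewrite {y yz}E leNgt; apply/negP => fz.
  have cF : continuous (fun y => sg * derive1n 2 f y).
    by move=> y; apply: cvgM; [exact: cvg_cst|exact: c2].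
  have nz : 0 < - (sg * derive1n 2 f z) by rewrite oppr_gt0.
  have [d d0 hd] := @continuous_eps R _ z _ cF nz.
  pose y := z + Num.min d e / 2.
  have m0 : 0 < Num.min d e by rewrite lt_min d0.
  have E : y - z = Num.min d e / 2 by rewrite /y; clear; lra.
  have yE : `|y - z| < Num.min d e by rewrite E gtr0_norm ?divr_gt0//; clear -m0; lra.
  move: (yE); rewrite lt_min => /andP[yd ye].
  have := hd y yd; have := Hy y ye; rewrite -subr_eq0 E gt_eqF ?divr_gt0// => /(_ isT) h0.
  by rewrite ltr_norml => /andP[_]; exact: lin h0 fz.
move=> nN; have [lp|lp] := pselect (limit_point [set y | 0 < derive1n 2 f y] z).
  have ln : ~ limit_point [set y | derive1n 2 f y < 0] z by move=> ln; apply: nN.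
  have [|e e0 H] := sign 1; last by exists 1, e; split => //; left.
  rewrite (_ : [set y | _] = [set y | derive1n 2 f y < 0])//.
  by apply/seteqP; split => y /=; rewrite mul1r.
have [|e e0 H] := sign (-1); last by exists (-1), e; split => //; right.
rewrite (_ : [set y | _] = [set y | 0 < derive1n 2 f y])//.
by apply/seteqP; split => y /=; rewrite mulN1r oppr_lt0.
Qed.

Lemma clos_Infl_closed f : C2 f -> closed (clos_Infl f).
Proof.
move=> f_C2; rewrite -openC openE => z /= /(clos_Infl_sign _ f_C2)[sg [e [sg1 e0 H]]].
apply/nbhs_ballP; exists (e / 2) => [/=|w]; first by rewrite divr_gt0.
rewrite /ball/= => zw; apply/(clos_Infl_sign _ f_C2); exists sg, (e / 2); split => //.
  by rewrite divr_gt0.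
move=> y yw; apply: H; rewrite (_ : y - z = y - w + (w - z)); last by clear; lra.
by apply: le_lt_trans (ler_normD _ _) _; rewrite (distrC w); clear -yw zw; lra.
Qed.

End inflection_set.

(** * Functions of time crossing a null set of values *)

Section negligible_values.
Context {R : realType}.
Notation mu := (@lebesgue_measure R).
Implicit Types (P : R -> R) (A : set R) (a b s t K e : R).

Lemma loc_int_indic A : measurable A -> loc_int (\1_A : R -> R).
Proof.
move=> mA; apply: (bounded_loc_int (M := 1)); first exact: measurable_indic.
by move=> x; rewrite indicE; case: (_ \in _); rewrite ?normr1 ?normr0.
Qed.

Lemma oint_indic_ge0 A a b : a <= b -> 0 <= oint (\1_A : R -> R) a b.
Proof. by move=> ab; apply: oint_ge0 => // x _; rewrite indicE. Qed.

Lemma oint_indic_le A a b e : measurable A -> (mu A < e%:E)%E -> a <= b ->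
  oint (\1_A : R -> R) a b <= e.
Proof.
move=> mA Ae ab; rewrite ointE// /Rintegral integral_indic//.
have AI : (mu (A `&` `[a, b]) <= mu A)%E.
  by apply: le_measure; rewrite ?inE//; exact: measurableI.
rewrite -lee_fin fineK; first by apply/ltW; apply: le_lt_trans Ae.
rewrite ge0_fin_numE//; apply: le_lt_trans AI _; apply: lt_trans Ae _; exact: ltry.
Qed.

Lemma oint_indic_eq A a b : a <= b -> (forall x, a <= x <= b -> A x) ->
  oint (\1_A : R -> R) a b = b - a.
Proof.
move=> ab H; rewrite -[RHS]mul1r -oint_cst; apply: eq_oint => x.
by rewrite (min_idPl ab) (max_idPr ab) => /H Ax; rewrite indicE mem_set.
Qed.

Lemma variation_le P A K a b : measurable A -> 0 <= K -> a <= b -> cont_itv a b P ->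
  (forall t, a <= t < b -> exists2 d, 0 < d & forall s, t < s < t + d -> s <= b ->
    `|P s - P t| <= K * oint (\1_A : R -> R) t s) ->
  `|P b - P a| <= K * oint (\1_A : R -> R) a b.
Proof.
move=> mA K0 ab cP loc; have lA := loc_int_indic mA.
pose psi t := K * oint (\1_A : R -> R) a t.
have psiB s t : psi t - psi s = K * oint (\1_A : R -> R) s t.
  by rewrite /psi -(oint_cat a s t lA) mulrDr; clear; lra.
have cpsi : cont_itv a b psi.
  apply: (lipschitz_cont_itv (k := K)) => s t _ _; rewrite psiB normrM (ger0_norm K0).
  rewrite ler_wpM2l//; apply: le_trans (oint_norm_le lA (M := 1) _) _; last by rewrite mul1r.
  by move=> x _; rewrite indicE; case: (_ \in _); rewrite ?normr1 ?normr0.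
have up : psi a - P a <= psi b - P b.
  apply: (locally_nondecreasing_right (phi := fun t => psi t - P t)) => //; first exact: cont_itvB.
  move=> t tI; have [d d0 H] := loc t tI; exists d => // s ss sb.
  by have := H s ss sb; rewrite -psiB ler_norml => /andP[_]; clear; lra.
have lo : psi a + P a <= psi b + P b.
  apply: (locally_nondecreasing_right (phi := fun t => psi t + P t)) => //; first exact: cont_itvD.
  move=> t tI; have [d d0 H] := loc t tI; exists d => // s ss sb.
  by have := H s ss sb; rewrite -psiB ler_norml => /andP[+ _]; clear; lra.
by rewrite -psiB ler_norml; apply/andP; split; clear -up lo; lra.
Qed.

(* The values of [v] in an open neighbourhood of [N] of measure less than [e]
   are collapsed, which moves [v] by at most [e]. *)
Lemma variation_off_null (v : R -> R) (N : set R) M a b : closed N -> mu N = 0%E -> continuous v ->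
  0 <= M -> a <= b ->
  (forall t, a <= t < b -> ~ N (v t) -> exists2 d, 0 < d & forall s, t < s < t + d -> s <= b ->
    `|v s - v t| <= M * (s - t)) ->
  `|v b - v a| <= M * oint (\1_[set t | ~ N (v t)] : R -> R) a b.
Proof.
move=> cN N0 cv M0 ab loc; apply/ler_addgt0Pr => e e0.
have oC : open [set t | ~ N (v t)].
  rewrite -[X in open X]/(v @^-1` (~` N)); apply: open_comp; last by rewrite openC.
  by move=> x _; exact: cv.
have mA : measurable [set t | ~ N (v t)] by exact: open_measurable.
have mN : measurable N by exact: closed_measurable.
have Nfin : (mu N < +oo)%E by rewrite N0 ltry.
have [ O [oO NO Oe]] := lebesgue_regularity_outer mN Nfin e0.
have mO : measurable O by exact: open_measurable.
have {}Oe : (mu O < e%:E)%E.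
  rewrite -(setUIDK O N) measureU//; [|exact: measurableI|exact: measurableD|].
    rewrite [X in (X + _)%E](_ : _ = 0%E) ?add0e//.
    apply/eqP; rewrite eq_le measure_ge0 andbT -[leRHS]N0.
    by apply: le_measure; rewrite ?inE//; exact: measurableI.
  by apply/seteqP; split => x //= [[_ ?] [_ ?]].
have lO := loc_int_indic mO.
(* F is 1-Lipschitz and constant on each interval inside O, and it alters differences of values by
   at most the measure of O, less than e. *)
pose F z := z - oint (\1_O : R -> R) 0 z.
have FB x y : F y - F x = y - x - oint (\1_O : R -> R) x y.
  by rewrite /F -(oint_cat 0 x y lO); clear; lra.
have oO1 x y : x <= y -> 0 <= oint (\1_O : R -> R) x y <= y - x.
  move=> xy; rewrite oint_indic_ge0//= -[leRHS]mul1r -oint_cst; apply: le_oint => //.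
    exact: loc_int_cst.
have F1 x y : `|F y - F x| <= `|y - x|.
  have h w z : w <= z -> `|F z - F w| <= `|z - w|.
    move=> wz; have /andP[? ?] := oO1 _ _ wz.
    by rewrite FB !ger0_norm ?subr_ge0// lerBlDr lerDl.
  by have /orP[xy|yx] := le_total x y; [exact: h|rewrite distrC (distrC y); exact: h].
have Fe : `|v b - v a| <= `|F (v b) - F (v a)| + e.
  have Oe' x y : `|oint (\1_O : R -> R) x y| <= e.
    have h w z : w <= z -> `|oint (\1_O : R -> R) w z| <= e.
      by move=> wz; rewrite ger0_norm ?oint_indic_ge0//; exact: oint_indic_le.
    by have /orP[xy|yx] := le_total x y; [exact: h|rewrite oint_swap normrN; exact: h].
  have := ler_normD (F (v b) - F (v a)) (oint (\1_O : R -> R) (v a) (v b)).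
  have := Oe' (v a) (v b); rewrite FB subrK; set A := `|oint _ _ _|; set A1 := `|_|; set A2 := `|_|.
  by clear; lra.
apply: le_trans Fe _; rewrite lerD2r.
apply: (variation_le (P := fun t => F (v t))) => //.
  move=> t _ d d0; have [d' d'0 h] := @continuous_eps R v t d cv d0.
  by exists d' => // s _ st; apply: le_lt_trans (F1 _ _) _; exact: h.
(* If v t is in N, then v stays in O for a while and F (v) is constant; otherwise F does not expand
   distances and the Lipschitz hypothesis applies. *)
move=> t tI; have [Nt|nNt] := pselect (N (v t)).
  have : \forall z \near v t, O z by apply: open_nbhs_nbhs; split => //; exact: NO.
  move=> /nbhs_ballP[r /= r0 rO]; have [d d0 h] := @continuous_eps R v t r cv r0.
  exists d => // s /andP[ts std] sb; rewrite (_ : F (v s) - F (v t) = 0); last first.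
    rewrite FB; apply/eqP; rewrite subr_eq0; apply/eqP.
    have st : `|v s - v t| < r by apply: h; rewrite ger0_norm ?subr_ge0 1?ltW//; clear -std; lra.
    have eqO x y : (forall z, Num.min x y <= z <= Num.max x y -> O z) -> y - x = oint (\1_O : R -> R) x y.
      move=> H; rewrite -[LHS]mul1r -oint_cst; apply: eq_oint => z /H Oz.
      by rewrite indicE mem_set.
    apply: eqO => z zz; apply: rO; rewrite /ball/= distrC.
    exact: le_lt_trans (ler_dist_between zz) st.
  by rewrite normr0 mulr_ge0// oint_indic_ge0// ltW.
have [d d0 h] := loc t tI nNt.
have : \forall s \near t, ~ N (v s) by apply: open_nbhs_nbhs.
move=> /nbhs_ballP[r /= r0 rN].
exists (Num.min d r); first by rewrite lt_min d0.
move=> s /andP[ts std] sb; apply: le_trans (F1 _ _) _.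
move: std; rewrite -ltrBlDl lt_min => /andP[sd sr].
rewrite oint_indic_eq ?(ltW ts)//; first by apply: h => //; rewrite ts -ltrBlDl.
move=> x /andP[tx xs]; apply: rN; rewrite /ball/= distrC ger0_norm ?subr_ge0//.
by apply: le_lt_trans sr; rewrite lerD2r.
Qed.

(** Let P be v minus the primitive of k. It is locally constant at times in the open set [Om] where
    v avoids N, and in general it varies by at most 2 M times the measure of [Om]. A compact V
    inside [Om] carries almost all of that measure, so the variation of P is at most 2 M times an
    arbitrarily small remainder. *)
Lemma primitive_off_null (v k : R -> R) (N : set R) M a b : closed N -> mu N = 0%E -> continuous v ->
  0 <= M -> a <= b -> measurable_fun setT k -> (forall t, `|k t| <= M) ->
  (forall t, N (v t) -> k t = 0) ->
  (forall t, a <= t <= b -> ~ N (v t) -> exists2 d, 0 < d & forall r s,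
    a <= r -> r <= s -> s <= b -> t - d < r -> s < t + d -> v s - v r = oint k r s) ->
  v b - v a = oint k a b.
Proof.
move=> cN N0 cv M0 ab mk kM kN loc.
pose Om := [set t | ~ N (v t)].
have oC : open Om.
  rewrite -[X in open X]/(v @^-1` (~` N)); apply: open_comp; last by rewrite openC.
  by move=> x _; exact: cv.
have mOm : measurable Om by exact: open_measurable.
have lk := bounded_loc_int mk kM; have lOm := loc_int_indic mOm.
have kOm s t : s <= t -> `|oint k s t| <= M * oint (\1_Om : R -> R) s t.
  move=> st; rewrite -ointZ//; have lM := loc_intZ M lOm.
  have kb x : `|k x| <= M * \1_Om x.
    rewrite indicE; have [Ox|nOx] := pselect (Om x); first by rewrite mem_set// mulr1.
    by rewrite memNset// mulr0 kN ?normr0//; apply: contrapT.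
  rewrite ler_norml -ointN//; apply/andP; split; apply: le_oint => //.
  - exact: loc_intN.
  - by move=> x _; have := kb x; rewrite ler_norml => /andP[].
  - by move=> x _; have := kb x; rewrite ler_norml => /andP[].
have vOm s t : a <= s -> s <= t -> t <= b -> `|v t - v s| <= M * oint (\1_Om : R -> R) s t.
  move=> as_ st tb; apply: variation_off_null => // r /andP[sr rt] Nr.
  have [|d d0 h] := loc r _ Nr; first by rewrite (le_trans as_ sr) (le_trans (ltW rt)).
  exists d => // q /andP[rq qd] qt; rewrite (h r q)//; last by clear -d0; lra.
  - apply: le_trans (oint_norm_le lk (fun x _ => kM x)) _.
    by rewrite ger0_norm ?subr_ge0// ltW.
  - exact: le_trans sr.
  - exact: ltW.
  - exact: le_trans tb.
pose P t := v t - oint k a t.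
have PB s t : P t - P s = v t - v s - oint k s t.
  by rewrite /P -(oint_cat a s t lk); clear; lra.
have cP : cont_itv a b P.
  apply: cont_itvB; first exact: continuous_cont_itv.
  apply: (lipschitz_cont_itv (k := M)) => s t _ _.
  rewrite (_ : oint k a s - oint k a t = oint k t s); last first.
    by rewrite -(oint_cat a t s lk); clear; lra.
  exact: (oint_norm_le lk (fun x _ => kM x)).
suff P0 : `|P b - P a| <= 0.
  by move: P0; rewrite normr_le0 PB subr_eq0 => /eqP.
apply/ler_addgt0Pr => e e0; rewrite add0r.
pose D := Om `&` `[a, b]; have mD : measurable D by exact: measurableI.
have Dfin : (mu D < +oo)%E.
  apply: (@le_lt_trans _ _ (mu `[a, b]%classic)).
    by apply: le_measure; rewrite ?inE//; exact: subIsetr.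
  by rewrite lebesgue_measure_itv/=; case: ifP => _; rewrite ltry.
have e1 : 0 < e / (2 * M + 1) by rewrite divr_gt0//; clear -M0; lra.
have [V [cV VD Ve]] := lebesgue_regularity_inner mD Dfin e1.
have clV : closed V by apply: compact_closed => //; exact: Rhausdorff.
have mV : measurable V by exact: closed_measurable.
have mDV : measurable (D `\` V) by exact: measurableD.
apply: (@le_trans _ _ (2 * M * oint (\1_(D `\` V) : R -> R) a b)); last first.
  have E := oint_indic_le mDV Ve ab; have := ler_wpM2l (_ : 0 <= 2 * M) E.
  rewrite mulr_ge0// => /(_ isT) E'; apply: le_trans E' _.
  rewrite mulrA ler_pdivrMr ?(mulrC _ e) ?ler_pM2l//; clear -M0; lra.
apply: variation_le => //; first by rewrite mulr_ge0.
move=> t /andP[at_ tb]; have [Vt|nVt] := pselect (V t).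
  have [Ot _] := VD _ Vt; have [|d d0 h] := loc t _ Ot; first by rewrite at_ ltW.
  exists d => // s /andP[ts sd] sb; rewrite PB (h t s)// ?subrr ?normr0//.
  - by rewrite mulr_ge0 ?mulr_ge0 ?oint_indic_ge0// ltW.
  - exact: ltW.
  - by clear -d0; lra.
have : \forall s \near t, (~` V) s by apply: open_nbhs_nbhs; split => //; rewrite openC.
move=> /nbhs_ballP[r /= r0 rV]; exists r => // s /andP[ts sr] sb.
(* Just after a time outside the closed set V, removing V from [Om] removes nothing. *)
have E : oint (\1_(D `\` V) : R -> R) t s = oint (\1_Om : R -> R) t s.
  apply: eq_oint => x; rewrite (min_idPl (ltW ts)) (max_idPr (ltW ts)) => /andP[tx xs].
  rewrite !indicE; congr (_%:R); congr nat_of_bool; apply/idP/idP; rewrite !inE => H.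
    by case: H => -[].
  split; first by split => //=; rewrite in_itv/= (le_trans at_ tx) (le_trans xs sb).
  apply: rV; rewrite /ball/= distrC ger0_norm ?subr_ge0//; clear -xs sr; lra.
rewrite E PB; apply: le_trans (ler_normB _ _) _; rewrite -mulrA mulr_natl mulr2n.
by apply: lerD; [exact: vOm (ltW ts) sb|exact: kOm (ltW ts)].
Qed.

End negligible_values.

(** * The source along arbitrary characteristics *)

Section universal_source.
Context {R : realType}.
Notation mu := (@lebesgue_measure R).
Implicit Types (f ga lam gamma phi : R -> R) (u g : R * R -> R).
Implicit Types (t s x y a b d e M K : R).

Definition universal_source f u g M (p : R * R) : R :=
  if `[< clos_Infl f (u p) >] then 0 else
  if oscillating g p then touching_source f (derive1n 2 f) u M p else g p.

Lemma universal_source_bdd2 f u g M : C2 f -> continuous u -> 0 <= M -> bdd2 g M ->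
  bdd2 (universal_source f u g M) M.
Proof.
move=> f_C2 cu M0 bg; split.
  apply: measurable_fun_ifT; [|exact: measurable_cst|].
    apply: (measurable_fun_bool true); rewrite setTI.
    rewrite (_ : _ @^-1` _ = u @^-1` (clos_Infl f)).
      apply: closed_prod_measurable; apply: preimage_closed; last exact: clos_Infl_closed.
      by move=> p _; exact: cu.
    by apply/seteqP; split => p /= /asboolP.
  apply: measurable_fun_ifT; [exact: oscillating_measurable bg| |exact: bg.1].
  by apply: touching_source_measurable => //; exact: C2_continuous.
move=> p; rewrite /universal_source; case: ifP => _; first by rewrite normr0.
by case: ifP => _; [exact: touching_source_le|exact: bg.2].
Qed.

Lemma characteristic_primitive f u g M ga lam s1 s2 : C2 f ->
  rect_balance f u (srcG g) M -> bdd2 g M -> mu (clos_Infl f) = 0%E ->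
  char_on (derive1 f) u ga lam s1 s2 -> s1 <= s2 ->
  u (s2, ga s2) - u (s1, ga s1) = oint (fun t => universal_source f u g M (t, ga t)) s1 s2.
Proof.
move=> f_C2 B bg N0 ch s12; have cu := rb_cont B; have M0 := rb_ge0 B; have cga := ch_ga ch.
have [mh hM] := universal_source_bdd2 f_C2 cu M0 bg.
have cv := @curve_continuous R u ga cu cga.
apply: (@primitive_off_null R (fun t => u (t, ga t)) _ (clos_Infl f) M) => //.
- exact: clos_Infl_closed.
- exact: (@curve_measurable R _ _ (universal_source f u g M) ga).
- by move=> t Nt; rewrite /universal_source asboolT.
move=> t tI Nt; have [sg [e [sg1 e0 H]]] := (clos_Infl_sign (u (t, ga t)) f_C2).1 Nt.
(* One half of e is spent on the variation of u along the segment, the other on a neighbourhood of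
   each value taken there. *)
have e20 : 0 < e / 2 by rewrite divr_gt0.
have [d d0 hd] := @continuous_eps R _ t _ cv e20.
exists d => // r s s1r rs ss2 tr st.
have near q : r <= q <= s -> `|u (q, ga q) - u (t, ga t)| < e / 2.
  move=> /andP[rq qs]; apply: hd; rewrite ltr_norml; apply/andP; split; clear -rq qs tr st; lra.
have inI q : r <= q <= s -> s1 <= q <= s2.
  by move=> /andP[rq qs]; rewrite (le_trans s1r rq) (le_trans qs ss2).
have ch' : char_on (derive1 f) u ga lam r s.
  split; [exact: ch_ga ch|exact: ch_lam ch| |by move=> q /inI; exact: (ch_speed ch)].
  move=> q /inI qI k k0; have [d' d'0 h] := ch_der ch qI k0.
  by exists d' => // w /inI; exact: h.
have tan : tangent_side f u ga lam sg r s.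
  exists (e / 2) => // q w qI wq; rewrite (ch_speed ch (inI q qI)).
  by apply: (C2_tangent (z := u (t, ga t)) (e := e)) => //; exact: near.
have nearsign q : r <= q <= s ->
    forall y, `|y - u (q, ga q)| < e / 2 -> 0 <= sg * derive1n 2 f y.
  move=> qI y yq; apply: H; rewrite (_ : y - u (t, ga t) = y - u (q, ga q) + (u (q, ga q) - u (t, ga t))).
    apply: le_lt_trans (ler_normD _ _) _; rewrite [ltRHS]splitr; apply: ltrD => //; exact: near.
  by rewrite addrA subrK.
have sides q : r <= q <= s -> exists2 rho, 0 < rho &
    convex_side (derive1 f) (convexity (derive1n 2 f) (u (q, ga q))) (u (q, ga q)) rho.
  by move=> qI; exact: (convexity_side f_C2 sg1 e20 (nearsign q qI)).
rewrite (characteristic_primitive_local f_C2 B bg ch' rs sg1 tan sides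
  (oscillating_measurable bg) (fun p => not_oscillating_cvg bg)).
apply: eq_oint => q; rewrite (min_idPl rs) (max_idPr rs) => qI.
rewrite /universal_source asboolF//; apply/(clos_Infl_sign _ f_C2).
by exists sg, (e / 2); split => //; exact: nearsign.
Qed.

Lemma clamp_comp_continuous (h : R -> R) a b : a <= b -> cont_itv a b h ->
  continuous (fun t => h (clamp a b t)).
Proof.
move=> ab ch t; apply/cvgrPdist_lt => e e0.
have [d d0 H] := ch _ (clamp_itv t ab) e e0.
apply/nbhs_ballP; exists d => // s ts; rewrite distrC; apply: H; first exact: clamp_itv.
apply: le_lt_trans (clamp_lipschitz _ _ _ _) _; by rewrite distrC.
Qed.

Lemma characteristic_on f u (I : set R) gamma a b : characteristic f u I gamma ->
  continuous u -> a <= b -> I a -> I b ->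
  char_on (derive1 f) u (fun t => gamma (clamp a b t))
    (fun t => derive1 f (u (clamp a b t, gamma (clamp a b t)))) a b.
Proof.
move=> [iI dI cI] cu ab Ia Ib; have sub t : a <= t <= b -> I t by move=> tab; exact: (iI a b).
pose sp t := derive1 f (u (t, gamma t)).
have der t : a <= t <= b -> forall e, 0 < e -> exists2 d, 0 < d & forall s, a <= s <= b ->
    `|s - t| < d -> `|gamma s - gamma t - sp t * (s - t)| <= e * `|s - t|.
  move=> tab e e0; have /cvgrPdist_le/(_ e e0) := dI t (sub t tab).
  move=> /nbhs_ballP[d /= d0 H]; exists d => // s sab st.
  have [->|snt] := eqVneq s t; first by rewrite !subrr mulr0 subr0 normr0 mulr0.
  have := H s _ snt (sub s sab); rewrite /ball/= distrC => /(_ st) h.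
  have st0 : s - t != 0 by rewrite subr_eq0.
  rewrite -ler_pdivrMr ?normr_gt0// -normfV -normrM mulrBl mulfK// distrC; exact: h.
split.
- apply: clamp_comp_continuous => //.
  move=> t tab e e0; have [d d0 H] := der t tab 1 ltr01.
  pose C := `|sp t| + 1; have C0 : 0 < C by rewrite /C; have := normr_ge0 (sp t); clear; lra.
  exists (Num.min d (e / C)); first by rewrite lt_min d0 divr_gt0.
  move=> s sab; rewrite lt_min => /andP[sd]; rewrite ltr_pdivlMr// => se.
  apply: le_lt_trans se; have := H s sab sd; rewrite mul1r => h1.
  have := ler_normD (gamma s - gamma t - sp t * (s - t)) (sp t * (s - t)).
  rewrite subrK => /le_trans; apply.
  by rewrite normrM [leRHS](_ : _ = `|s - t| + `|sp t| * `|s - t|) ?lerD2r// /C; lra.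
- apply: (@clamp_comp_continuous sp) => // t tab e e0.
  have /subspace_continuousP/(_ t (sub t tab))/cvgrPdist_lt/(_ e e0) := cI.
  move=> /nbhs_ballP[d /= d0 H]; exists d => // s sab st.
  by rewrite distrC; apply: H (sub s sab); rewrite /ball/= distrC.
- move=> t tab e e0; have [d d0 H] := der t tab e e0; exists d => // s sab st.
  by rewrite !clampE//; exact: H.
- by move=> t tab; rewrite clampE.
Qed.

(** Here v need not be differentiable everywhere, as k is only measurable. Still, the product minus
    both primitives has derivative 0 at every time: the increment of v is the integral of k, and
    replacing phi r by phi t under it costs o(s - t). *)
Lemma integration_by_parts_oint (v k phi phi' : R -> R) M a b : a <= b ->
  measurable_fun setT k -> (forall t, `|k t| <= M) -> continuous v ->
  (forall s t, a <= s <= b -> a <= t <= b -> v t - v s = oint k s t) ->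
  continuous phi -> continuous phi' -> (forall t, slope_at phi t (phi' t)) ->
  v b * phi b - v a * phi a =
  oint (fun t => v t * phi' t) a b + oint (fun t => k t * phi t) a b.
Proof.
move=> ab mk kM cv vk cp cp' sp.
have M0 : 0 <= M by exact: le_trans (kM 0).
have cvp : continuous (fun t => v t * phi' t).
  by move=> t; apply: cvgM; [exact: cv|exact: cp'].
have lvp := continuous_loc_int cvp; have lk := bounded_loc_int mk kM.
have lkp : loc_int (fun t => k t * phi t).
  move=> c d; have [K K0 HK] := @box_bounded _ (fun p => phi p.1) c d 0 0
    (fun p => continuous_comp (@cvg_fst _ _ _ _ _) (cp p.1)).
  apply: (bounded_integrable_itv (M := M * K)).
    by apply: measurable_funM => //; exact: continuous_measurable_fun.
  move=> t tt; rewrite normrM; apply: ler_pM => //; apply: (HK t 0) => //; by rewrite lexx.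
pose F t := v t * phi t - oint (fun r => v r * phi' r) a t - oint (fun r => k r * phi r) a t.
have : F b - F a = oint (fun=> 0) a b.
  apply: oint_of_derivative => //; first exact: cst_continuous.
  move=> t tab e e0.
  pose C := 2 * M + `|v t| + 1.
  have C0 : 0 < C by rewrite /C; have := normr_ge0 (v t); clear -M0; lra.
  pose q := e / C; have q0 : 0 < q by rewrite divr_gt0.
  have [d1 d10 h1] := sp t q q0.
  have [d2 d20 h2] := @continuous_eps R phi t q cp q0.
  have [d3 d30 h3] := @oint_deriv _ _ t lvp (cvp t) q q0.
  exists (Num.min (Num.min d1 d2) d3); first by rewrite !lt_min d10 d20.
  move=> s sab; rewrite !lt_min => /andP[/andP[sd1 sd2] sd3].
  rewrite /= mul0r subr0.
  have -> : F s - F t =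
     oint (fun r => k r * (phi t - phi r)) t s + (v s - v t) * (phi s - phi t)
     + v t * (phi s - phi t - phi' t * (s - t))
     - (oint (fun r => v r * phi' r) t s - v t * phi' t * (s - t)).
    have -> : oint (fun r => k r * (phi t - phi r)) t s =
        phi t * oint k t s - oint (fun r => k r * phi r) t s.
      rewrite -ointZ// -ointB//; last exact: loc_intZ.
      by congr oint; apply/funext => r; rewrite mulrBr mulrC.
    rewrite -vk// /F -(oint_cat a t s lvp) -(oint_cat a t s lkp).
    set A := v t; set A' := v s; set p := phi t; set p' := phi s.
    set X := oint _ a t; set Y := oint _ a t; set X' := oint _ t s; set Y' := oint _ t s.
    clear; rewrite mulrBr !mulrBl !mulrBr mulrA; lra.
  have E1 : `|oint (fun r => k r * (phi t - phi r)) t s| <= M * q * `|s - t|.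
    apply: oint_norm_le.
      rewrite (_ : (fun _ => _) = (fun r => phi t * k r - k r * phi r)); last first.
        by apply/funext => r; rewrite mulrBr mulrC.
      by apply: loc_intB => //; exact: loc_intZ.
    move=> r rr; rewrite normrM; apply: ler_pM => //; apply/ltW; rewrite distrC; apply: h2.
    exact: le_lt_trans (ler_dist_between rr) sd2.
  have E2 : `|(v s - v t) * (phi s - phi t)| <= M * q * `|s - t|.
    rewrite normrM mulrAC; apply: ler_pM => //.
      rewrite vk//; apply: oint_norm_le => // r _; exact: kM.
    exact/ltW/h2.
  have E3 : `|v t * (phi s - phi t - phi' t * (s - t))| <= `|v t| * q * `|s - t|.
    by rewrite normrM -mulrA ler_wpM2l//; exact: h1.
  have E4 := h3 s sd3.
  apply: le_trans (ler_normB _ _) _; apply: le_trans (lerD (ler_normD _ _) (lexx _)) _.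
  apply: le_trans (lerD (lerD (ler_normD _ _) (lexx _)) (lexx _)) _.
  apply: le_trans (lerD (lerD (lerD E1 E2) E3) E4) _.
  have -> : e = q * C by rewrite /q divfK// gt_eqF.
  by rewrite -!mulrDl ler_wpM2r// /C; clear; lra.
rewrite oint_cst mul0r => /eqP; rewrite subr_eq0 /F !oint_refl !subr0 => /eqP.
by set X := oint _ _ _; set Y := oint _ _ _; clear; lra.
Qed.

Lemma Rintegral_restrict (h : R -> R) (D E K : set R) : measurable D -> measurable E ->
  K `<=` D -> K `<=` E -> (forall t, ~ K t -> h t = 0) ->
  \int[mu]_(t in D) h t = \int[mu]_(t in E) h t.
Proof.
move=> mD mE KD KE h0; rewrite /Rintegral integral_mkcond [in RHS]integral_mkcond.
congr fine; apply: eq_integral => t _; rewrite /patch.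
have [Kt|nKt] := pselect (K t); first by rewrite !mem_set//; [exact: KE|exact: KD].
by rewrite h0//; case: ifP; case: ifP.
Qed.

Lemma universal_source_Broad f u g M : C2 f ->
  rect_balance f u (srcG g) M -> bdd2 g M -> mu (clos_Infl f) = 0%E ->
  forall (I : set R) gamma, characteristic f u I gamma ->
  forall phi : R -> R, test_function I° phi ->
    - (\int[mu]_(t in I°) (u (t, gamma t) * derive1 phi t)) =
    \int[mu]_(t in I°) (universal_source f u g M (t, gamma t) * phi t).
Proof.
move=> f_C2 B bg N0 I gamma cI phi [sphi [K [cK KI phi0]]].
have cu := rb_cont B; have M0 := rb_ge0 B.
have [cphi dphi] := sphi [::]; have [cphi' _] := sphi [:: 1].
have cd : continuous (derive1 phi).
  by rewrite (_ : derive1 phi = 'D_1 phi)//; apply/funext => t; rewrite derive1E.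
have clK : closed K by apply: compact_closed => //; exact: Rhausdorff.
have dphi0 t : ~ K t -> derive1 phi t = 0.
  move=> nK; have : \forall s \near t, (~` K) s by apply: open_nbhs_nbhs; split => //; rewrite openC.
  move=> H; rewrite derive1E (@near_eq_derive _ _ _ phi (cst 0)) ?derive_cst//.
  by apply: filterS H => s; exact: phi0.
have mI : measurable I° by apply: open_measurable; exact: open_interior.
have [[k0 Kk0]|K0] := pselect (K !=set0); last first.
  have nK t : ~ K t by move=> Kt; apply: K0; exists t.
  rewrite (@eq_Rintegral _ _ _ mu _ (fun=> 0)); last by move=> t _; rewrite dphi0 ?mulr0.
  rewrite [in RHS](@eq_Rintegral _ _ _ mu _ (fun=> 0)); last by move=> t _; rewrite phi0 ?mulr0.
  by rewrite /Rintegral integral0 oppr0.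
have cid : {within K, continuous (fun t : R => t)}.
  by apply: continuous_subspaceT => t; exact: cvg_id.
have nb (x : R) : I° x -> exists2 e, 0 < e & I° (x - e) /\ I° (x + e).
  move=> Ix; have : \forall y \near x, I° y by apply: open_nbhs_nbhs; split => //; exact: open_interior.
  move=> /nbhs_ballP[e /= e0 H]; exists (e / 2); first by rewrite divr_gt0.
  by split; apply: H; rewrite /ball/= ltr_norml; apply/andP; split; clear -e0; lra.
(* The extreme points of the compact K are pushed outwards inside the open set I°. The segment
   between them lies in I, and phi vanishes at both of its ends. *)
have [m + mmin] := compact_EVT_min (ex_intro _ k0 Kk0) cK cid; rewrite inE => Km.
have [n + nmax] := compact_EVT_max (ex_intro _ k0 Kk0) cK cid; rewrite inE => Kn.
have [d1 d10 [Ia _]] := nb m (KI m Km); have [d2 d20 [_ Ib]] := nb n (KI n Kn).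
set a := m - d1 in Ia; set b := n + d2 in Ib.
have Kab t : K t -> a < t < b.
  move=> Kt; have h1 : m <= t by apply: mmin; rewrite inE.
  have h2 : t <= n by apply: nmax; rewrite inE.
  by rewrite /a /b; apply/andP; split; clear -h1 h2 d10 d20; lra.
have ab : a <= b by have /andP[h1 h2] := Kab _ Kk0; exact: ltW (lt_trans h1 h2).
have ch := characteristic_on cI cu ab (interior_subset Ia) (interior_subset Ib).
set ga := (fun t => gamma (clamp a b t)) in ch; pose v t := u (t, ga t).
have cga := ch_ga ch.
pose k t := universal_source f u g M (t, ga t).
have [mh hM] := universal_source_bdd2 f_C2 cu M0 bg.
have mk : measurable_fun setT k by exact: (@curve_measurable R _ _ (universal_source f u g M) ga).
have kM t : `|k t| <= M by exact: hM.
have prim s t : a <= s -> s <= t -> t <= b -> v t - v s = oint k s t.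
  move=> as_ st tb; apply: (characteristic_primitive (lam :=
    fun t => derive1 f (u (clamp a b t, gamma (clamp a b t)))) f_C2 B bg N0 _ st).
  have inI q : s <= q <= t -> a <= q <= b.
    by move=> /andP[sq qt]; rewrite (le_trans as_ sq) (le_trans qt tb).
  split; [exact: ch_ga ch|exact: ch_lam ch| |by move=> q /inI; exact: (ch_speed ch)].
  move=> q /inI qI e e0; have [d d0 h] := ch_der ch qI e0.
  by exists d => // w /inI; exact: h.
have vk s t : a <= s <= b -> a <= t <= b -> v t - v s = oint k s t.
  move=> /andP[as_ sb] /andP[at_ tb]; have /orP[st|ts] := le_total s t; first exact: prim.
  by rewrite oint_swap -prim// opprB.
have := integration_by_parts_oint ab mk kM (@curve_continuous R u ga cu cga) vk (cphi : continuous phi)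
  cd
  (fun t => @derivable_slope R phi t (dphi 1 t)).
rewrite (phi0 b); last by move=> /Kab; rewrite ltxx andbF.
rewrite (phi0 a); last by move=> /Kab; rewrite ltxx.
rewrite !mulr0 subrr !(ointE _ ab) => /eqP; rewrite eq_sym addr_eq0 => /eqP E.
have Ksub : K `<=` `[a, b]%classic.
  by move=> t /Kab /andP[? ?]; rewrite /= in_itv/= !ltW.
rewrite (Rintegral_restrict mI (measurable_itv `[a, b]) KI Ksub); last by move=> t /dphi0 ->; rewrite mulr0.
rewrite [in RHS](Rintegral_restrict mI (measurable_itv `[a, b]) KI Ksub); last by move=> t /phi0 ->; rewrite mulr0.
rewrite (@eq_Rintegral _ _ _ mu _ (fun t => v t * derive1 phi t)); last first.
  by move=> t; rewrite inE/= in_itv/= => tab; rewrite /v /ga clampE.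
rewrite [in RHS](@eq_Rintegral _ _ _ mu _ (fun t => k t * phi t)); last first.
  by move=> t; rewrite inE/= in_itv/= => tab; rewrite /k /ga clampE.
by rewrite E opprK.
Qed.

End universal_source.

(** * Smooth test functions *)

Section smooth_functions.
Context {R : realType}.
Implicit Types (h F : R -> R) (x y a b e d w : R) (k : nat).

Lemma slope_atD F h x w w' : slope_at F x w -> slope_at h x w' ->
  slope_at (fun y => F y + h y) x (w + w').
Proof.
move=> sF sh e e0; have e20 : 0 < e / 2 by rewrite divr_gt0.
have [d1 d10 h1] := sF _ e20; have [d2 d20 h2] := sh _ e20.
exists (Num.min d1 d2) => [|y]; first by rewrite lt_min d10.
rewrite lt_min => /andP[/h1 {}h1 /h2 {}h2].
rewrite (_ : _ - _ = F y - F x - w * (y - x) + (h y - h x - w' * (y - x))).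
  by apply: le_trans (ler_normD _ _) _; rewrite [e]splitr mulrDl; exact: lerD.
by rewrite mulrDl; clear; lra.
Qed.

Lemma slope_bound F x w : slope_at F x w -> exists2 d, 0 < d & forall y, `|y - x| < d ->
  `|F y - F x| <= (`|w| + 1) * `|y - x|.
Proof.
move=> sF; have [d d0 H] := sF 1 ltr01; exists d => // y /H; rewrite mul1r => h1.
have := ler_normD (F y - F x - w * (y - x)) (w * (y - x)); rewrite subrK => /le_trans; apply.
by rewrite mulrDl mul1r addrC normrM lerD2l.
Qed.

Lemma slope_continuous F x w : slope_at F x w -> {for x, continuous F}.
Proof.
move=> /slope_bound[d d0 H]; apply/cvgrPdist_lt => e e0.
have C0 : 0 < `|w| + 1 by rewrite ltr_wpDl.
apply/nbhs_ballP; exists (Num.min d (e / (`|w| + 1))) => [/=|y].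
  by rewrite lt_min d0 divr_gt0.
rewrite /ball/= distrC lt_min => /andP[/H h1]; rewrite ltr_pdivlMr// mulrC => h2.
by rewrite distrC; apply: le_lt_trans h2.
Qed.

Lemma slope_atM F h x w w' : slope_at F x w -> slope_at h x w' ->
  slope_at (fun y => F y * h y) x (w * h x + F x * w').
Proof.
move=> sF sh e e0.
pose C := `|h x| + `|F x| + (`|w| + 1) * (`|w'| + 1).
have C0 : 0 < C.
  by rewrite /C ltr_wpDl ?addr_ge0// mulr_gt0// ltr_wpDl.
pose q := e / C; have q0 : 0 < q by rewrite divr_gt0.
have [d1 d10 h1] := sF _ q0; have [d2 d20 h2] := sh _ q0.
have [d3 d30 h3] := slope_bound sF; have [d4 d40 h4] := slope_bound sh.
exists (Num.min (Num.min (Num.min d1 d2) (Num.min d3 d4)) q) => [|y].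
  by rewrite !lt_min d10 d20 d30 d40.
rewrite !lt_min => /andP[/andP[/andP[/h1 {}h1 /h2 {}h2] /andP[/h3 {}h3 /h4 {}h4]] yq].
rewrite (_ : _ - _ = (F y - F x - w * (y - x)) * h x + F x * (h y - h x - w' * (y - x))
  + (F y - F x) * (h y - h x)); last first.
  by clear; ring.
have E1 : `|(F y - F x - w * (y - x)) * h x| <= q * `|h x| * `|y - x|.
  by rewrite normrM mulrAC ler_wpM2r.
have E2 : `|F x * (h y - h x - w' * (y - x))| <= q * `|F x| * `|y - x|.
  by rewrite normrM (mulrC q) -mulrA ler_wpM2l.
have E3 : `|(F y - F x) * (h y - h x)| <= q * ((`|w| + 1) * (`|w'| + 1)) * `|y - x|.
  rewrite normrM; apply: le_trans (ler_pM _ _ h3 h4) _ => //.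
  rewrite mulrACA mulrA ler_wpM2r// mulrC ler_wpM2r ?mulr_ge0 ?addr_ge0//; exact: ltW.
apply: le_trans (ler_normD _ _) _; apply: le_trans (lerD (ler_normD _ _) (lexx _)) _.
apply: le_trans (lerD (lerD E1 E2) E3) _.
by rewrite -!mulrDl -!mulrDr -/C /q divfK// gt_eqF.
Qed.

Lemma slope_at_affine F a b x w : slope_at F (a * x + b) w ->
  slope_at (fun y => F (a * y + b)) x (a * w).
Proof.
move=> sF e e0; have A0 : 0 < `|a| + 1 by rewrite ltr_wpDl.
have q0 : 0 < e / (`|a| + 1) by rewrite divr_gt0.
have [d d0 H] := sF _ q0; exists (d / (`|a| + 1)) => [|y]; first by rewrite divr_gt0.
rewrite ltr_pdivlMr// => yd.
have E : a * y + b - (a * x + b) = a * (y - x) by rewrite mulrBr; clear; lra.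
have le1 : `|a * (y - x)| <= `|y - x| * (`|a| + 1).
  by rewrite normrM mulrC ler_wpM2l// lerDl.
have := H (a * y + b); rewrite E => /(_ (le_lt_trans le1 yd)).
rewrite (_ : w * (a * (y - x)) = a * w * (y - x)); last by clear; ring.
move=> /le_trans; apply.
apply: le_trans (_ : e / (`|a| + 1) * (`|y - x| * (`|a| + 1)) <= _); first by rewrite ler_wpM2l// ltW.
by rewrite mulrC -mulrA (mulrC (`|a| + 1)) divfK ?gt_eqF// mulrC.
Qed.

Lemma eq_slope_at F h x w d : 0 < d -> (forall y, `|y - x| < d -> F y = h y) ->
  slope_at h x w -> slope_at F x w.
Proof.
move=> d0 E sh e e0; have [d' d'0 H] := sh e e0.
exists (Num.min d d') => [|y]; first by rewrite lt_min d0.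
by rewrite lt_min => /andP[yd yd']; rewrite !E ?subrr ?normr0//; exact: H.
Qed.

Lemma slope_at_cst a x : slope_at (fun=> a) x 0.
Proof. by move=> e e0; exists 1 => // y _; rewrite subrr mul0r subrr normr0 mulr_ge0// ltW. Qed.

Lemma is_derive_slope F x w : is_derive x 1 F w -> slope_at F x w.
Proof.
move=> dF; have := @derivable_slope R F x; rewrite derive1E derive_val; apply.
exact: ex_derive.
Qed.

(* The functions x^-k exp(-1/x), extended by 0, are closed under derivation up
   to linear combinations. *)
Definition flat_exp k x : R := if 0 < x then x^-1 ^+ k * expR (- x^-1) else 0.

(** The term of degree k + 2 in the series of expR x^-1 beats x^-k by a factor x^2. A quadratic
    bound is what makes the slope at 0 vanish. *)
Lemma flat_exp_le k x : 0 < x -> `|flat_exp k x| <= k.+2`!%:R * x ^+ 2.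
Proof.
move=> x0; rewrite /flat_exp x0; have i0 : 0 < x^-1 by rewrite invr_gt0.
rewrite ger0_norm; last by rewrite mulr_ge0 ?exprn_ge0 ?expR_ge0// ltW.
have H : x^-1 ^+ k.+2 / k.+2`!%:R <= expR x^-1.
  by apply: le_trans (expR_ge1Dxn k.+1 (ltW i0)); rewrite lerDr.
rewrite expRN ler_pdivrMr ?expR_gt0//.
have f0 : 0 < k.+2`!%:R :> R by rewrite ltr0n fact_gt0.
apply: le_trans (_ : k.+2`!%:R * x ^+ 2 * (x^-1 ^+ k.+2 / k.+2`!%:R) <= _); last first.
  by rewrite ler_wpM2l// mulr_ge0// ?exprn_ge0// ltW.
rewrite !exprS expr0 mulr1; set P := x^-1 ^+ k; set q := _%:R in f0 *.
rewrite (_ : q * (x * x) * (x^-1 * (x^-1 * P) / q) = P) ?lexx//; move: x0 f0; clear => x0 f0.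
by field; rewrite !gt_eqF.
Qed.

Lemma flat_exp_slope k x :
  slope_at (flat_exp k) x (- (k%:R * flat_exp k.+1 x) + flat_exp k.+2 x).
Proof.
have [x0|xn|<-] := ltgtP 0 x.
- have E y : `|y - x| < x -> flat_exp k y = y^-1 ^+ k * expR (- y^-1).
    rewrite ltr_norml => /andP[h1 _]; rewrite /flat_exp ifT//; clear -h1; lra.
  apply: (eq_slope_at x0 E).
  have x0' : x != 0 by rewrite gt_eqF.
  have dV : is_derive x 1 (fun y : R => y^-1) (- (x^-1 ^+ 2)).
    have -> : - (x^-1 ^+ 2) = - x ^- 2 *: (1 : R) by rewrite /GRing.scale/= mulr1 exprVn.
    exact: is_deriveV.
  have sV := is_derive_slope dV.
  have sX : slope_at (fun y => y^-1 ^+ k) x (- (k%:R * x^-1 ^+ k.+1)).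
    elim: k {E} => [|k IH].
      rewrite mul0r oppr0; apply: (eq_slope_at (h := fun=> 1) (d := 1)) => //; exact: slope_at_cst.
    apply: (eq_slope_at (h := fun y => y^-1 * y^-1 ^+ k) (d := 1)) => //.
      by move=> y _; rewrite exprS.
    have := slope_atM sV IH; congr slope_at.
    by rewrite !exprS expr0 -natr1; clear; ring.
  have sE : slope_at (fun y => expR (- y^-1)) x (expR (- x^-1) * x^-1 ^+ 2).
    apply: is_derive_slope; apply: (is_derive1_comp (g := fun y => - y^-1)).
    by rewrite -[_ ^+ 2]opprK; apply: is_deriveN.
  have := slope_atM sX sE; congr slope_at.
  rewrite /flat_exp x0 !exprS expr0; set P := _ ^+ k; clear; ring.
- apply: (eq_slope_at (h := fun=> 0) (d := - x)); first by rewrite oppr_gt0.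
    move=> y; rewrite ltr_norml => /andP[_ h1]; rewrite /flat_exp ifF//.
    by apply/negbTE; rewrite -leNgt; clear -h1; lra.
  rewrite /flat_exp ltNge (ltW xn) /= mulr0 oppr0 addr0; exact: slope_at_cst.
rewrite {2 3}/flat_exp ltxx mulr0 oppr0 addr0 => e e0.
have f0 : 0 < k.+2`!%:R :> R by rewrite ltr0n fact_gt0.
exists (e / k.+2`!%:R) => [|y]; first by rewrite divr_gt0.
rewrite subr0 mul0r subr0 {2}/flat_exp ltxx subr0 => ye.
have [y0|yn] := ltP 0 y; last by rewrite /flat_exp ltNge yn normr0 mulr_ge0// ltW.
apply: le_trans (flat_exp_le k y0) _; rewrite expr2 mulrA (gtr0_norm y0) ler_pM2r//.
by move: ye; rewrite gtr0_norm// ltr_pdivlMr// mulrC => /ltW.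
Qed.

End smooth_functions.

(** * Smooth products and approximate identities *)

Section product_test_functions.
Context {R : realType}.
Implicit Types (h : R -> R) (phi : R * R -> R) (x y s t a b c d e : R) (n k : nat).

(** A syntactic class closed under differentiation: induction on the syntax yields a derivative in
    the same class, hence all iterated ones. *)
Inductive smooth1 : (R -> R) -> Prop :=
| smooth1_flat k : smooth1 (flat_exp k)
| smooth1_affine h a b : smooth1 h -> smooth1 (fun x => h (a * x + b))
| smooth1_mul h h' : smooth1 h -> smooth1 h' -> smooth1 (fun x => h x * h' x)
| smooth1_add h h' : smooth1 h -> smooth1 h' -> smooth1 (fun x => h x + h' x)
| smooth1_cst c : smooth1 (fun=> c)
| smooth1_prim h : smooth1 h -> smooth1 (oint h 0).

Lemma oint_slope h x : continuous h -> slope_at (oint h 0) x (h x).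
Proof.
move=> ch e e0; have lh := continuous_loc_int ch.
have [d d0 H] := @oint_deriv _ _ x lh (ch x) e e0; exists d => // y yx.
rewrite (_ : oint h 0 y - oint h 0 x = oint h x y); first exact: H.
by rewrite -(oint_cat 0 x y lh); clear; lra.
Qed.

Lemma smooth1_slope h : smooth1 h -> exists2 h', smooth1 h' & forall x, slope_at h x (h' x).
Proof.
elim=> {h} [k|h a b sh [h' sh' H]|h g sh [h' sh' H] sg [g' sg' G]|h g sh [h' sh' H] sg [g' sg' G]|c|h sh [h' sh' H]].
- exists (fun x => (- k%:R) * flat_exp k.+1 x + flat_exp k.+2 x).
    by apply: smooth1_add; [apply: smooth1_mul; [exact: smooth1_cst|exact: smooth1_flat]|exact: smooth1_flat].
  by move=> x; have := @flat_exp_slope R k x; rewrite mulNr.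
- exists (fun x => a * h' (a * x + b)).
    by apply: smooth1_mul; [exact: smooth1_cst|exact: smooth1_affine].
  by move=> x; exact: slope_at_affine.
- exists (fun x => h' x * g x + h x * g' x).
    by apply: smooth1_add; apply: smooth1_mul.
  by move=> x; exact: slope_atM.
- exists (fun x => h' x + g' x); first exact: smooth1_add.
  by move=> x; exact: slope_atD.
- by exists (fun=> 0); [exact: smooth1_cst|move=> x; exact: slope_at_cst].
- exists h => // x; apply: oint_slope => y; exact: slope_continuous (H y).
Qed.

Lemma smooth1_continuous h : smooth1 h -> continuous h.
Proof. by move=> /smooth1_slope[h' _ H] x; exact: slope_continuous (H x). Qed.

(** Sums of products of functions of one variable, since a directional derivative of a product is
    such a sum. *)
Inductive smooth2 : (R * R -> R) -> Prop :=
| smooth2_mul h h' : smooth1 h -> smooth1 h' -> smooth2 (fun p => h p.1 * h' p.2)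
| smooth2_add phi psi : smooth2 phi -> smooth2 psi -> smooth2 (fun p => phi p + psi p).

Lemma smooth2_continuous phi : smooth2 phi -> continuous phi.
Proof.
elim=> {phi} [h h' sh sh'|phi psi _ cphi _ cpsi] p; last by apply: cvgD; [exact: cphi|exact: cpsi].
apply: cvgM.
  by apply: (@continuous_comp _ _ _ fst h); [exact: cvg_fst|exact: smooth1_continuous].
by apply: (@continuous_comp _ _ _ snd h'); [exact: cvg_snd|exact: smooth1_continuous].
Qed.

Lemma product_slope h h' p (v : R * R) w w' : slope_at h p.1 w -> slope_at h' p.2 w' ->
  slope_at (fun y => h (y *: v + p).1 * h' (y *: v + p).2) 0 (v.1 * w * h' p.2 + h p.1 * (v.2 * w')).
Proof.
move=> H H'.
apply: (eq_slope_at (h := fun y => h (v.1 * y + p.1) * h' (v.2 * y + p.2)) (d := 1)) => //.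
  by move=> y _; rewrite !(mulrC _ y).
have S1 : slope_at (fun y => h (v.1 * y + p.1)) 0 (v.1 * w).
  by apply: slope_at_affine; rewrite mulr0 add0r.
have S2 : slope_at (fun y => h' (v.2 * y + p.2)) 0 (v.2 * w').
  by apply: slope_at_affine; rewrite mulr0 add0r.
by have := slope_atM S1 S2; rewrite !mulr0 !add0r.
Qed.

Lemma smooth2_slope phi (v : R * R) : smooth2 phi -> exists2 psi, smooth2 psi &
  forall p, slope_at (fun y => phi (y *: v + p)) 0 (psi p).
Proof.
elim=> {phi} [h h' sh sh'|phi1 phi2 _ [psi1 s1 H1] _ [psi2 s2 H2]].
  have [dh sdh H] := smooth1_slope sh; have [dh' sdh' H'] := smooth1_slope sh'.
  exists (fun p => v.1 * dh p.1 * h' p.2 + h p.1 * (v.2 * dh' p.2)).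
    apply: smooth2_add.
      apply: (smooth2_mul (h := fun x => v.1 * dh x)) => //.
      by apply: smooth1_mul => //; exact: smooth1_cst.
    apply: (smooth2_mul (h' := fun x => v.2 * dh' x)) => //.
    by apply: smooth1_mul => //; exact: smooth1_cst.
  by move=> p; exact: product_slope.
exists (fun p => psi1 p + psi2 p); first exact: smooth2_add.
by move=> p; exact: slope_atD.
Qed.

Lemma derive_slope (V : normedModType R) (phi : V -> R) (p v : V) w :
  slope_at (fun y => phi (y *: v + p)) 0 w -> derivable phi p v /\ 'D_v phi p = w.
Proof.
move=> H.
have cv : h^-1 *: ((phi \o shift p) (h *: v) - phi p) @[h --> 0^'] --> w.
  apply/cvgrPdist_le => e e0; have [d d0 hd] := H e e0.
  apply/nbhs_ballP; exists d => // y /=; rewrite /ball/= distrC => yd y0.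
  have := hd y yd; rewrite scale0r add0r => h1.
  have yp : 0 < `|y - 0| by rewrite subr0 normr_gt0.
  rewrite distrC -(ler_pM2r yp) -normrM mulrBl.
  rewrite subr0 in h1 *; apply: le_trans h1; rewrite le_eqVlt; apply/orP; left; apply/eqP.
  by congr (`|_ - _|); rewrite /GRing.scale/= mulrAC mulVf// mul1r.
by split; [apply/cvg_ex; exists w|exact: (cvg_lim (@Rhausdorff R) cv)].
Qed.

Lemma smooth2_smooth phi : smooth2 phi -> smooth phi.
Proof.
move=> sphi vs.
suff S : smooth2 (iter_derive vs phi).
  split; first exact: smooth2_continuous.
  by move=> v p; have [psi _ H] := smooth2_slope v S; have [] := derive_slope (H p).
elim: vs => [//|v vs IH] /=; have [psi spsi H] := smooth2_slope v IH.
rewrite (_ : (fun p => _) = psi)//; apply/funext => p.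
by have [] := derive_slope (H p).
Qed.

Definition bump x : R := flat_exp 0 x * flat_exp 0 (- 1 * x + 1).

Lemma smooth1_bump : smooth1 bump.
Proof. by apply: smooth1_mul; [|apply: smooth1_affine]; exact: smooth1_flat. Qed.

Lemma flat_exp_ge0 x : 0 <= flat_exp 0 x.
Proof. by rewrite /flat_exp; case: ifP => // _; rewrite expr0 mul1r expR_ge0. Qed.

Lemma bump_ge0 x : 0 <= bump x.
Proof. by rewrite mulr_ge0// flat_exp_ge0. Qed.

Lemma bump_out x : ~~ (0 < x < 1) -> bump x = 0.
Proof.
rewrite negb_and -!leNgt /bump => /orP[x0|x1].
  by rewrite /flat_exp ltNge x0 mul0r.
by rewrite {2}/flat_exp ifF ?mulr0//; apply/negbTE; rewrite -leNgt; clear -x1; lra.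
Qed.

Lemma bump_continuous : continuous bump.
Proof. exact: (@smooth1_continuous bump smooth1_bump). Qed.

Lemma bump_loc_int : loc_int bump.
Proof. exact: (@continuous_loc_int _ bump bump_continuous). Qed.

Lemma bump_mass : 0 < oint bump 0 1.
Proof.
have h0 : 0 < bump (1 / 2).
  have E : - 1 * (1 / 2) + 1 = 1 / 2 :> R by clear; lra.
  have i0 : 0 < 1 / 2 :> R by rewrite divr_gt0.
  by rewrite /bump E mulr_gt0// /flat_exp i0 expr0 mul1r expR_gt0.
have h20 : 0 < bump (1 / 2) / 2 by rewrite divr_gt0.
have [d d0 H] := @continuous_eps R bump (1 / 2) _ (@bump_continuous) h20.
pose q := Num.min (d / 2) (1 / 2); have q0 : 0 < q by rewrite lt_min !divr_gt0.
have [q1 q2] : q <= d / 2 /\ q <= 1 / 2 by rewrite /q !ge_min !lexx orbT.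
rewrite -(oint_cat 0 (1 / 2) 1 (@bump_loc_int)) -(oint_cat (1 / 2) (1 / 2 + q) 1 (@bump_loc_int)).
rewrite ltr_wpDl//; first by apply: oint_ge0 => [|x _]; [clear; lra|exact: bump_ge0].
rewrite ltr_pwDl//; last by apply: oint_ge0 => [|x _]; [clear -q2; lra|exact: bump_ge0].
apply: (@lt_le_trans _ _ (oint (fun=> bump (1 / 2) / 2) (1 / 2) (1 / 2 + q))).
  by rewrite oint_cst mulr_gt0//; clear -q0; lra.
apply: le_oint; [exact: loc_int_cst|exact: (@bump_loc_int)|by clear -q0; lra|].
move=> x /andP[x1 x2]; have := H x; rewrite ger0_norm ?subr_ge0//.
have -> : x - 1 / 2 < d.
  apply: (@le_lt_trans _ _ q); first by rewrite lerBlDl.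
  by apply: le_lt_trans q1 _; rewrite ltr_pdivrMr// ltr_pMr// ltr1n.
by move=> /(_ isT); rewrite ltr_norml => /andP[+ _]; clear; lra.
Qed.

Definition smooth_step x : R := (oint bump 0 1)^-1 * oint bump 0 x.

Definition smooth_kernel x : R := (oint bump 0 1)^-1 * bump x.

Lemma smooth1_step : smooth1 smooth_step.
Proof. by apply: smooth1_mul; [exact: smooth1_cst|apply: smooth1_prim; exact: smooth1_bump]. Qed.

Lemma smooth1_kernel : smooth1 smooth_kernel.
Proof. by apply: smooth1_mul; [exact: smooth1_cst|exact: smooth1_bump]. Qed.

Lemma smooth_step_slope x : slope_at smooth_step x (smooth_kernel x).
Proof.
have := slope_atM (slope_at_cst (oint bump 0 1)^-1 x) (@oint_slope bump x (@bump_continuous)).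
by rewrite mul0r add0r.
Qed.

Lemma smooth_kernel_ge0 x : 0 <= smooth_kernel x.
Proof. by rewrite mulr_ge0 ?bump_ge0// invr_ge0 ltW// bump_mass. Qed.

Lemma smooth_kernel_out x : ~~ (0 < x < 1) -> smooth_kernel x = 0.
Proof. by move=> /bump_out; rewrite /smooth_kernel => ->; rewrite mulr0. Qed.

Lemma smooth_step_le0 x : x <= 0 -> smooth_step x = 0.
Proof.
move=> x0; rewrite /smooth_step (_ : oint bump 0 x = 0) ?mulr0//.
rewrite (eq_oint (g := fun=> 0)) ?oint_cst ?mul0r// => y; rewrite (min_idPr x0) (max_idPl x0) => /andP[_ y0].
by apply: bump_out; rewrite ltNge y0.
Qed.

Lemma smooth_step_ge1 x : 1 <= x -> smooth_step x = 1.
Proof.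
move=> x1; rewrite /smooth_step -(oint_cat 0 1 x (@bump_loc_int)) (_ : oint bump 1 x = 0).
  by rewrite addr0 mulVf// gt_eqF// bump_mass.
rewrite (eq_oint (g := fun=> 0)) ?oint_cst ?mul0r//.
move=> y; rewrite (min_idPl x1) => /andP[y1 _]; apply: bump_out.
by rewrite negb_and -!leNgt y1 orbT.
Qed.

Lemma smooth_step_itv x : 0 <= smooth_step x <= 1.
Proof.
have mono a b : a <= b -> smooth_step a <= smooth_step b.
  move=> ab; rewrite -subr_ge0 -mulrBr -(oint_cat 0 a b (@bump_loc_int)) (addrC (oint _ 0 a)) addrK.
  by rewrite mulr_ge0 ?invr_ge0 ?(ltW bump_mass)//; apply: oint_ge0 => // y _; exact: bump_ge0.
apply/andP; split.
  have [x0|/ltW x0] := leP x 0; first by rewrite smooth_step_le0.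
  by rewrite -(smooth_step_le0 (lexx 0)); exact: mono.
have [x1|/ltW x1] := leP 1 x; first by rewrite smooth_step_ge1.
by rewrite -(smooth_step_ge1 (lexx 1)); exact: mono.
Qed.

(** Rises from 0 at s to 1 at s + 1 / (n + 1), entirely to the right of s; its derivative
    [delta_kernel] is a one-sided approximate identity. *)
Definition cutoff n s t : R := smooth_step (n.+1%:R * t + - (n.+1%:R * s)).

Definition delta_kernel n s t : R := n.+1%:R * smooth_kernel (n.+1%:R * t + - (n.+1%:R * s)).

Lemma smooth1_cutoff n s : smooth1 (cutoff n s).
Proof. by apply: smooth1_affine; exact: smooth1_step. Qed.

Lemma smooth1_delta n s : smooth1 (delta_kernel n s).
Proof. by apply: smooth1_mul; [exact: smooth1_cst|apply: smooth1_affine; exact: smooth1_kernel]. Qed.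

Lemma cutoff_slope n s t : slope_at (cutoff n s) t (delta_kernel n s t).
Proof. by apply: slope_at_affine; exact: smooth_step_slope. Qed.

Lemma cutoff_itv n s t : 0 <= cutoff n s t <= 1.
Proof. exact: smooth_step_itv. Qed.

Lemma cutoff_left n s t : t <= s -> cutoff n s t = 0.
Proof. by move=> ts; apply: smooth_step_le0; rewrite subr_le0 ler_pM2l ?ltr0n. Qed.

Lemma cutoff_right n s t : n.+1%:R^-1 <= t - s -> cutoff n s t = 1.
Proof.
move=> ts; apply: smooth_step_ge1; rewrite -mulrBr.
by rewrite -(@ler_pM2l _ n.+1%:R^-1) ?invr_gt0 ?ltr0n// mulrA mulVf ?mul1r ?mulr1// pnatr_eq0.
Qed.

Lemma delta_ge0 n s t : 0 <= delta_kernel n s t.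
Proof. by rewrite mulr_ge0// smooth_kernel_ge0. Qed.

Lemma delta_out n s t : ~~ (s < t < s + n.+1%:R^-1) -> delta_kernel n s t = 0.
Proof.
move=> ts; rewrite /delta_kernel smooth_kernel_out ?mulr0//; apply: contra ts.
have n0 : 0 < n.+1%:R :> R by rewrite ltr0n.
rewrite subr_gt0 ltr_pM2l// => /andP[-> /=]; rewrite -mulrBr -ltrBlDl.
by rewrite -(@ltr_pM2l _ n.+1%:R^-1) ?invr_gt0// mulrA mulVf ?mul1r ?mulr1// gt_eqF.
Qed.

End product_test_functions.

(** * From the distributional to the integral balance law *)

Section product_integral.
Context {R : realType}.
Notation mu := (@lebesgue_measure R).
Implicit Types (h : R -> R) (H : R * R -> R) (a b K : R).

Lemma integral_oint h a b : a <= b -> mu.-integrable `[a, b] (EFin \o h) ->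
  (forall x, ~~ (a <= x <= b) -> h x = 0) ->
  (\int[mu]_x (h x)%:E = (oint h a b)%:E)%E.
Proof.
move=> ab ih h0; rewrite ointE// /Rintegral fineK; last exact: integrable_fin_num.
rewrite [RHS]integral_mkcond; apply: eq_integral => x _; rewrite /patch.
case: ifPn => // xn; rewrite h0//; apply: contra xn => xab.
by rewrite inE/= in_itv.
Qed.

Lemma integral_oint2 H K t1 t2 a b : t1 <= t2 -> a <= b -> bdd2 H K ->
  (forall t x, ~~ (t1 <= t <= t2) || ~~ (a <= x <= b) -> H (t, x) = 0) ->
  \int[(mu \x mu)%E]_p H p = oint2 H t1 t2 a b.
Proof.
move=> t12 ab bH H0; have [mH HK] := bH.
pose D : set (R * R) := `[t1, t2] `*` `[a, b].
have mD : measurable D by exact: measurableX.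
have Dfin : ((mu \x mu) D < +oo)%E.
  have -> : ((mu \x mu) D = mu `[t1, t2]%classic * mu `[a, b]%classic)%E.
    by apply: product_measure1E.
  rewrite [mu `[t1, t2]%classic]lebesgue_measure_itv [mu `[a, b]%classic]lebesgue_measure_itv/=.
  by apply: lte_mul_pinfty; case: ifP => // _; rewrite -?EFinD ?lee_fin ?subr_ge0// ltry.
have iD : (mu \x mu)%E.-integrable D (EFin \o H).
  apply: measurable_bounded_integrable => //.
  - exact: measurable_funTS.
  - exists K; split; first exact: num_real.
    by move=> x Kx p _; apply: le_trans (HK p) (ltW Kx).
have iH : (mu \x mu)%E.-integrable setT (EFin \o H).
  have iR := (integrable_mkcond (mu := (mu \x mu)%E) (EFin \o H) mD).1 iD.
  have Q p : ((EFin \o H) \_ D) p = (EFin \o H) p.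
    move: p => [t x]; rewrite /patch; case: ifPn => // px /=; rewrite H0//.
    rewrite -negb_and; apply: contra px => /andP[tt xx].
    by rewrite inE; split; rewrite /= in_itv.
  by move/integrableP: iR => [mR fR]; apply/integrableP; split; move: mR fR; rewrite (funext Q).
rewrite /Rintegral -(integral12_prod_meas1 iH) /fubini_F /=.
have inner t : (\int[mu]_x (H (t, x))%:E)%E = (oint (fun x => H (t, x)) a b)%:E.
  apply: integral_oint => //; first exact: (bdd2_slice t bH).
  by move=> x xn; apply: H0; rewrite xn orbT.
under eq_integral do rewrite inner.
rewrite (integral_oint (h := fun t => oint (fun x => H (t, x)) a b) t12)//.
  exact: (bdd2_inner a b bH).
move=> t tn; rewrite (eq_oint (g := fun=> 0)) ?oint_cst ?mul0r// => x _.
by apply: H0; rewrite tn.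
Qed.

End product_integral.

(** * Limits of smooth windows *)

Section window.
Context {R : realType}.
Implicit Types (h : R -> R) (t s c d a b e C K : R) (n : nat).

Definition loc_bdd h := measurable_fun setT h /\
  forall a b, exists C, forall t, a <= t <= b -> `|h t| <= C.

Lemma loc_bdd_int h : loc_bdd h -> loc_int h.
Proof. by move=> [mh bh] a b; have [C hC] := bh a b; exact: (bounded_integrable_itv mh hC). Qed.

Lemma continuous_loc_bdd h : continuous h -> loc_bdd h.
Proof.
move=> ch; split; first exact: continuous_measurable_fun.
move=> a b; have [K K0 HK] := @box_bounded _ (fun p => h p.1) a b 0 0
  (fun p => continuous_comp (@cvg_fst _ _ _ _ _) (ch p.1)).
by exists K => t tt; apply: (HK t 0) => //; rewrite lexx.
Qed.

Lemma loc_bddM h h' : loc_bdd h -> loc_bdd h' -> loc_bdd (fun t => h t * h' t).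
Proof.
move=> [mh bh] [mh' bh']; split; first exact: measurable_funM.
move=> a b; have [C hC] := bh a b; have [C' hC'] := bh' a b; exists (C * C') => t tt.
by rewrite normrM; apply: ler_pM => //; [exact: hC|exact: hC'].
Qed.

(** A smooth approximation of the indicator of ]s, t]; when s <= t its support lies in [s, t + 1]
    for every n. *)
Definition window n s t x : R := cutoff n s x - cutoff n t x.

Definition window_slope n s t x : R := delta_kernel n s x - delta_kernel n t x.

Lemma smooth1_window n s t : smooth1 (window n s t).
Proof.
rewrite (_ : window n s t = (fun x => cutoff n s x + -1 * cutoff n t x)).
  apply: smooth1_add; first exact: smooth1_cutoff.
  by apply: smooth1_mul; [exact: smooth1_cst|exact: smooth1_cutoff].
by apply/funext => x; rewrite mulN1r.
Qed.

Lemma window_slopeP n s t x : slope_at (window n s t) x (window_slope n s t x).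
Proof. by apply: slope_atD; [exact: cutoff_slope|apply: slope_atN; exact: cutoff_slope]. Qed.

Lemma window_norm n s t x : `|window n s t x| <= 1.
Proof.
have /andP[? ?] := cutoff_itv n s x; have /andP[? ?] := cutoff_itv n t x.
by rewrite ler_norml; apply/andP; split; rewrite /window; lra.
Qed.

Lemma inv_le1 n : n.+1%:R^-1 <= 1 :> R.
Proof. by rewrite invf_le1 ?ltr0n// ler1n. Qed.

Lemma window_out n s t x : s <= t -> ~~ (s <= x <= t + 1) -> window n s t x = 0.
Proof.
move=> st; rewrite negb_and -!ltNge /window => /orP[xs|tx].
  by rewrite !cutoff_left ?subrr// ltW// (lt_le_trans xs).
have i1 := inv_le1 n; rewrite !cutoff_right ?subrr//.
  by move: i1; move: _^-1 => i i1; clear -i1 tx; lra.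
by move: i1; move: _^-1 => i i1; clear -i1 tx st; lra.
Qed.

Lemma window_slope_out n s t x : s <= t -> ~~ (s <= x <= t + 1) -> window_slope n s t x = 0.
Proof.
move=> st xn; have i1 := inv_le1 n.
rewrite /window_slope !delta_out ?subrr//; apply: contra xn; move: i1; move: _^-1 => i i1;
  by move=> /andP[h1 h2]; apply/andP; split; clear -h1 h2 i1 st; lra.
Qed.

Lemma eventually_inv d : 0 < d -> exists n0, forall n, (n0 <= n)%N -> n.+1%:R^-1 <= d.
Proof.
move=> d0; have [m [_ md]] := exists_small_inv d^-1; exists m => n mn.
apply: le_trans (md d d0 _); last by rewrite mulVf// gt_eqF.
by rewrite lef_pV2 ?posrE ?ltr0n// ler_nat.
Qed.

Lemma delta_continuous n s : continuous (delta_kernel n s).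
Proof. exact: (@smooth1_continuous R _ (smooth1_delta n s)). Qed.

Lemma window_continuous n s t : continuous (window n s t).
Proof. exact: (@smooth1_continuous R _ (smooth1_window n s t)). Qed.

Lemma window_slope_continuous n s t : continuous (window_slope n s t).
Proof. by move=> x; apply: cvgB; exact: delta_continuous. Qed.

Lemma delta_mass n s c d : c <= s -> s + 1 <= d -> oint (delta_kernel n s) c d = 1.
Proof.
move=> cs sd; have i1 := inv_le1 n.
rewrite -(oint_of_derivative (F := cutoff n s)) //.
- by rewrite cutoff_right ?cutoff_left ?subr0//; move: i1; move: _^-1 => i i1; clear -i1 sd; lra.
- by clear -cs sd; lra.
- exact: delta_continuous.
move=> t _ e e0; have [q q0 H] := cutoff_slope n s t e0; exists q => // y _; exact: H.
Qed.

Lemma delta_norm n s c d h C : c <= s -> s + 1 <= d -> loc_bdd h ->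
  (forall t, c <= t <= d -> `|h t| <= C) ->
  `|oint (fun t => delta_kernel n s t * h t) c d| <= C.
Proof.
move=> cs sd bh hC; have cd : c <= d by clear -cs sd; lra.
have bd := continuous_loc_bdd (@delta_continuous n s).
have ld := loc_bdd_int bd; have lh := loc_bdd_int (loc_bddM bd bh).
rewrite -[C]mulr1 -(delta_mass n cs sd) -ointZ//.
have lC := loc_intZ C ld.
rewrite ler_norml -ointN//; apply/andP; split; apply: le_oint => //; first exact: loc_intN.
  move=> t /hC; rewrite ler_norml => /andP[h1 _].
  by rewrite -mulNr mulrC ler_wpM2l// delta_ge0.
move=> t /hC; rewrite ler_norml => /andP[_ h1].
by rewrite mulrC ler_wpM2r// delta_ge0.
Qed.

Lemma delta_limit s c d h : c <= s -> s + 1 <= d -> continuous h ->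
  oint (fun t => delta_kernel n s t * h t) c d @[n --> \oo] --> h s.
Proof.
move=> cs sd ch; apply/cvgrPdist_le => e e0; have cd : c <= d by clear -cs sd; lra.
have [q q0 H] := @continuous_eps R h s e ch e0.
have [n0 Hn] := eventually_inv q0.
near=> n; have qn : n.+1%:R^-1 <= q by apply: Hn; near: n; exact: nbhs_infty_ge.
have bd := continuous_loc_bdd (@delta_continuous n s).
have ld := loc_bdd_int bd; have bh := continuous_loc_bdd ch.
have lh := loc_bdd_int (loc_bddM bd bh).
rewrite distrC -[h s]mulr1 -(delta_mass n cs sd) -(ointZ _ _ _ ld).
have lz := loc_intZ (h s) ld; rewrite -(ointB _ _ lh lz).
rewrite -[e]mulr1 -(delta_mass n cs sd) -(ointZ _ _ _ ld).
have le_ := loc_intZ e ld; have lB := loc_intB lh lz.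
have pt t : `|delta_kernel n s t * h t - h s * delta_kernel n s t| <= e * delta_kernel n s t.
  rewrite (mulrC _ (h t)) -mulrBl normrM (ger0_norm (delta_ge0 n s t)).
  have [/andP[t1 t2]|tn] := boolP (s < t < s + n.+1%:R^-1); last first.
    by rewrite (delta_out tn) !mulr0.
  rewrite ler_wpM2r ?delta_ge0// ltW// H// ger0_norm ?subr_ge0 ?(ltW t1)//.
  by move: t2 qn; move: _^-1 => i t2 qn; clear -t2 qn; lra.
rewrite ler_norml -(ointN _ _ le_); apply/andP; split; apply: le_oint => //.
- exact: loc_intN.
- by move=> t _; have := pt t; rewrite ler_norml => /andP[].
- by move=> t _; have := pt t; rewrite ler_norml => /andP[].
Unshelve. all: by end_near. Qed.

Lemma window_slope_limit s t h : s <= t -> continuous h ->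
  oint (fun x => window_slope n s t x * h x) s (t + 1) @[n --> \oo] --> h s - h t.
Proof.
move=> st ch.
have E n : oint (fun x => window_slope n s t x * h x) s (t + 1) =
    oint (fun x => delta_kernel n s x * h x) s (t + 1) - oint (fun x => delta_kernel n t x * h x) s (t + 1).
  rewrite -ointB; last 2 first.
  - exact: loc_bdd_int (loc_bddM (continuous_loc_bdd (@delta_continuous n s)) (continuous_loc_bdd ch)).
  - exact: loc_bdd_int (loc_bddM (continuous_loc_bdd (@delta_continuous n t)) (continuous_loc_bdd ch)).
  by congr oint; apply/funext => x; rewrite mulrBl.
under eq_fun do rewrite E.
by apply: cvgB; apply: delta_limit => //; rewrite lerD2r.
Qed.

Lemma window_limit s t h : s <= t -> loc_bdd h ->
  oint (fun x => window n s t x * h x) s (t + 1) @[n --> \oo] --> oint h s t.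
Proof.
move=> + bh; rewrite le_eqVlt => /predU1P[<-|st'].
  rewrite oint_refl; apply: (@cvg_eventually _ _ _ 0) => n _.
  by rewrite (eq_oint (g := fun=> 0)) ?oint_cst ?mul0r// => x _; rewrite /window subrr mul0r.
have st := ltW st'; have [mh lbh] := bh; have [C hC] := lbh s (t + 1).
have t1 : t <= t + 1 by rewrite lerDl.
have E n : oint (fun x => window n s t x * h x) s (t + 1) =
    oint (fun x => window n s t x * h x) s t + oint (fun x => window n s t x * h x) t (t + 1).
  rewrite oint_cat//; apply: loc_bdd_int; apply: loc_bddM => //.
  exact: continuous_loc_bdd (@window_continuous n s t).
under eq_fun do rewrite E.
have mw n : measurable_fun setT (fun x => window n s t x * h x).
  by apply: measurable_funM => //; exact: continuous_measurable_fun (@window_continuous n s t).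
have bw n x : s <= x <= t + 1 -> `|window n s t x * h x| <= C.
  by move=> /hC hx; rewrite normrM -[C]mul1r; apply: ler_pM => //; exact: window_norm.
have mlt (c : R) : measurable_fun setT (fun x : R => c < x).
  by apply: measurable_fun_ltr; [exact: measurable_cst|exact: measurable_id].
rewrite -[oint h s t]addr0; apply: cvgD.
  (* Every window vanishes at x = s, so the pointwise limit is h only for x > s; the integral
     ignores that end point. *)
  rewrite -(eq_oint_ae (F := fun x => if s < x then h x else 0) st); last 3 first.
  - by apply: measurable_fun_ifT => //; exact: measurable_cst.
  - by [].
  - by apply: aeW => x /= /andP[-> _].
  apply: (oint_dominated (M := C)) => //.
  - move=> n x; rewrite (min_idPl st) (max_idPr st) => /andP[x1 x2].
    by apply: bw; rewrite x1 (le_trans x2).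
  - move=> x; rewrite (min_idPl st) (max_idPr st) => /andP[x1 x2].
    case: ltP => sx; last first.
      by apply: (@cvg_eventually _ _ _ 0) => n _; rewrite /window !cutoff_left ?subrr ?mul0r// (le_trans sx).
    have [n0 H] := eventually_inv (ltac:(by rewrite subr_gt0) : 0 < x - s).
    apply: (@cvg_eventually _ _ _ n0) => n /H xs.
    by rewrite /window cutoff_right// cutoff_left// subr0 mul1r.
  - by apply: measurable_fun_ifT => //; exact: measurable_cst.
rewrite (_ : 0 = oint (fun x => if t < x then 0 else h x) t (t + 1)); last first.
  rewrite (eq_oint_ae (G := fun=> 0) t1) ?oint_cst ?mul0r//.
    by apply: measurable_fun_ifT => //; exact: measurable_cst.
  by apply: aeW => x /= /andP[-> _].
apply: (oint_dominated (M := C)) => //.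
- move=> n x; rewrite (min_idPl t1) (max_idPr t1) => /andP[x1 x2].
  by apply: bw; rewrite x2 (le_trans st).
- move=> x; rewrite (min_idPl t1) (max_idPr t1) => /andP[x1 x2].
  case: ltP => tx.
    have [n0 H] := eventually_inv (ltac:(by rewrite subr_gt0) : 0 < x - t).
    apply: (@cvg_eventually _ _ _ n0) => n /H xs.
    rewrite /window !cutoff_right ?subrr ?mul0r//.
    by apply: le_trans xs _; rewrite lerD2l lerN2.
  have xt : x = t by apply: le_anti; rewrite tx x1.
  rewrite xt.
  have [n0 H] := eventually_inv (ltac:(by rewrite subr_gt0) : 0 < t - s).
  apply: (@cvg_eventually _ _ _ n0) => n /H xs.
  by rewrite /window cutoff_right// cutoff_left// subr0 mul1r.
- by apply: measurable_fun_ifT => //; exact: measurable_cst.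
Qed.

End window.

(** * The balance on rectangles, from smooth test functions *)

Section eulerian_balance.
Context {R : realType}.
Notation mu := (@lebesgue_measure R).
Implicit Types (f h : R -> R) (u g H : R * R -> R) (s t r x a b e M K C : R) (n m : nat).

Lemma oint_param_continuous H a b : a <= b -> continuous H ->
  continuous (fun r => oint (fun x => H (r, x)) a b).
Proof.
move=> ab cH r; apply/cvgrPdist_lt => e e0.
have C0 : 0 < b - a + 1 by clear -ab; lra.
have q0 : 0 < e / (b - a + 1) by rewrite divr_gt0.
have [d d0 hd] := @box_uniform _ H r r a b _ cH q0.
apply/nbhs_ballP; exists d => // r' rr'.
rewrite -ointB; [|exact: loc_int_slice_x..].
apply: (@le_lt_trans _ _ (e / (b - a + 1) * `|b - a|)).
  apply: oint_norm_le; first by apply: loc_intB; exact: loc_int_slice_x.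
  move=> x; rewrite (min_idPl ab) (max_idPr ab) => xx; rewrite distrC; apply/ltW/hd => //.
  - by rewrite lexx.
  - by rewrite distrC.
  - by rewrite subrr normr0.
rewrite ger0_norm ?subr_ge0// mulrAC ltr_pdivrMr// ltr_pM2l//; clear; lra.
Qed.

Lemma supported_bounded H t1 t2 a b : continuous H ->
  (forall t x, ~~ (t1 <= t <= t2) || ~~ (a <= x <= b) -> H (t, x) = 0) ->
  exists K, bdd2 H K.
Proof.
move=> cH H0; have [K K0 HK] := @box_bounded _ H t1 t2 a b cH.
exists K; split; first exact: continuous2_measurable.
move=> [t x]; have [tt|tn] := boolP (t1 <= t <= t2); last first.
  by rewrite H0 ?tn// normr0 ltW.
have [xx|xn] := boolP (a <= x <= b); last by rewrite H0 ?xn ?orbT// normr0 ltW.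
exact: HK.
Qed.

Definition smeared n m s t a b (p : R * R) : R := window n s t p.1 * window m a b p.2.

Lemma smeared_test n m s t a b : s <= t -> a <= b -> test_function setT (smeared n m s t a b).
Proof.
move=> st ab; split.
  apply: smooth2_smooth; apply: smooth2_mul; exact: smooth1_window.
exists (`[s, t + 1] `*` `[a, b + 1]); split => //.
  by apply: compact_setX; exact: segment_compact.
move=> [r x] nK; rewrite /smeared/=.
have [rr|rn] := boolP (s <= r <= t + 1); last by rewrite window_out// mul0r.
have [xx|xn] := boolP (a <= x <= b + 1); last by rewrite (@window_out R m)// mulr0.
by exfalso; apply: nK; split; rewrite /= in_itv.
Qed.

Lemma smeared_derive n m s t a b (v p : R * R) :
  'D_v (smeared n m s t a b) p =
  v.1 * window_slope n s t p.1 * window m a b p.2 + window n s t p.1 * (v.2 * window_slope m a b p.2).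
Proof.
have S := product_slope v (window_slopeP n s t p.1) (window_slopeP m a b p.2).
by have [] := @derive_slope R (R * R)%type (smeared n m s t a b) p v _ S.
Qed.

Lemma fst_continuous h : continuous h -> continuous (fun p : R * R => h p.1).
Proof.
move=> ch p; apply: (@continuous_comp _ _ _ fst h); [exact: cvg_fst|exact: ch].
Qed.

Lemma snd_continuous h : continuous h -> continuous (fun p : R * R => h p.2).
Proof.
move=> ch p; apply: (@continuous_comp _ _ _ snd h); [exact: cvg_snd|exact: ch].
Qed.

Lemma mul_continuous (T : topologicalType) (F G : T -> R) : continuous F -> continuous G ->
  continuous (fun p => F p * G p).
Proof. by move=> cF cG p; exact: (cvgM (cF p) (cG p)). Qed.

Lemma smeared_balance f u g M n m s t a b : continuous f -> continuous u -> bdd2 g M ->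
  Eulerian_source f u g -> s <= t -> a <= b ->
  oint (fun r => window_slope n s t r * oint (fun x => window m a b x * u (r, x)) a (b + 1)
    + window n s t r * oint (fun x => window_slope m a b x * f (u (r, x))) a (b + 1)) s (t + 1) =
  - oint (fun r => window n s t r * oint (fun x => window m a b x * g (r, x)) a (b + 1)) s (t + 1).
Proof.
move=> cf cu bg [_ E] st ab.
have cq : continuous (fun p => f (u p)).
  by move=> p; apply: (@continuous_comp _ _ _ u f); [exact: cu|exact: cf].
have st1 : s <= t + 1 by clear -st; lra.
have ab1 : a <= b + 1 by clear -ab; lra.
have := E _ (smeared_test n m st ab).
pose H (p : R * R) := window_slope n s t p.1 * (window m a b p.2 * u p) +
   window n s t p.1 * (window_slope m a b p.2 * f (u p)).
have cw := @window_continuous R n s t; have cw' := @window_continuous R m a b.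
have cs := @window_slope_continuous R n s t; have cs' := @window_slope_continuous R m a b.
have A1 : continuous (fun p : R * R => window m a b p.2 * u p).
  by apply: mul_continuous => //; exact: snd_continuous cw'.
have A2 : continuous (fun p : R * R => window_slope n s t p.1 * (window m a b p.2 * u p)).
  by apply: mul_continuous => //; exact: fst_continuous cs.
have A3 : continuous (fun p : R * R => window_slope m a b p.2 * f (u p)).
  by apply: mul_continuous => //; exact: snd_continuous cs'.
have A4 : continuous (fun p : R * R => window n s t p.1 * (window_slope m a b p.2 * f (u p))).
  by apply: mul_continuous => //; exact: fst_continuous cw.
have cH : continuous H by move=> p; exact: (cvgD (A2 p) (A4 p)).
have H0 r x : ~~ (s <= r <= t + 1) || ~~ (a <= x <= b + 1) -> H (r, x) = 0.
  rewrite /H /= => /orP[rn|xn].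
    by rewrite (window_out n st rn) (window_slope_out n st rn) !mul0r addr0.
  by rewrite (window_out m ab xn) (window_slope_out m ab xn) !mul0r !mulr0 addr0.
have [K bH] := supported_bounded cH H0.
pose S (p : R * R) := window n s t p.1 * (window m a b p.2 * g p).
have bS : bdd2 S M.
  split.
    apply: measurable_funM; first by apply: continuous2_measurable; exact: fst_continuous.
    apply: measurable_funM; last exact: bg.1.
    by apply: continuous2_measurable; exact: snd_continuous.
  move=> p; rewrite !normrM -[M]mul1r; apply: ler_pM => //; first exact: window_norm.
  by rewrite -[M]mul1r; apply: ler_pM => //; [exact: window_norm|exact: bg.2].
have S0 r x : ~~ (s <= r <= t + 1) || ~~ (a <= x <= b + 1) -> S (r, x) = 0.
  rewrite /S /= => /orP[rn|xn].
    by rewrite (window_out n st rn) !mul0r.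
  by rewrite (window_out m ab xn) !mul0r !mulr0.
have -> : \int[(mu \x mu)%E]_p (u p * 'D_(1, 0) (smeared n m s t a b) p +
    f (u p) * 'D_(0, 1) (smeared n m s t a b) p) = \int[(mu \x mu)%E]_p H p.
  apply: eq_Rintegral => p _; rewrite !smeared_derive /H/=.
  by rewrite !mul1r !mul0r mulr0 addr0 add0r; clear; ring.
have -> : \int[(mu \x mu)%E]_p (g p * smeared n m s t a b p) = \int[(mu \x mu)%E]_p S p.
  by apply: eq_Rintegral => p _; rewrite /S /smeared; clear; ring.
rewrite (integral_oint2 st1 ab1 bH H0) (integral_oint2 st1 ab1 bS S0) => E'.
have sl r h : continuous h -> forall G : R * R -> R, continuous G -> loc_int (fun x => h x * G (r, x)).
  move=> ch G cG; apply: continuous_loc_int; apply: mul_continuous => //.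
  exact: slice_x_continuous.
have -> : (fun r => window_slope n s t r * oint (fun x => window m a b x * u (r, x)) a (b + 1)
    + window n s t r * oint (fun x => window_slope m a b x * f (u (r, x))) a (b + 1)) =
   (fun r => oint (fun x => H (r, x)) a (b + 1)).
  apply/funext => r; have l1 := sl r _ cw' u cu; have l2 := sl r _ cs' (fun p => f (u p)) cq.
  by rewrite -(ointZ _ _ _ l1) -(ointZ _ _ _ l2) -(ointD _ _ (loc_intZ _ l1) (loc_intZ _ l2)).
have -> : (fun r => window n s t r * oint (fun x => window m a b x * g (r, x)) a (b + 1)) =
   (fun r => oint (fun x => S (r, x)) a (b + 1)).
  apply/funext => r; rewrite -ointZ//; apply: loc_bdd_int; apply: loc_bddM.
    exact: continuous_loc_bdd cw'.
  split; first exact: (measurable_fun_pair2 r bg.1).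
  by move=> ? ?; exists M => x _; exact: bg.2.
by move: E'; rewrite /oint2 => <-; rewrite opprK.
Qed.

(** The windows in time and in space are sharpened separately. For a fixed space window the
    integrals of u and f(u) in x are continuous in time, so the time limit can be taken first; the
    space limit then passes under the time integral by dominated convergence. *)
Lemma Eulerian_rect_balance_le f u g M s t a b : continuous f -> continuous u -> bdd2 g M ->
  Eulerian_source f u g -> s <= t -> a <= b ->
  oint (fun x => u (t, x)) a b - oint (fun x => u (s, x)) a b =
  oint (fun r => f (u (r, a)) - f (u (r, b)) + (srcG g r b - srcG g r a)) s t.
Proof.
move=> cf cu bg E st ab.
have cq : continuous (fun p => f (u p)).
  by move=> p; apply: (@continuous_comp _ _ _ u f); [exact: cu|exact: cf].
have ab1 : a <= b + 1 by clear -ab; lra.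
pose U m r := oint (fun x => window m a b x * u (r, x)) a (b + 1).
pose Q m r := oint (fun x => window_slope m a b x * f (u (r, x))) a (b + 1).
pose S m r := oint (fun x => window m a b x * g (r, x)) a (b + 1).
have cU m : continuous (U m).
  apply: (oint_param_continuous (H := fun p => window m a b p.2 * u p) ab1).
  by apply: mul_continuous => //; apply: snd_continuous; exact: window_continuous.
have cQ m : continuous (Q m).
  apply: (oint_param_continuous (H := fun p => window_slope m a b p.2 * f (u p)) ab1).
  by apply: mul_continuous => //; apply: snd_continuous; exact: window_slope_continuous.
have bS m : bdd2 (fun p => window m a b p.2 * g p) M.
  split.
    apply: measurable_funM; last exact: bg.1.
    by apply: continuous2_measurable; apply: snd_continuous; exact: window_continuous.
  move=> p; rewrite normrM -[M]mul1r; apply: ler_pM => //; [exact: window_norm|exact: bg.2].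
have mS m : measurable_fun setT (S m) by exact: (bdd2_inner_measurable a (b + 1) (bS m)).
have SM m r : `|S m r| <= M * `|b + 1 - a| by exact: (bdd2_inner_le r a (b + 1) (bS m)).
have lS m : loc_bdd (S m) by split => // ? ?; exists (M * `|b + 1 - a|) => r _.
have lb (n : nat) h : loc_bdd h -> loc_int (fun r => window n s t r * h r).
  by move=> bh; apply: loc_bdd_int; apply: loc_bddM => //; apply: continuous_loc_bdd; exact: window_continuous.
have step1 m : U m s - U m t + oint (Q m) s t = - oint (S m) s t.
  have lim1 : oint (fun r => window_slope n s t r * U m r + window n s t r * Q m r) s (t + 1)
      @[n --> \oo] --> U m s - U m t + oint (Q m) s t.
    have E1 n : oint (fun r => window_slope n s t r * U m r + window n s t r * Q m r) s (t + 1) =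
        oint (fun r => window_slope n s t r * U m r) s (t + 1) + oint (fun r => window n s t r * Q m r) s (t + 1).
      apply: ointD; last by apply: lb; exact: continuous_loc_bdd (cQ m).
      apply: continuous_loc_int; apply: mul_continuous; [exact: window_slope_continuous|exact: cU].
    under eq_fun do rewrite E1.
    apply: cvgD; first exact: (window_slope_limit st (cU m)).
    exact: (window_limit st (continuous_loc_bdd (cQ m))).
  have lim2 : - oint (fun r => window n s t r * S m r) s (t + 1) @[n --> \oo] --> - oint (S m) s t.
    by apply: cvgN; exact: (window_limit st (lS m)).
  apply: (cvg_unique (@Rhausdorff R) lim1).
  rewrite [X in X @ \oo](_ : _ = (fun n => - oint (fun r => window n s t r * S m r) s (t + 1)))//.
  by apply/funext => n; exact: smeared_balance bg E st ab.
have limU r : U m r @[m --> \oo] --> oint (fun x => u (r, x)) a b.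
  by apply: (window_limit ab); apply: continuous_loc_bdd; exact: slice_x_continuous.
have limQ : oint (Q m) s t @[m --> \oo] --> oint (fun r => f (u (r, a)) - f (u (r, b))) s t.
  have [C C0 HC] := @box_bounded _ (fun p => f (u p)) s t a (b + 1) cq.
  apply: (oint_dominated (M := C + C)).
  - by move=> m; exact: continuous_measurable_fun (cQ m).
  - move=> m r; rewrite (min_idPl st) (max_idPr st) => rr.
    have cr : continuous (fun x => f (u (r, x))) := slice_x_continuous (h := fun p => f (u p)) cq.
    have bq := continuous_loc_bdd cr.
    have d1 := delta_norm m (lexx a) (ltac:(by rewrite lerD2r) : a + 1 <= b + 1) bq (fun x xx => HC r x rr xx).
    have d2 := delta_norm m ab (lexx (b + 1)) bq (fun x xx => HC r x rr xx).
    have bd c := continuous_loc_bdd (@delta_continuous R m c).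
    have -> : Q m r = oint (fun x => delta_kernel m a x * f (u (r, x))) a (b + 1) -
        oint (fun x => delta_kernel m b x * f (u (r, x))) a (b + 1).
      rewrite -ointB; [|exact: loc_bdd_int (loc_bddM (bd a) bq)|exact: loc_bdd_int (loc_bddM (bd b) bq)].
      by congr oint; apply/funext => x; rewrite /window_slope mulrBl.
    apply: (le_trans (ler_normB (oint _ _ _) (oint _ _ _))); exact: (lerD d1 d2).
  - move=> r _; apply: (window_slope_limit ab (h := fun x => f (u (r, x)))).
    exact: (slice_x_continuous (h := fun p => f (u p)) cq).
  - apply: measurable_funB; apply: continuous_measurable_fun.
      exact: (slice_t_continuous (h := fun p => f (u p)) cq).
    exact: (slice_t_continuous (h := fun p => f (u p)) cq).
have limS : oint (S m) s t @[m --> \oo] --> oint (fun r => srcG g r b - srcG g r a) s t.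
  apply: (oint_dominated (M := M * `|b + 1 - a|)) => //.
    move=> r _; rewrite (srcGB _ _ _ bg); apply: (window_limit ab).
    split; first exact: (measurable_fun_pair2 r bg.1).
    by move=> ? ?; exists M => x _; exact: bg.2.
  apply: (eq_measurable_fun (fun r => oint (fun x => g (r, x)) a b)).
    by move=> r _; rewrite (srcGB _ _ _ bg).
  exact: (bdd2_inner_measurable a b bg).
have lim : oint (fun x => u (s, x)) a b - oint (fun x => u (t, x)) a b +
    oint (fun r => f (u (r, a)) - f (u (r, b))) s t = - oint (fun r => srcG g r b - srcG g r a) s t.
  have l1 : U m s - U m t + oint (Q m) s t @[m --> \oo] -->
      oint (fun x => u (s, x)) a b - oint (fun x => u (t, x)) a b +
      oint (fun r => f (u (r, a)) - f (u (r, b))) s t.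
    by apply: cvgD limQ; apply: cvgB; exact: limU.
  have l2 : - oint (S m) s t @[m --> \oo] --> - oint (fun r => srcG g r b - srcG g r a) s t.
    exact: cvgN limS.
  apply: (cvg_unique (@Rhausdorff R) l1).
  rewrite [X in X @ \oo](_ : _ = (fun m => - oint (S m) s t))//.
  by apply/funext => m; exact: step1.
have lq x : loc_int (fun r => f (u (r, x))) by apply: (loc_int_slice_t (h := fun p => f (u p))).
have lG : loc_int (fun r => srcG g r b - srcG g r a).
  rewrite (_ : (fun r => _) = (fun r => oint (fun x => g (r, x)) a b)); last first.
    by apply/funext => r; exact: srcGB bg.
  exact: (bdd2_inner a b bg).
rewrite ointD//; last exact: loc_intB.
move: lim; set A1 := oint _ a b; set A2 := oint _ a b; set A3 := oint _ s t; set A4 := oint _ s t.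
by clear; lra.
Qed.

Lemma Eulerian_rect_balance f u g M : continuous f -> continuous u -> 0 <= M -> bdd2 g M ->
  Eulerian_source f u g -> rect_balance f u (srcG g) M.
Proof.
move=> cf cu M0 bg E.
have cq : continuous (fun p => f (u p)).
  by move=> p; apply: (@continuous_comp _ _ _ u f); [exact: cu|exact: cf].
have mG x : measurable_fun setT (fun t => srcG g t x).
  exact: (srcG_curve_measurable (c := fun=> x) bg (@cst_continuous _ _ x)).
split => //.
  by move=> t x y; rewrite (srcGB _ _ _ bg); exact: bdd2_inner_le.
have lG x y : loc_int (fun r => srcG g r y - srcG g r x).
  apply: (bounded_loc_int (M := M * `|y - x|)); first exact: measurable_funB.
  by move=> r; rewrite (srcGB _ _ _ bg); exact: bdd2_inner_le.
have lq x : loc_int (fun r => f (u (r, x))) by apply: (loc_int_slice_t (h := fun p => f (u p))).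
have lin (A A' X : R) : - A - - A' = X -> A - A' = - X by clear; lra.
have key t1 t2 a b : t1 <= t2 -> oint (fun x => u (t2, x)) a b - oint (fun x => u (t1, x)) a b =
    oint (fun r => f (u (r, a)) - f (u (r, b)) + (srcG g r b - srcG g r a)) t1 t2.
  move=> t12; have /orP[ab|ba] := le_total a b; first exact: (Eulerian_rect_balance_le cf cu bg E t12 ab).
  have := Eulerian_rect_balance_le cf cu bg E t12 ba.
  rewrite (oint_swap (fun x => u (t2, x)) a b) (oint_swap (fun x => u (t1, x)) a b) => E'.
  rewrite (_ : (fun r => f (u (r, a)) - f (u (r, b)) + (srcG g r b - srcG g r a)) =
      (fun r => - (f (u (r, b)) - f (u (r, a)) + (srcG g r a - srcG g r b)))).
    rewrite (ointN _ _ (loc_intD (loc_intB (lq b) (lq a)) (lG b a))).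
    exact: lin E'.
  by apply/funext => r; rewrite opprD !opprB.
move=> t1 t2 a b; have /orP[t12|t21] := le_total t1 t2; first exact: key.
by rewrite [RHS]oint_swap -(key t2 t1 a b t21) opprB.
Qed.

End eulerian_balance.

(** * The common source *)

Section universal_source_Eulerian.
Context {R : realType}.
Notation mu := (@lebesgue_measure R).
Implicit Types (f : R -> R) (u g phi : R * R -> R) (M : R).

Lemma C2_loc_lip f : C2 f -> loc_lip f.
Proof.
move=> f_C2 A; have [d1 _ _] := f_C2; have cf1 := C2_continuous1 f_C2.
have [L L0 HL] := @box_bounded _ (fun p => derive1 f p.1) (- A) A 0 0
  (fun p => continuous_comp (@cvg_fst _ _ _ _ _) (cf1 p.1)).
exists L; first exact: ltW.
move=> x y xA yA; have [c cc ->] := mean_value x y d1; rewrite normrM ler_wpM2r//.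
apply: (HL c 0); last by rewrite lexx.
move: cc xA yA; rewrite ge_min le_max !ler_norml => /andP[/orP[?|?] /orP[?|?]] /andP[? ?] /andP[? ?];
  by apply/andP; split; lra.
Qed.

Lemma measurable_neq (F G : R * R -> R) : measurable_fun setT F -> measurable_fun setT G ->
  measurable [set p | F p != G p].
Proof.
move=> mF mG; rewrite (_ : [set p | F p != G p] = (fun p => F p - G p) @^-1` [set~ 0]).
  by rewrite -[X in measurable X]setTI; apply: (measurable_funB mF mG) => //; exact: measurableC.
by apply/seteqP; split => p /=; rewrite -subr_eq0 => /eqP.
Qed.

Lemma eq_Rintegral_ae (H G : R * R -> R) : measurable_fun setT H -> measurable_fun setT G ->
  (mu \x mu)%E [set p | H p != G p] = 0%E ->
  \int[(mu \x mu)%E]_p H p = \int[(mu \x mu)%E]_p G p.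
Proof.
move=> mH mG HG; rewrite /Rintegral; congr fine; apply: ae_eq_integral => //.
- exact/measurable_EFinP.
- exact/measurable_EFinP.
exists [set p | H p != G p]; split => //.
  exact: (measurable_neq mH mG).
move=> p /= np; apply/negP => /eqP E; apply: np => _; congr EFin; exact: E.
Qed.

(** The two functions can differ only where g oscillates, or where u lies in the inflection set and
    g is not 0. The latter set is null because the cut-off source has integral 0 over every
    rectangle. *)
Lemma universal_source_ae f u g M : C2 f -> rect_balance f u (srcG g) M -> bdd2 g M ->
  mu (clos_Infl f) = 0%E ->
  (mu \x mu)%E [set p | universal_source f u g M p != g p] = 0%E.
Proof.
move=> f_C2 B bg N0; have cu := rb_cont B; have M0 := rb_ge0 B.
have cN := clos_Infl_closed f_C2; have mN : measurable (clos_Infl f) by exact: closed_measurable.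
have bN := bdd2_cutoff M0 mN cu bg.
have N1 := ae_oint2_zero bN (fun t1 t2 a b t12 ab =>
  source_null_levels B bg (C2_loc_lip f_C2) cN N0 t12 ab).
have N2 := oscillating_null bg.
have mg := (universal_source_bdd2 f_C2 cu M0 bg).1.
have m1 := measurable_neq bN.1 (@measurable_cst _ _ _ _ setT (0 : R)).
have m2 : measurable [set p | oscillating g p].
  by have := oscillating_measurable bg measurableT (Y := [set true]); rewrite setTI; apply.
have S : [set p | universal_source f u g M p != g p] `<=`
    [set p | \1_(clos_Infl f) (u p) * g p != 0] `|` [set p | oscillating g p].
  move=> p /=; rewrite /universal_source; case: asboolP => [Np|_].
    by rewrite indicE mem_set// mul1r eq_sym => ?; left.
  by case: ifP => [? _|_]; [right|rewrite eqxx].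
have n1 := proj2 (negligibleP (mu \x mu)%E m1) N1.
have n2 := proj2 (negligibleP (mu \x mu)%E m2) N2.
exact: (proj1 (negligibleP (mu \x mu)%E (measurable_neq mg bg.1))
  (negligibleS (mu := (mu \x mu)%E) S (negligibleU (mu := (mu \x mu)%E) n1 n2))).
Qed.

Lemma Eulerian_source_ae f u g h M : bdd2 h M -> Eulerian_source f u g ->
  (mu \x mu)%E [set p | h p != g p] = 0%E -> Eulerian_source f u h.
Proof.
move=> bh [[[K gK] mg] E] hg; split.
  by split; [exists M; exact: bh.2|exact: bh.1].
move=> phi tphi; rewrite (E phi tphi).
have mphi : measurable_fun setT phi by apply: continuous2_measurable; have [] := tphi.1 [::].
apply: eq_Rintegral_ae.
- exact: (measurable_funM mg mphi).
- exact: (measurable_funM bh.1 mphi).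
apply/eqP; rewrite eq_le measure_ge0 andbT -[leRHS]hg; apply: le_measure; rewrite ?inE.
- exact: (measurable_neq (measurable_funM mg mphi) (measurable_funM bh.1 mphi)).
- exact: (measurable_neq bh.1 mg).
by move=> p /=; apply: contra => /eqP ->.
Qed.

End universal_source_Eulerian.

Theorem theorem3p1 (R : realType) (f : R -> R) (u : R * R -> R)
    (f_C2 : C2 f)
    (u_continuous : continuous u)
    (balance : exists g0 : R * R -> R, Eulerian_source f u g0)
    (Infl_negligible : lebesgue_measure (clos_Infl f) = 0%E) :
  exists g : R * R -> R, Eulerian_source f u g /\ Broad_source f u g.
Proof.
have [g0 E] := balance; have [[[M gM] mg] _] := E.
have M0 : 0 <= M := le_trans (normr_ge0 _) (gM (0, 0)).
have bg : bdd2 g0 M by split.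
have B := Eulerian_rect_balance (C2_continuous f_C2) u_continuous M0 bg E.
have bU := universal_source_bdd2 f_C2 u_continuous M0 bg.
exists (universal_source f u g0 M); split.
  apply: (Eulerian_source_ae bU E).
  exact: universal_source_ae.
split; first by split; [exists M; exact: bU.2|exact: bU.1].
by move=> I gamma cI phi; exact: universal_source_Broad.
Qed.
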